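(* Let $A=(a_{ij}),B=(b_{ij}),C=(c_{ij}),D=(d_{ij}):\mathbb{R}\to\mathbb{R}^{d\times d}$ be continuous bounded functions, and suppose that for some $m>0$ $$\max\big\{|a_{ij}(t)|,|b_{ij}(t)|,|c_{ij}(t)|,|d_{ij}(t)|\big\}\le m\qquad\text{for all } i,j\in\{1,\dots,d\},\ t\in\mathbb{R}.$$ Let $\Phi=\{\Phi_{t,s}\}_{t\ge s}$ be the linear mean-square random dynamical system generated by the linear mean-field stochastic differential equation $$\mathrm{d}X_t=\big(A(t)X_t+B(t)\mathbb{E}X_t\big)\,\mathrm{d}t+\big(C(t)X_t+D(t)\mathbb{E}X_t\big)\,\mathrm{d}W_t .$$ Then the mean-square dichotomy spectrum $\Sigma$ of $\Phi$ is the disjoint union of at most $d(d+1)$ compact intervals $[a_1,b_1],\dots,[a_n,b_n]$ with $a_1\le b_1<a_2\le b_2<\dots<a_n\le b_n$. Furthermore, for each $s\in\mathbb{R}$ there exists a filtration of subspaces $$\{0\}\subsetneq V_1(s)\subsetneq V_2(s)\subsetneq\dots\subsetneq V_n(s)=\mathfrak{X}_s$$ such that for any $i\in\{1,\dots,n\}$, a random variable $X_s\in\mathfrak{X}_s$ belongs to $V_i(s)$ if and only if for any $\varepsilon>0$ there exists $K(\varepsilon)>0$ such that $$\|\Phi_{t,s}X_s\|_{\rm ms}\le K(\varepsilon)e^{(b_i+\varepsilon)(t-s)}\qquad\text{for all } t\ge s.$$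
   Context: Let $\{W_t\}_{t\in\mathbb{R}}$ be a two-sided scalar Wiener process on a complete probability space $(\Omega,\mathcal{F},\mathbb{P})$, and let $\{\mathcal{F}_t\}_{t\in\mathbb{R}}$ be its natural filtration ($\mathcal{F}_t$ is generated by the increments $W_u-W_v$, $v\le u\le t$, and the $\mathbb{P}$-null sets). Put $\mathfrak{X}_t:=L^2(\Omega,\mathcal{F}_t;\mathbb{R}^d)$ with norm $\|X\|_{\rm ms}:=\sqrt{\mathbb{E}|X|^2}$, where $|\cdot|$ is the Euclidean norm. The linear mean-square random dynamical system (MS-RDS) generated by the equation: for $X_s\in\mathfrak{X}_s$ and $t\ge s$, $\Phi_{t,s}X_s:=X_t\in\mathfrak{X}_t$, where $\{X_t\}_{t\ge s}$ is the unique solution with initial value $X_s$ at time $s$, i.e. $X_t\in\mathfrak X_t$ and $$X_t=X_s+\int_s^t\big(A(u)X_u+B(u)\mathbb{E}X_u\big)\mathrm{d}u+\int_s^t\big(C(u)X_u+D(u)\mathbb{E}X_u\big)\mathrm{d}W_u$$ (Itô integral). Each $\Phi_{t,s}:\mathfrak{X}_s\to\mathfrak{X}_t$ is a bounded linear operator. Exponential dichotomy: for $\gamma\in\mathbb{R}$, $\Phi$ admits an exponential dichotomy with growth rate $\gamma$ if there exist constants $K,\alpha>0$ and a time-dependent decomposition into linear subspaces $\mathfrak{X}_t=U_\gamma(t)\oplus S_\gamma(t)$, $t\in\mathbb{R}$, such that $\|\Phi_{t,s}X_s\|_{\rm ms}\le Ke^{(\gamma-\alpha)(t-s)}\|X_s\|_{\rm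 ms}$ for $X_s\in S_\gamma(s)$, $t\ge s$, and $\|\Phi_{t,s}X_s\|_{\rm ms}\ge\frac1Ke^{(\gamma+\alpha)(t-s)}\|X_s\|_{\rm ms}$ for $X_s\in U_\gamma(s)$, $t\ge s$. The mean-square dichotomy spectrum is $\Sigma:=\{\gamma\in\mathbb{R}:\Phi\text{ has no exponential dichotomy with growth rate }\gamma\}$. *)

(* Defs.v *)
From HB Require Import structures.
From mathcomp Require Export all_boot all_order all_algebra.
From mathcomp Require Export all_classical all_reals all_analysis.
Export Order.TTheory GRing.Theory Num.Theory.
Export numFieldNormedType.Exports.

Set Implicit Arguments.
Unset Strict Implicit.
Unset Printing Implicit Defensive.

Local Open Scope classical_set_scope.
Local Open Scope ring_scope.

Section MeanFieldSDE.
Context {disp : measure_display} {T : measurableType disp} {R : realType}.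
Variable P : probability T R.

Definition increment (W : R -> T -> R) (v u : R) (w : T) : R := W u w - W v w.

Record two_sided_wiener (W : R -> T -> R) : Prop := TwoSidedWiener {
  wiener_measurable : forall t, measurable_fun setT (W t) ;
  wiener_start : {ae P, forall w, W 0 w = 0} ;
  wiener_gaussian : forall (v u : R) (E : set R), v < u -> measurable E ->
    P (increment W v u @^-1` E) = normal_prob 0 (Num.sqrt (u - v)) E ;
  wiener_independent : forall (n : nat) (tau : nat -> R) (E : nat -> set R),
    {homo tau : i j / (i <= j)%N >-> i <= j} ->
    (forall k, measurable (E k)) ->
    P (\bigcap_(k in `I_n) increment W (tau k) (tau k.+1) @^-1` E k) =
    (\prod_(k < n) P (increment W (tau k) (tau k.+1) @^-1` E k))%E ;
  wiener_continuous : {ae P, forall w, continuous (fun t => W t w)} }.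

Variable W : R -> T -> R.

(* The sigma-algebra F_t is <<s filtration_gen t >>. *)
Definition filtration_gen (t : R) : set (set T) :=
  [set E | (exists v u (E' : set R), [/\ v <= u, u <= t, measurable E' &
              E = increment W v u @^-1` E'])
           \/ P.-negligible E].

Definition adapted_at (t : R) (f : T -> R) : Prop :=
  measurable_fun [set: g_sigma_algebraType (filtration_gen t)]
    (f : g_sigma_algebraType (filtration_gen t) -> R).

Definition second_moment (f : T -> R) : \bar R := 'E_P[fun w => (f w ^+ 2)%R]%E.

Record step_process := StepProcess {
  step_size : nat ;
  step_grid : nat -> R ;
  step_height : nat -> T -> R }.

Definition step_process_on (s t : R) (e : step_process) : Prop :=
  [/\ step_grid e 0%N = s,
      step_grid e (step_size e) = t,
      forall k, (k < step_size e)%N -> step_grid e k <= step_grid e k.+1 &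
      forall k, (k < step_size e)%N ->
        adapted_at (step_grid e k) (step_height e k) /\
        (second_moment (step_height e k) < +oo)%E].

Definition step_value (e : step_process) (u : R) (w : T) : R :=
  \sum_(k < step_size e)
    step_height e k w * \1_(`]step_grid e k, step_grid e k.+1]) u.

Definition step_integral (e : step_process) (w : T) : R :=
  \sum_(k < step_size e)
    step_height e k w * increment W (step_grid e k) (step_grid e k.+1) w.

(* [I] is a version of the Ito integral of [f] against W over [s, t]. *)
Definition is_ito_integral (s t : R) (f : R -> T -> R) (I : T -> R) : Prop :=
  [/\ measurable_fun (`[s, t] `*` [set: T]) (fun z : R * T => f z.1 z.2),
      forall u, s <= u <= t -> adapted_at u (f u),
      (\int[lebesgue_measure]_(u in `[s, t]) second_moment (f u) < +oo)%E,
      measurable_fun [set: T] I &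
      exists e : nat -> step_process,
      [/\ forall n, step_process_on s t (e n),
          (\int[lebesgue_measure]_(u in `[s, t])
             second_moment (fun w => f u w - step_value (e n) u w)%R)%E
             @[n --> \oo] --> 0%E &
          second_moment (fun w => I w - step_integral (e n) w)
             @[n --> \oo] --> 0%E]].

Section StateSpace.
Variable d : nat.

Definition euclid_norm (x : 'cV[R]_d) : R :=
  Num.sqrt (\sum_(i < d) x i 0 ^+ 2).

(* Random vectors are kept as functions: [X] and [Y] denote the same element of
   L^2 when they agree almost surely, so the zero element of the state space is
   [ms_zero t], and its linear subspaces are those [ms_subspace]s, which contain
   [ms_zero t] and hence are unions of almost-sure classes. *)
Definition ms_space (t : R) : set (T -> 'cV[R]_d) :=
  [set X : T -> 'cV[R]_d | (forall i, adapted_at t (fun w => X w i 0)) /\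
           (second_moment (fun w => euclid_norm (X w)) < +oo)%E].

Definition ms_zero (t : R) : set (T -> 'cV[R]_d) :=
  [set X : T -> 'cV[R]_d | ms_space t X /\ {ae P, forall w, X w = 0}].

Definition ms_norm (X : T -> 'cV[R]_d) : R :=
  Num.sqrt (fine (second_moment (fun w => euclid_norm (X w)))).

Definition mean (X : T -> 'cV[R]_d) : 'cV[R]_d :=
  \col_i fine 'E_P[fun w => (X w i 0)%R]%E.

Definition ms_subspace (t : R) (V : set (T -> 'cV[R]_d)) : Prop :=
  [/\ V `<=` ms_space t,
      ms_zero t `<=` V &
      forall (c : R) X Y, V X -> V Y -> V (fun w => c *: X w + Y w)].

Definition ms_direct_sum (t : R) (U S : set (T -> 'cV[R]_d)) : Prop :=
  [/\ ms_subspace t U, ms_subspace t S,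
      forall Z, ms_space t Z ->
        exists X Y, [/\ U X, S Y & Z = (fun w => X w + Y w)] &
      U `&` S = ms_zero t].

Variables A B C D : R -> 'M[R]_d.

Definition drift (X : R -> T -> 'cV[R]_d) (u : R) (w : T) : 'cV[R]_d :=
  A u *m X u w + B u *m mean (X u).

Definition diffusion (X : R -> T -> 'cV[R]_d) (u : R) (w : T) : 'cV[R]_d :=
  C u *m X u w + D u *m mean (X u).

(* Joint measurability and local square integrability make the pathwise
   Lebesgue integral of the drift meaningful. *)
Definition mf_sde_solution (s : R) (x : T -> 'cV[R]_d)
    (X : R -> T -> 'cV[R]_d) : Prop :=
  [/\ forall t, s <= t -> ms_space t (X t),
      forall i, measurable_fun (`[s, +oo[ `*` [set: T])
        (fun z : R * T => X z.1 z.2 i 0),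
      forall t, s <= t ->
        (\int[lebesgue_measure]_(u in `[s, t])
           second_moment (fun w => euclid_norm (X u w)) < +oo)%E,
      {ae P, forall w, X s w = x w} &
      forall t i, s <= t -> exists I : T -> R,
        is_ito_integral s t (fun u w => diffusion X u w i 0) I /\
        {ae P, forall w, X t w i 0 = x w i 0
           + (\int[lebesgue_measure]_(u in `[s, t]) drift X u w i 0)
           + I w}].

(* [Phi t s] is the evolution operator from time s to time t; only its values
   for s <= t on [ms_space s] are relevant. *)
Definition ms_rds_generated
    (Phi : R -> R -> (T -> 'cV[R]_d) -> (T -> 'cV[R]_d)) : Prop :=
  forall s x, ms_space s x ->
    (exists X, mf_sde_solution s x X) /\
    (forall X, mf_sde_solution s x X -> forall t, s <= t ->
       ms_space t (Phi t s x) /\ {ae P, forall w, Phi t s x w = X t w}).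

Variable Phi : R -> R -> (T -> 'cV[R]_d) -> (T -> 'cV[R]_d).

Definition exponential_dichotomy (gamma : R) : Prop :=
  exists K alpha : R, exists U S : R -> set (T -> 'cV[R]_d),
  [/\ 0 < K, 0 < alpha,
      forall t, ms_direct_sum t (U t) (S t),
      forall s t X, s <= t -> S s X ->
        ms_norm (Phi t s X) <=
          K * expR ((gamma - alpha) * (t - s)) * ms_norm X &
      forall s t X, s <= t -> U s X ->
        ms_norm (Phi t s X) >=
          K^-1 * expR ((gamma + alpha) * (t - s)) * ms_norm X].

Definition dichotomy_spectrum : set R :=
  [set gamma | ~ exponential_dichotomy gamma].

End StateSpace.
End MeanFieldSDE.

(* Main.v *)
From HB Require Import structures.
Require Import Defs.
From mathcomp Require Import ring lra measurable_realfun zify.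

Set Implicit Arguments.
Unset Strict Implicit.
Unset Printing Implicit Defensive.

Local Open Scope classical_set_scope.
Local Open Scope ring_scope.

(** Call a vector X of the state space at time s slow at rate g when the norm of
    its orbit is O(e^(g (t - s))).  Slow vectors at rate g form a subspace that
    grows with g.  If the flow has a dichotomy with growth rate g, its stable space
    at time s must be exactly the space of slow vectors at rate g ([dich_slow]):
    the unstable part of a slow vector would otherwise outgrow it.  Hence the
    stable filtration is intrinsic, it is locally constant on the resolvent set,
    which is open ([ed_open]), and two resolvent rates with the same slow spaces
    enclose only resolvent rates ([ed_between]).  Since the norm of an orbit changes
    at most exponentially in both directions ([phi_growth]), large negative rates
    are in the resolvent set with slow space 0 and large positive ones with slow
    space everything ([ed_low], [ed_high]).  So the resolvent set falls apart into
    intervals, one for each slow filtration that occurs, and the spectrum consists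
    of the compact intervals between consecutive ones; this last step is pure order
    theory ([resolvent_intervals]).  The subspaces V_i are the slow spaces that
    belong to the gap on the right of the i-th spectral interval.

    What has to be shown is that at most d (d + 1) proper inclusions are possible,
    although the state space has infinite dimension.  The reason is that the norm
    of an orbit depends on its initial value X only through E X and E X X^T.  The
    process (X_t, E X_t) solves a linear equation in dimension 2 d with
    deterministic coefficients, so that the matrix G of the second moments of its
    2 d components satisfies a linear differential equation; a linear relation
    between the matrices G of finitely many initial values therefore persists
    ([phi_gram_zero]), and in particular passes to the squared norms of the orbits
    ([phi_moment]).  The symmetric matrices (E X)(E X)^T and E X X^T together are a
    vector with d (d + 1) coordinates ([moments]).  Picking one vector in each
    difference of a chain of slow spaces that is longer than d (d + 1) gives linearly
    dependent moments, and the relation shows that the last vector involved grows as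
    slowly as those before it, which is absurd ([slow_dependent], [chain_bound]).

    The chains are counted at one time, so one also needs that slow spaces of two
    resolvent rates which agree at one time agree at all times
    ([equal_all_times]).  Backwards in time this follows from the invariance of slow
    vectors.  Forwards it is not formal, because the flow is not onto: at a later
    time s there are vectors which depend on noise after time t.  However such a
    vector has the same second moments, hence the same growth, as some vector known
    at time t, built from increments of W before time t ([realization]).  If it were
    slow at the larger rate and in the unstable space of the smaller one, splitting
    it at time t for the larger rate would write it, up to the displacement of size
    O(sqrt (s - t)) caused by the flow between t and s ([phi_small]), as the sum of a
    vector slow at the smaller rate and a vector fast for the larger rate; this
    contradicts the fact that slow and fast vectors form a positive angle
    ([dich_angle], [equal_forward]).

    The differential equation for G is used in integrated form: [local_expansion]
    compares G at the ends of a short interval with an error O((t - s)^(3/2)), and a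
    discrete Gronwall argument sums up the errors.  It rests on the isometry of the
    Ito integral and its orthogonality to the past ([ito_isometry], [ito_orth]),
    which are proved for step processes, from the independence of the increments of
    W from the past ([filtration_indep]), and extended by continuity. *)

(** * Square integrable functions on a probability space *)

Section SquareIntegrable.
Context {disp : measure_display} {T : measurableType disp} {R : realType}.
Variable P : probability T R.

Definition sqint (f : T -> R) : Prop :=
  measurable_fun setT f /\ (second_moment P f < +oo)%E.

Definition ip (f g : T -> R) : R := \int[P]_w (f w * g w).

Definition nrm (f : T -> R) : R := Num.sqrt (ip f f).

Lemma second_momentE f : second_moment P f = (\int[P]_w (f w ^+ 2)%:E)%E.
Proof. by rewrite /second_moment unlock. Qed.

Lemma second_moment_ge0 f : (0 <= second_moment P f)%E.
Proof. by rewrite second_momentE; apply: integral_ge0 => w _; rewrite lee_fin sqr_ge0. Qed.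

Lemma sqintP f : sqint f <->
  measurable_fun setT f /\ P.-integrable setT (EFin \o (fun w => f w ^+ 2)).
Proof.
split=> -[mf]; rewrite ?second_momentE => h; split => //; last first.
  case/integrableP: h => _; rewrite second_momentE.
  by under eq_integral do rewrite /= ger0_norm ?sqr_ge0//.
apply/integrableP; split; first by apply/measurable_EFinP; exact: measurable_funX.
by under eq_integral do rewrite /= ger0_norm ?sqr_ge0//.
Qed.

Lemma sqint_integrableM f g : sqint f -> sqint g ->
  P.-integrable setT (EFin \o (fun w => f w * g w)).
Proof.
move=> /sqintP[mf f2] /sqintP[mg g2].
apply: (@le_integrable _ _ _ P setT measurableT _ ((EFin \o (fun w => (f w ^+ 2)%R)) \+ (EFin \o (fun w => (g w ^+ 2)%R)))%E) => //.
- by apply/measurable_EFinP; exact: measurable_funM.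
- move=> w _ /=; rewrite lee_fin [leRHS]ger0_norm ?addr_ge0 ?sqr_ge0//.
  rewrite normrM.
  have := sqr_ge0 (`|f w| - `|g w|); rewrite sqrrB !real_normK ?num_real// => h.
  have h2 : 0 <= `|f w| * `|g w| by rewrite mulr_ge0.
  lra.
- exact: integrableD.
Qed.

Lemma sqint_cst c : sqint (cst c).
Proof.
split; first exact: measurable_cst.
rewrite second_momentE /= integral_cst//= probability_setT mule1; exact: ltry.
Qed.

Lemma sqint_integrable f : sqint f -> P.-integrable setT (EFin \o f).
Proof.
move=> sf; have := sqint_integrableM sf (sqint_cst 1).
by apply: eq_integrable => // w _ /=; rewrite mulr1.
Qed.

Lemma sqintD f g : sqint f -> sqint g -> sqint (fun w => f w + g w).
Proof.
move=> sf sg; have ifg := sqint_integrableM sf sg.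
move: sf sg => /sqintP[mf f2] /sqintP[mg g2]; apply/sqintP; split.
  exact: measurable_funD.
have -> : EFin \o (fun w => (f w + g w) ^+ 2) = (((EFin \o (fun w => (f w ^+ 2)%R)) \+
   (EFin \o (fun w => (g w ^+ 2)%R))) \+ ((EFin \o (fun w => (f w * g w)%R)) \+ (EFin \o (fun w => (f w * g w)%R))))%E.
  by apply/funext => w /=; rewrite -!EFinD; congr EFin; ring.
by apply: integrableD => //; apply: integrableD.
Qed.

Lemma sqintZ c f : sqint f -> sqint (fun w => c * f w).
Proof.
move=> /sqintP[mf f2]; apply/sqintP; split; first exact: measurable_funM.
have -> : EFin \o (fun w => (c * f w) ^+ 2) =
   (fun w => (c ^+ 2)%:E * (EFin \o (fun w => (f w ^+ 2)%R)) w)%E.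
  by apply/funext => w /=; rewrite -EFinM exprMn.
exact: integrableZl.
Qed.

Lemma sqint_sum (I : Type) (r : seq I) (F : I -> T -> R) :
  (forall i, sqint (F i)) -> sqint (fun w => \sum_(i <- r) F i w).
Proof.
move=> h; elim: r => [|i r ih].
  by under eq_fun do rewrite big_nil; exact: sqint_cst.
by under eq_fun do rewrite big_cons; exact: sqintD.
Qed.

Lemma ipC f g : ip f g = ip g f.
Proof. by apply: eq_Rintegral => w _; rewrite mulrC. Qed.

Lemma ipDl f g h : sqint f -> sqint g -> sqint h ->
  ip (fun w => f w + g w) h = ip f h + ip g h.
Proof.
move=> sf sg sh; rewrite /ip -RintegralD//; try exact: sqint_integrableM.
by apply: eq_Rintegral => w _; rewrite mulrDl.
Qed.

Lemma ipZl c f g : sqint f -> sqint g -> ip (fun w => c * f w) g = c * ip f g.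
Proof.
move=> sf sg; rewrite /ip -RintegralZl//; try exact: sqint_integrableM.
by apply: eq_Rintegral => w _; rewrite mulrA.
Qed.

Lemma ipDr f g h : sqint f -> sqint g -> sqint h ->
  ip h (fun w => f w + g w) = ip h f + ip h g.
Proof. by move=> *; rewrite ipC ipDl// ![ip _ h]ipC. Qed.

Lemma ipZr c f g : sqint f -> sqint g -> ip g (fun w => c * f w) = c * ip g f.
Proof. by move=> *; rewrite ipC ipZl// [ip _ g]ipC. Qed.

Lemma ip0l g : ip (fun=> 0) g = 0.
Proof. by rewrite /ip; under eq_Rintegral do rewrite mul0r; rewrite (Rintegral_cst P measurableT 0) mul0r. Qed.

Lemma ip_cst c c' : ip (cst c) (cst c') = c * c'.
Proof. by rewrite /ip (Rintegral_cst P measurableT (c * c')) /= probability_setT mulr1. Qed.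

Lemma ip_suml (I : Type) (r : seq I) (F : I -> T -> R) g :
  (forall i, sqint (F i)) -> sqint g ->
  ip (fun w => \sum_(i <- r) F i w) g = \sum_(i <- r) ip (F i) g.
Proof.
move=> sF sg; elim: r => [|i r ih].
  by rewrite big_nil; under eq_fun do rewrite big_nil; exact: ip0l.
rewrite big_cons -ih -ipDl//; last exact: sqint_sum.
by congr ip; apply/funext => w; rewrite big_cons.
Qed.

Lemma ip_sumr (I : Type) (r : seq I) (F : I -> T -> R) g :
  (forall i, sqint (F i)) -> sqint g ->
  ip g (fun w => \sum_(i <- r) F i w) = \sum_(i <- r) ip g (F i).
Proof.
by move=> sF sg; rewrite ipC ip_suml//; apply: eq_bigr => i _; rewrite ipC.
Qed.

Lemma ip_ge0 f : 0 <= ip f f.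
Proof. by apply: Rintegral_ge0 => w _; rewrite -expr2 sqr_ge0. Qed.

Lemma second_moment_ip f : sqint f -> second_moment P f = (ip f f)%:E.
Proof.
move=> [mf f2]; rewrite /ip /Rintegral fineK.
  by rewrite second_momentE; apply: eq_integral => w _; rewrite expr2.
under eq_integral do rewrite -expr2.
by rewrite -second_momentE ge0_fin_numE// second_moment_ge0.
Qed.

Lemma ip_ae f f' g g' : measurable_fun setT f -> measurable_fun setT f' ->
  measurable_fun setT g -> measurable_fun setT g' ->
  {ae P, forall w, f w = f' w} -> {ae P, forall w, g w = g' w} ->
  ip f g = ip f' g'.
Proof.
move=> mf mf' mg mg' ff gg; rewrite /ip /Rintegral; congr fine.
apply: ae_eq_integral => //; try by apply/measurable_EFinP; exact: measurable_funM.
by apply: filterS2 ff gg => w -> ->.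
Qed.

Lemma ipBB f g : sqint f -> sqint g ->
  ip (fun w => f w - g w) (fun w => f w - g w) = ip f f - 2 * ip f g + ip g g.
Proof.
move=> sf sg.
have E : (fun w => f w - g w) = (fun w => f w + (-1) * g w).
  by apply/funext => w; rewrite mulN1r.
have sg' := sqintZ (-1) sg.
rewrite E ipDl//; last exact: sqintD.
rewrite !ipDr// !ipZl// !ipZr// (ipC g f); ring.
Qed.

Lemma ipDD f g : sqint f -> sqint g ->
  ip (fun w => f w + g w) (fun w => f w + g w) = ip f f + 2 * ip f g + ip g g.
Proof.
move=> sf sg; rewrite ipDl//; last exact: sqintD.
rewrite !ipDr// (ipC g f); ring.
Qed.

(** The discriminant of the nonnegative quadratic polynomial c -> |f + c g|^2; if
    |g| = 0 the polynomial is affine, hence constant. *)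
Lemma ip_CS f g : sqint f -> sqint g -> `|ip f g| <= nrm f * nrm g.
Proof.
move=> sf sg.
have key c : 0 <= ip f f + 2 * c * ip f g + c ^+ 2 * ip g g.
  have := ip_ge0 (fun w => f w + c * g w).
  rewrite ipDD//; last exact: sqintZ.
  rewrite ipZl//; last exact: sqintZ.
  by rewrite !ipZr// expr2 -!mulrA.
have f0 := ip_ge0 f; have g0 := ip_ge0 g.
rewrite /nrm -sqrtrM// -sqrtr_sqr ler_sqrt; last exact: mulr_ge0.
move: key; set x := ip f f; set y := ip g g; set z := ip f g => key.
have [y0|y0] := eqVneq y 0.
  have [->|z0] := eqVneq z 0; first by rewrite expr0n/= mulr_ge0.
  have := key (- (x + 1) / (2 * z)).
  rewrite y0 mulr0 addr0.
  have -> : 2 * (- (x + 1) / (2 * z)) * z = - (x + 1) by field.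
  by lra.
have yp : 0 < y by rewrite lt_def y0.
have := key (- z / y).
have -> : x + 2 * (- z / y) * z + (- z / y) ^+ 2 * y = (x * y - z ^+ 2) / y by field.
by rewrite pmulr_lge0 ?invr_gt0// subr_ge0.
Qed.

Lemma nrm_ge0 f : 0 <= nrm f. Proof. exact: sqrtr_ge0. Qed.

Lemma sqr_nrm f : nrm f ^+ 2 = ip f f.
Proof. by rewrite sqr_sqrtr// ip_ge0. Qed.

Lemma nrmD f g : sqint f -> sqint g -> nrm (fun w => f w + g w) <= nrm f + nrm g.
Proof.
move=> sf sg; rewrite -ler_sqr ?nnegrE ?addr_ge0 ?nrm_ge0//.
rewrite sqrrD !sqr_nrm ipDD//.
have := le_trans (ler_norm _) (ip_CS sf sg); lra.
Qed.

Lemma nrmZ c f : sqint f -> nrm (fun w => c * f w) = `|c| * nrm f.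
Proof.
move=> sf; rewrite /nrm ipZl//; last exact: sqintZ.
by rewrite ipZr// mulrA -expr2 sqrtrM ?sqr_ge0// sqrtr_sqr.
Qed.

Lemma nrm_eq0_ae f : sqint f -> nrm f = 0 -> {ae P, forall w, f w = 0}.
Proof.
move=> sf /eqP; rewrite sqrtr_eq0 => h.
have {h} h : ip f f = 0 by apply/eqP; rewrite eq_le h ip_ge0.
have := second_moment_ip sf; rewrite h second_momentE => h2.
have mf2 : measurable_fun setT (fun w => (f w ^+ 2)%:E).
  by apply/measurable_EFinP; apply: measurable_funX; case: sf.
have : (\int[P]_w `|(f w ^+ 2)%:E| = 0)%E.
  by rewrite -[RHS]h2; apply: eq_integral => w _; rewrite /= ger0_norm ?sqr_ge0.
move/(ae_eq_integral_abs P measurableT mf2).1.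
by apply: filterS => w /(_ I) [] /eqP; rewrite sqrf_eq0 => /eqP.
Qed.

End SquareIntegrable.

(** * Independence *)

Section Independence.
Context {disp : measure_display} {T : measurableType disp} {R : realType}.
Variable P : probability T R.

(** Both sides are finite measures of E, namely the restriction of P to F and a
    multiple of P, so they agree on the sigma-algebra as soon as they agree on an
    intersection-stable family of generators. *)
Lemma indep_generated (G : set (set T)) (F : set T) :
  setI_closed G -> G setT -> G `<=` measurable -> measurable F ->
  (forall E, G E -> P (E `&` F) = (P E * P F)%E) ->
  forall E, <<s G >> E -> P (E `&` F) = (P E * P F)%E.
Proof.
move=> GI GT Gm mF GF E sE.
have PF : 0 <= fine (P F) by apply: fine_ge0.
have NE A : mscale (NngNum PF) P A = (P A * P F)%E.
  by rewrite /mscale/= fineK ?fin_num_measure// muleC.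
rewrite -NE -[LHS]/(mrestr P mF E).
apply: (@g_sigma_algebra_measure_unique _ R _ G Gm (fun=> setT)) => //.
- by rewrite bigcup_const//; exists 0%N.
- by move=> A GA; rewrite [RHS]NE; exact: GF.
- move=> k; apply: (@le_lt_trans _ _ 1%E); last exact: ltry.
  by apply: probability_le1; exact: measurableI.
Qed.

(** Independence says that the law of the pair is the product of the laws; the
    identity is Fubini's theorem for the function (s, t) -> s t. *)
Lemma indep_expectation (x y : T -> R) :
  measurable_fun setT x -> measurable_fun setT y ->
  (forall A B, measurable A -> measurable B ->
    P ((x @^-1` A) `&` (y @^-1` B)) = (P (x @^-1` A) * P (y @^-1` B))%E) ->
  P.-integrable setT (EFin \o x) -> P.-integrable setT (EFin \o y) ->
  P.-integrable setT (EFin \o (fun w => x w * y w)) /\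
  \int[P]_w (x w * y w) = (\int[P]_w x w) * (\int[P]_w y w).
Proof.
move=> mx my xy ix iy.
pose X : {mfun T >-> R} := HB.pack x (isMeasurableFun.Build _ _ _ _ x mx).
pose Y : {mfun T >-> R} := HB.pack y (isMeasurableFun.Build _ _ _ _ y my).
have mxy : measurable_fun setT (fun w => (x w, y w)) by exact: measurable_fun_pair.
pose XY : {mfun T >-> (R * R)%type} := HB.pack (fun w => (x w, y w))
   (isMeasurableFun.Build _ _ _ _ (fun w => (x w, y w)) mxy).
pose m1 := distribution P X; pose m2 := distribution P Y.
pose m12 := distribution P XY.
have E : forall Z, measurable Z -> (m1 \x m2)%E Z = m12 Z.
  apply: product_measure_unique => A B mA mB.
  exact: xy.
pose f (z : R * R) := (z.1 * z.2)%:E.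
have mf : measurable_fun setT f.
  by apply/measurable_EFinP; apply: measurable_funM.
have mabs : measurable_fun [set: R] (fun y : R => `|y|%:E).
  by apply/measurable_EFinP; exact: normr_measurable.
have mEF : measurable_fun [set: R] (fun y : R => y%:E).
  by apply/measurable_EFinP; exact: measurable_id.
have iabs z (Z : {mfun T >-> R}) : z = Z :> (T -> R) -> P.-integrable setT (EFin \o z) ->
    (\int[distribution P Z]_t `|t|%:E = \int[P]_w `|z w|%:E)%E.
  by move=> -> _; rewrite ge0_integral_distribution.
have intf : (m1 \x m2)%E.-integrable setT f.
  apply/integrable12ltyP => //.
  have inner s : (\int[m2]_t `|f (s, t)| = `|s|%:E * \int[P]_w `|y w|%:E)%E.
    rewrite -(iabs y Y)// -ge0_integralZl//.
    by apply: eq_integral => t _; rewrite /f/= normrM.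
  under eq_integral do rewrite inner.
  have yf : (\int[P]_w `|y w|%:E)%E \is a fin_num.
    rewrite ge0_fin_numE; last by apply: integral_ge0 => w _; rewrite lee_fin.
    by case/integrableP: iy.
  rewrite /= -(fineK yf) ge0_integralZr//; last first.
    by apply: fine_ge0; apply: integral_ge0 => w _; rewrite lee_fin.
  rewrite (iabs x X)// fineK// lte_mul_pinfty//.
  - by apply: integral_ge0 => w _; rewrite lee_fin.
  - rewrite ge0_fin_numE; last by apply: integral_ge0 => w _; rewrite lee_fin.
    by case/integrableP: ix.
  - by move: yf; rewrite ge0_fin_numE//; apply: integral_ge0 => w _; rewrite lee_fin.
have imu : P.-integrable setT (f \o XY).
  apply/integrableP; split; first by apply: measurableT_comp.
  case/integrableP: intf => _.
  rewrite (eq_measure_integral m12); last by move=> A mA _; exact: E.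
  rewrite /m12 ge0_integral_distribution//.
  exact: measurableT_comp.
split; first exact: imu.
rewrite /Rintegral.
have -> : (\int[P]_w (x w * y w)%:E = \int[m1]_s \int[m2]_t f (s, t))%E.
  rewrite (integral12_prod_meas1 intf).
  rewrite (eq_measure_integral m12); last by move=> A mA _; exact: E.
  by rewrite /m12 integral_distribution.
have yfin : (\int[P]_w (y w)%:E)%E \is a fin_num by exact: integrable_fin_num.
have xfin : (\int[P]_w (x w)%:E)%E \is a fin_num by exact: integrable_fin_num.
have iy2 : m2.-integrable setT EFin.
  apply/integrableP; split => //.
  by rewrite (iabs y Y)//; case/integrableP: iy.
have ix1 : m1.-integrable setT EFin.
  apply/integrableP; split => //.
  by rewrite (iabs x X)//; case/integrableP: ix.
have -> : (\int[m1]_s \int[m2]_t f (s, t) = \int[m1]_s (s%:E * \int[P]_w (y w)%:E))%E.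
  apply: eq_integral => s _; rewrite /f/=.
  under eq_integral do rewrite EFinM.
  by rewrite integralZl// integral_distribution.
rewrite -(fineK yfin) integralZr// fineM//; last first.
  by apply: integrable_fin_num.
congr (fine _ * _).
by rewrite integral_distribution.
Qed.

End Independence.

(** * The Brownian filtration *)

Section Filtration.
Context {disp : measure_display} {T : measurableType disp} {R : realType}.
Variable P : probability T R.
Variable W : R -> T -> R.
Hypothesis Pc : measure_is_complete P.
Hypothesis hW : two_sided_wiener P W.

Let mW t : measurable_fun setT (W t). Proof. exact: (wiener_measurable hW). Qed.

Lemma measurable_increment v u : measurable_fun setT (increment W v u).
Proof. exact: measurable_funB. Qed.

Lemma filtration_gen_measurable t : filtration_gen P W t `<=` measurable.
Proof.
move=> E [[v [u [E' [_ _ mE' ->]]]]|]; last exact: Pc.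
by rewrite -[X in measurable X]setTI; exact: measurable_increment.
Qed.

Lemma filtration_measurable t : <<s filtration_gen P W t >> `<=` measurable.
Proof.
apply: smallest_sub; last exact: filtration_gen_measurable.
exact: sigma_algebra_measurable.
Qed.

Lemma filtration_mono s t : s <= t ->
  <<s filtration_gen P W s >> `<=` <<s filtration_gen P W t >>.
Proof.
move=> st; apply: sub_sigma_algebra2 => E [[v [u [E' [vu us mE' ->]]]]|nE].
  by left; exists v, u, E'; split => //; exact: le_trans us st.
by right.
Qed.

Lemma adaptedP t f : adapted_at P W t f <->
  forall E, measurable E -> <<s filtration_gen P W t >> (f @^-1` E).
Proof.
split=> h.
  by move=> E mE; have := h measurableT E mE; rewrite setTI.
by move=> _ E mE; rewrite setTI; exact: h.
Qed.

Lemma adapted_measurable t f : adapted_at P W t f -> measurable_fun setT f.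
Proof.
move=> /adaptedP h _ E mE; rewrite setTI.
exact: (@filtration_measurable t _ (h _ mE)).
Qed.

Lemma adapted_mono s t f : s <= t -> adapted_at P W s f -> adapted_at P W t f.
Proof.
move=> st /adaptedP h; apply/adaptedP => E mE; exact: filtration_mono (h _ mE).
Qed.

Lemma adapted_cst t c : adapted_at P W t (cst c).
Proof. exact: measurable_cst. Qed.

Lemma adaptedD t f g : adapted_at P W t f -> adapted_at P W t g ->
  adapted_at P W t (fun w => f w + g w).
Proof. by move=> hf hg; exact: measurable_funD. Qed.

Lemma adaptedZ t c f : adapted_at P W t f -> adapted_at P W t (fun w => c * f w).
Proof. by move=> hf; apply: measurable_funM => //; exact: measurable_cst. Qed.

Lemma adaptedM t f g : adapted_at P W t f -> adapted_at P W t g ->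
  adapted_at P W t (fun w => f w * g w).
Proof. by move=> hf hg; exact: measurable_funM. Qed.

Lemma adapted_sum t (I : Type) (r : seq I) (F : I -> T -> R) :
  (forall i, adapted_at P W t (F i)) ->
  adapted_at P W t (fun w => \sum_(i <- r) F i w).
Proof.
move=> h; elim: r => [|i r ih].
  by under eq_fun do rewrite big_nil; exact: adapted_cst.
by under eq_fun do rewrite big_cons; exact: adaptedD.
Qed.

Lemma adapted_increment v u t : v <= u -> u <= t ->
  adapted_at P W t (increment W v u).
Proof.
move=> vu ut; apply/adaptedP => E mE; apply: sub_sigma_algebra.
by left; exists v, u, E.
Qed.

Definition grid_gen (s : seq R) : set (set T) :=
  [set E | exists v u E', [/\ v \in s, u \in s, measurable E' &
              E = increment W v u @^-1` E']].

Section Grid.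
Variables (n : nat) (tau : nat -> R).
Hypothesis tau_homo : {homo tau : i j / (i <= j)%N >-> i <= j}.

(** The independence axiom of the Wiener process speaks of increments along one
    monotone grid; these events form an intersection-stable family. *)
Definition grid_rect : set (set T) :=
  [set E | exists Es : nat -> set R, (forall k, measurable (Es k)) /\
     E = \bigcap_(k in `I_n) increment W (tau k) (tau k.+1) @^-1` Es k].

Lemma grid_rectI : setI_closed grid_rect.
Proof.
move=> _ _ [E1 [m1 ->]] [E2 [m2 ->]].
exists (fun k => E1 k `&` E2 k); split; first by move=> k; exact: measurableI.
apply/seteqP; split => w /=.
  by move=> [h1 h2] k kn; split; [exact: h1|exact: h2].
by move=> h; split => k kn; case: (h k kn).
Qed.

Lemma grid_rectT : grid_rect setT.
Proof. by exists (fun=> setT); split => //; apply/seteqP; split. Qed.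

Lemma grid_rect_measurable : grid_rect `<=` measurable.
Proof.
move=> _ [Es [mE ->]]; apply: fin_bigcap_measurable => // k _.
by rewrite -[X in measurable X]setTI; exact: measurable_increment.
Qed.

(** The grid is prolonged by the point b, and the increment over the new last cell
    is tested against B. *)
Lemma grid_rect_indep b B : tau n <= b -> measurable B ->
  forall E, <<s grid_rect >> E ->
  P (E `&` increment W (tau n) b @^-1` B) =
  (P E * P (increment W (tau n) b @^-1` B))%E.
Proof.
move=> nb mB; apply: indep_generated.
- exact: grid_rectI.
- exact: grid_rectT.
- exact: grid_rect_measurable.
- by rewrite -[X in measurable X]setTI; exact: measurable_increment.
move=> _ [Es [mE ->]].
pose tau' k := if (k <= n)%N then tau k else b.
pose E' k := if (k < n)%N then Es k else B.
have htau' : {homo tau' : i j / (i <= j)%N >-> i <= j}.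
  move=> i j ij; rewrite /tau'; case: (leqP j n) => jn.
    by rewrite (leq_trans ij jn); exact: tau_homo.
  by case: ifP => // i_n; exact: le_trans (tau_homo i_n) nb.
have mE' k : measurable (E' k) by rewrite /E'; case: ifP.
have tE k : (k < n)%N -> increment W (tau' k) (tau' k.+1) @^-1` E' k =
   increment W (tau k) (tau k.+1) @^-1` Es k.
  by move=> kn; rewrite /tau' /E' (ltnW kn) kn.
have := wiener_independent hW n.+1 htau' mE'.
rewrite big_ord_recr/=.
have -> : \bigcap_(k in `I_n.+1) increment W (tau' k) (tau' k.+1) @^-1` E' k =
  (\bigcap_(k in `I_n) increment W (tau k) (tau k.+1) @^-1` Es k)
   `&` increment W (tau n) b @^-1` B.
  apply/seteqP; split => w /=.
    move=> h; split.
      move=> k kn; suff : (increment W (tau' k) (tau' k.+1) @^-1` E' k) w.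
        by rewrite (tE k kn).
      by apply: h; exact: ltnW.
    by have := h n (ltnSn n); rewrite /preimage/= /tau' /E' leqnn ltnn.
  move=> [h1 h2] k /=; rewrite ltnS leq_eqVlt => /orP[/eqP->|kn].
    by rewrite /tau' /E' leqnn ltnn.
  suff : (increment W (tau k) (tau k.+1) @^-1` Es k) w by rewrite -(tE k kn).
  exact: h1.
move=> ->; congr (_ * P _)%E; last by rewrite /tau' /E' leqnn !ltnn.
rewrite (wiener_independent hW n tau_homo mE).
by apply: eq_bigr => k _; rewrite tE.
Qed.

(** An increment between any two points of the grid is a difference of sums of
    consecutive increments. *)
Lemma grid_gen_rect (s : seq R) :
  (forall v, v \in s -> exists2 k, (k <= n)%N & v = tau k) ->
  grid_gen s `<=` <<s grid_rect >>.
Proof.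
move=> sub _ [v [u [E [vs us mE ->]]]].
have [i i_n ->] := sub v vs; have [j jn ->] := sub u us.
pose GT : measurableType _ := g_sigma_algebraType grid_rect.
have mi k : (k <= n)%N -> measurable_fun [set: GT] (increment W (tau 0%N) (tau k) : GT -> R).
  elim: k => [_|k ih kn].
    have -> : increment W (tau 0%N) (tau 0%N) = cst 0.
      by apply/funext => w; rewrite /increment subrr.
    exact: measurable_cst.
  have -> : increment W (tau 0%N) (tau k.+1) =
     (fun w => increment W (tau 0%N) (tau k) w + increment W (tau k) (tau k.+1) w).
    by apply/funext => w; rewrite /increment; ring.
  apply: measurable_funD; first exact: (ih (ltnW kn)).
  move=> _ A mA; rewrite setTI; apply: sub_sigma_algebra.
  exists (fun i => if i == k then A else setT); split.
    by move=> l; case: ifP.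
  apply/seteqP; split => w /=.
    by move=> h l _; case: eqP => // ->.
  by move=> /(_ k kn); rewrite /= eqxx.
have -> : increment W (tau i) (tau j) =
  (fun w => increment W (tau 0%N) (tau j) w - increment W (tau 0%N) (tau i) w).
  by apply/funext => w; rewrite /increment; ring.
have := measurable_funB (mi j jn) (mi i i_n).
by move=> /(_ measurableT E mE); rewrite setTI.
Qed.

End Grid.

Lemma grid_gen_indep (s : seq R) a b B : all (<= a) s -> a <= b -> measurable B ->
  forall E, <<s grid_gen s >> E ->
  P (E `&` increment W a b @^-1` B) = (P E * P (increment W a b @^-1` B))%E.
Proof.
move=> sa ab mB E sE.
pose s' := sort <=%O s.
pose tau := nth a s'.
pose n := size s'.
have tn : tau n = a by rewrite /tau nth_default.
have le_a k : tau k <= a.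
  have [kn|kn] := ltnP k n; last by rewrite /tau nth_default.
  by move/allP: sa; apply; rewrite -(mem_sort <=%O); exact: mem_nth.
have htau : {homo tau : i j / (i <= j)%N >-> i <= j}.
  move=> i j ij; have [jn|jn] := ltnP j n; last first.
    by rewrite {2}/tau [leRHS]nth_default.
  have ss : sorted <=%O s' by apply: sort_sorted; exact: le_total.
  apply: (sorted_leq_nth le_trans lexx) => //.
  by rewrite inE; exact: leq_ltn_trans ij jn.
have sub v : v \in s -> exists2 k, (k <= n)%N & v = tau k.
  rewrite -(mem_sort <=%O) => vs; exists (index v s').
    by rewrite index_size.
  by rewrite /tau nth_index.
rewrite -{1 2}tn; apply: (grid_rect_indep htau) => //; first by rewrite tn.
by apply: smallest_sub sE; [exact: smallest_sigma_algebra|exact: grid_gen_rect].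
Qed.

Lemma grid_gen_measurable s : <<s grid_gen s >> `<=` measurable.
Proof.
apply: smallest_sub; first exact: sigma_algebra_measurable.
move=> _ [v [u [E' [_ _ mE' ->]]]].
by rewrite -[X in measurable X]setTI; exact: measurable_increment.
Qed.

Lemma measure_eq_negligible E G : measurable E -> measurable G ->
  P.-negligible ((E `\` G) `|` (G `\` E)) -> P E = P G.
Proof.
move=> mE mG nEG.
have nE : P (E `\` G) = 0.
  by apply: measure_negligible; [exact: measurableD|apply: negligibleS nEG; left].
have nG : P (G `\` E) = 0.
  by apply: measure_negligible; [exact: measurableD|apply: negligibleS nEG; right].
have split A B : measurable A -> measurable B -> P A = (P (A `\` B) + P (A `&` B))%E.
  by move=> mA mB; exact: measureDI.
by rewrite (split E G)// (split G E)// nE nG setIC.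
Qed.

(** The generators of the sigma-algebra at time a (increments before a and
    negligible sets) are not stable under intersection.  The proof uses a larger
    family that is: the events which differ by a negligible set from an event
    determined by finitely many increments before a. *)
Lemma filtration_indep a b B E : a <= b -> measurable B ->
  <<s filtration_gen P W a >> E ->
  P (E `&` increment W a b @^-1` B) = (P E * P (increment W a b @^-1` B))%E.
Proof.
move=> ab mB sE.
pose H : set (set T) := [set E | measurable E /\ exists s G,
  [/\ all (<= a) s, <<s grid_gen s >> G & P.-negligible ((E `\` G) `|` (G `\` E))]].
have mF : measurable (increment W a b @^-1` B).
  by rewrite -[X in measurable X]setTI; exact: measurable_increment.
apply: (@indep_generated _ _ _ P H) => //.
- move=> E1 E2 [m1 [s1 [G1 [a1 g1 n1]]]] [m2 [s2 [G2 [a2 g2 n2]]]].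
  split; first exact: measurableI.
  exists (s1 ++ s2), (G1 `&` G2); split.
  + by rewrite all_cat a1.
  + pose GT : measurableType _ := g_sigma_algebraType (grid_gen (s1 ++ s2)).
    apply: (@measurableI _ GT).
      apply: sub_sigma_algebra2 g1 => _ [v [u [E' [vs us mE' ->]]]].
      by exists v, u, E'; split; rewrite // mem_cat ?vs ?us.
    apply: sub_sigma_algebra2 g2 => _ [v [u [E' [vs us mE' ->]]]].
    by exists v, u, E'; split; rewrite // mem_cat ?vs ?us orbT.
  + apply: negligibleS (negligibleU n1 n2) => w /= [[[h1 h2] h]|[[h1 h2] h]].
      have [g|g] := pselect (G1 w); last by left; left.
      by right; left; split => // ?; apply: h.
    have [g|g] := pselect (E1 w); last by left; right.
    by right; right; split => // ?; apply: h.
- split; first exact: measurableT.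
  exists [::], setT; split => //.
    pose GT : measurableType _ := g_sigma_algebraType (grid_gen [::]).
    exact: (@measurableT _ GT).
  by rewrite setDv setU0; exact: negligible_set0.
- by move=> ? [].
- move=> E0 [mE0 [s [G [sa sG nG]]]].
  have mG := grid_gen_measurable sG.
  rewrite (measure_eq_negligible mE0 mG nG).
  rewrite -(grid_gen_indep sa ab mB sG).
  apply: measure_eq_negligible; try exact: measurableI.
  apply: negligibleS nG => w /= [[[h1 h2] h]|[[h1 h2] h]].
    by left; split => // ?; apply: h.
  by right; split => // ?; apply: h.
- apply: sub_sigma_algebra2 sE => E0 hE0; split.
    exact: filtration_gen_measurable hE0.
  case: hE0 => [[v [u [E' [vu ua mE' ->]]]]|nE].
    exists [:: v; u], (increment W v u @^-1` E'); split.
    + by rewrite /= ua (le_trans vu ua).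
    + apply: sub_sigma_algebra; exists v, u, E'; split => //.
        by rewrite inE eqxx.
      by rewrite !inE eqxx orbT.
    + by rewrite setDv setU0; exact: negligible_set0.
  exists [::], set0; split => //; first exact: sigma_algebra0.
  by rewrite setD0 set0D setU0.
Qed.

End Filtration.

(** * Moments of the normal law *)

Section NormalMoments.
Context {R : realType}.
Local Notation mu := (@lebesgue_measure R).

Lemma integral_normal_prob_fin m sigma (f : R -> \bar R) :
  measurable_fun setT f -> (\int[normal_prob m sigma]_x `|f x| < +oo)%E ->
  (\int[normal_prob m sigma]_x f x = \int[mu]_x (f x * (normal_pdf m sigma x)%:E))%E.
Proof.
move=> mf finf.
rewrite -(Radon_Nikodym_change_of_variables (normal_prob_dominates m sigma))//=; last first.
  by apply/integrableP; split.
apply: ae_eq_integral => //.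
- apply: emeasurable_funM => //; apply: (measurable_int mu).
  by apply: Radon_Nikodym_integrable => /=; exact: normal_prob_dominates.
- apply: emeasurable_funM => //=; apply/measurableT_comp => //=.
  exact: measurable_normal_pdf.
- apply: ae_eqe_mul2l => /=.
  rewrite Radon_NikodymE//=; first exact: normal_prob_dominates.
  move=> dom; case: cid => /= h [h1 h2 h3].
  apply: integral_ae_eq => //=.
  + by apply/measurableT_comp =>//; exact: measurable_normal_pdf.
  + by move=> E _ mE; rewrite -h3.
Qed.

(** Monotone convergence from the truncations of f, for which the density formula
    holds because they are bounded. *)
Lemma ge0_integral_normal_prob m sigma (f : R -> R) :
  measurable_fun setT f -> (forall x, 0 <= f x) ->
  (\int[normal_prob m sigma]_x (f x)%:E = \int[mu]_x (f x * normal_pdf m sigma x)%:E)%E.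
Proof.
move=> mf f0.
pose g n x : \bar R := (Num.min (f x) n%:R)%:E.
have mg n : measurable_fun setT (g n).
  by apply/measurable_EFinP; apply: measurable_minr.
have g0 n x : (0 <= g n x)%E by rewrite lee_fin le_min f0 ler0n.
have ndg x : {homo g^~ x : a b / (a <= b)%N >-> (a <= b)%E}.
  move=> a b ab; rewrite lee_fin le_min ge_min lexx/= ge_min.
  by apply/orP; right; rewrite ler_nat.
have lg x : g ^~ x @ \oo --> (f x)%:E.
  apply: cvg_near_cst; near=> n; rewrite /g min_l//.
  by near: n; exact: nbhs_infty_ger.
have mpdf : measurable_fun setT (fun x => (normal_pdf m sigma x)%:E).
  by apply/measurable_EFinP; exact: measurable_normal_pdf.
have := @cvg_monotone_convergence _ _ _ (normal_prob m sigma) setT measurableT g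
  (fun n => mg n) (fun n x _ => g0 n x) (fun x _ => ndg x).
have -> : (\int[normal_prob m sigma]_x lim (g^~ x @ \oo) = \int[normal_prob m sigma]_x (f x)%:E)%E.
  by apply: eq_integral => x _; apply/cvg_lim.
move=> c1.
have := @cvg_monotone_convergence _ _ _ mu setT measurableT
  (fun n x => g n x * (normal_pdf m sigma x)%:E)%E.
have -> : (\int[mu]_x lim ((g n x * (normal_pdf m sigma x)%:E)%E @[n --> \oo])
    = \int[mu]_x (f x * normal_pdf m sigma x)%:E)%E.
  apply: eq_integral => x _; apply/cvg_lim => //.
  rewrite EFinM; apply: cvgeZr => //.
move=> c2.
have {}c2 := c2 (fun n => emeasurable_funM (mg n) mpdf)
  (fun n x _ => mule_ge0 (g0 n x) _).
have E : (fun n => \int[normal_prob m sigma]_x g n x)%E =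
         (fun n => \int[mu]_x (g n x * (normal_pdf m sigma x)%:E))%E.
  apply/funext => n; apply: integral_normal_prob_fin => //.
  apply: (@le_lt_trans _ _ (\int[normal_prob m sigma]_x (cst n%:R%:E x))%E).
    apply: ge0_le_integral => //=.
    - by apply/measurable_EFinP; apply: measurableT_comp => //; apply: measurable_minr.
    - by move=> x _; rewrite lee_fin ger0_norm ?le_min ?f0//= ge_min lexx orbT.
  by rewrite integral_cst//= [X in (_ * X)%E]integral_normal_pdf mule1 ltry.
apply: (cvg_unique _ c1) => //.
rewrite E; apply: c2.
- by move=> x; rewrite lee_fin normal_pdf_ge0.
- move=> x _ a b ab; apply: lee_wpmul2r; last exact: ndg.
  by rewrite lee_fin normal_pdf_ge0.
Unshelve. all: end_near. Qed.

Lemma normal_pdf0_scale (sigma x : R) : 0 < sigma ->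
  sigma * normal_pdf 0 sigma (sigma * x) = normal_pdf 0 1 x.
Proof.
move=> s0; rewrite !normal_pdfE ?gt_eqF//= mulrA; congr (_ * _).
  rewrite /normal_peak expr1n mul1r -mulrnAr sqrtrM ?sqr_ge0// sqrtr_sqr gtr0_norm//.
  by rewrite invfM mulVKf ?gt_eqF.
rewrite /normal_fun !subr0 expr1n; congr expR.
rewrite exprMn -[_ *+ 2 in LHS]mulr_natr -mulrN; field.
by rewrite gt_eqF.
Qed.

Lemma normal_second_moment_scale (sigma : R) : 0 < sigma ->
  (\int[normal_prob 0 sigma]_x (x ^+ 2)%:E =
   (sigma ^+ 2)%:E * \int[normal_prob 0 1]_x (x ^+ 2)%:E)%E.
Proof.
move=> s0; have mX2 : measurable_fun [set: R] (fun x : R => x ^+ 2) by exact: measurable_funX.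
rewrite !ge0_integral_normal_prob//; try by move=> x; exact: sqr_ge0.
pose F (x : R) := sigma * x.
have F'E : F^`()%classic = cst sigma.
  apply/funext => x; rewrite /F derive1E deriveM// derive_cst derive_id scaler0 addr0.
  by rewrite /GRing.scale/= mulr1.
rewrite (@increasing_ge0_integration_by_substitutionT R F
  (fun x => x ^+ 2 * normal_pdf 0 sigma x)).
- rewrite -ge0_integralZl//.
  + apply: eq_integral => x _; rewrite F'E -EFinM /=; congr EFin.
    rewrite -(normal_pdf0_scale x s0) /F !fctE/=; ring.
  + apply/measurable_EFinP; apply: measurable_funM; first exact: measurable_funX.
    exact: measurable_normal_pdf.
  + by move=> x _; rewrite lee_fin mulr_ge0 ?sqr_ge0 ?normal_pdf_ge0.
  + by rewrite lee_fin sqr_ge0.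
- by move=> x y xy; rewrite /F ltr_pM2l.
- by rewrite F'E => ?; exact: cvg_cst.
- by rewrite F'E; exact: is_cvg_cst.
- by rewrite F'E; exact: is_cvg_cst.
- by move=> x; apply: derivableM.
- by apply: gt0_cvgMrNy => //; exact: cvg_id.
- by apply: gt0_cvgMry => //; exact: cvg_id.
- move=> x; apply: cvgM; first by apply: exprn_continuous.
  by apply: continuous_normal_pdf; rewrite gt_eqF.
- by move=> x; rewrite mulr_ge0 ?sqr_ge0 ?normal_pdf_ge0.
Qed.

(** Finiteness by comparison: x^2 times the density of variance sigma^2 is
    bounded by a multiple of the density of variance 2 sigma^2. *)
Lemma normal_second_moment_lty (sigma : R) : 0 < sigma ->
  (\int[normal_prob 0 sigma]_x (x ^+ 2)%:E < +oo)%E.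
Proof.
move=> s0.
have mX2 : measurable_fun [set: R] (fun x : R => x ^+ 2) by exact: measurable_funX.
rewrite ge0_integral_normal_prob//; last by move=> x; exact: sqr_ge0.
(* The density of variance tau^2 = 2 sigma^2 decays only half as fast. *)
pose tau := Num.sqrt 2 * sigma.
have t0 : 0 < tau by rewrite mulr_gt0// sqrtr_gt0.
have tau2 : tau ^+ 2 = 2 * sigma ^+ 2 by rewrite exprMn sqr_sqrtr.
pose c := 2 * tau ^+ 2 * (normal_peak sigma / normal_peak tau).
have bound x : x ^+ 2 * normal_pdf 0 sigma x <= c * normal_pdf 0 tau x.
  have pdfE t : 0 < t -> normal_pdf 0 t x = normal_peak t * normal_fun 0 t x.
    by move=> ht; rewrite normal_pdfE ?gt_eqF.
  rewrite !pdfE// /c.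
  have pt : 0 < normal_peak tau by rewrite normal_peak_gt0// gt_eqF.
  have ps : 0 < normal_peak sigma by rewrite normal_peak_gt0// gt_eqF.
  have -> : 2 * tau ^+ 2 * (normal_peak sigma / normal_peak tau) * (normal_peak tau * normal_fun 0 tau x)
    = normal_peak sigma * (2 * tau ^+ 2 * normal_fun 0 tau x).
    by field; rewrite gt_eqF.
  rewrite [leLHS]mulrCA ler_pM2l// /normal_fun subr0.
  set y := x ^+ 2 / (2 * tau ^+ 2).
  have tn : 2 * tau ^+ 2 != 0 by rewrite gt_eqF// mulr_gt0// exprn_gt0.
  have -> : x ^+ 2 = 2 * tau ^+ 2 * y.
    by rewrite /y mulrC divfK.
  have -> : - (2 * tau ^+ 2 * y) / (sigma ^+ 2 *+ 2) = - y - y.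
    rewrite tau2 -mulr_natr; field; by rewrite gt_eqF// exprn_gt0.
  have -> : - (2 * tau ^+ 2 * y) / (tau ^+ 2 *+ 2) = - y.
    rewrite -mulr_natr; field; by rewrite gt_eqF// exprn_gt0.
  rewrite -[leLHS]mulrA ler_pM2l; last by rewrite mulr_gt0// exprn_gt0.
  rewrite expRD mulrA -[leRHS]mul1r ler_pM2r ?expR_gt0//.
  rewrite expRN -ler_pdivlMr ?invr_gt0 ?expR_gt0// invrK mul1r.
  have := @expR_ge1Dx R y; lra.
apply: (@le_lt_trans _ _ (\int[mu]_x (c%:E * (normal_pdf 0 tau x)%:E))%E).
  apply: ge0_le_integral => //.
  - by move=> x _; rewrite lee_fin mulr_ge0 ?sqr_ge0 ?normal_pdf_ge0.
  - by apply/measurable_EFinP; apply: measurable_funM => //; exact: measurable_normal_pdf.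
  - by apply: measurable_funeM; apply/measurable_EFinP; exact: measurable_normal_pdf.
  - by move=> x _; rewrite -EFinM lee_fin.
rewrite integralZl//; last exact: integrable_normal_pdf.
by rewrite integral_normal_pdf mule1 ltry.
Qed.

Lemma normal_second_moment_gt0 (sigma : R) : 0 < sigma ->
  (0 < \int[normal_prob 0 sigma]_x (x ^+ 2)%:E)%E.
Proof.
move=> s0; rewrite lt_def integral_ge0 ?andbT; last first.
  by move=> x _; rewrite lee_fin sqr_ge0.
apply/eqP => h.
have mX2 : measurable_fun [set: R] (fun x : R => (x ^+ 2)%:E).
  by apply/measurable_EFinP; exact: measurable_funX.
have : (\int[normal_prob 0 sigma]_x `|(x ^+ 2)%:E| = 0)%E.
  by rewrite -[RHS]h; apply: eq_integral => x _; rewrite /= ger0_norm ?sqr_ge0.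
move/(ae_eq_integral_abs (normal_prob 0 sigma) measurableT mX2).1 => [N [mN N0 sub]].
have N1 : normal_prob 0 sigma [set: R] = 1%E by rewrite /normal_prob integral_normal_pdf.
have z0 : normal_prob 0 sigma [set (0:R)] = 0%E.
  by rewrite /normal_prob integral_set1.
have : (normal_prob 0 sigma [set: R] <= normal_prob 0 sigma (N `|` [set (0:R)%R]))%E.
  apply: le_measure; rewrite ?inE//; first exact: measurableU.
  move=> x _; have [->|x0] := eqVneq x 0; [by right|left].
  apply: sub => /= /(_ I) [] /eqP; rewrite sqrf_eq0 => x0'.
  by rewrite x0' in x0.
by rewrite N1 measureU0// N0 leNgt lte01.
Qed.

(** The symmetry of the normal law, in the form needed to see that it has mean
    zero. *)
Lemma normal_pos_neg (sigma : R) : 0 < sigma ->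
  (\int[normal_prob 0 sigma]_x (Num.max x 0)%:E =
   \int[normal_prob 0 sigma]_x (Num.max (- x) 0)%:E)%E.
Proof.
move=> s0.
have mp : measurable_fun [set: R] (fun x => Num.max x 0 : R) by apply: measurable_maxr.
have mn : measurable_fun [set: R] (fun x => Num.max (- x) 0 : R).
  by apply: measurable_maxr => //; exact: measurableT_comp.
rewrite !ge0_integral_normal_prob//; try by move=> x; rewrite le_max lexx orbT.
pose g x := Num.max (- x) 0 * normal_pdf 0 sigma x.
have sym x : normal_pdf 0 sigma (- x) = normal_pdf 0 sigma x.
  by rewrite !normal_pdfE ?gt_eqF//= /normal_fun !subr0 sqrrN.
have cg : continuous g.
  move=> x; apply: cvgM; last by apply: continuous_normal_pdf; rewrite gt_eqF.
  by apply: continuous_max; [exact: continuousN|exact: cvg_cst].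
have := @ge0_integration_by_substitutionNy R g 0.
rewrite oppr0 => h.
transitivity (\int[mu]_(x in `[0%R, +oo[) (Num.max x 0 * normal_pdf 0 sigma x)%:E)%E.
  rewrite [RHS]integral_mkcond; apply: eq_integral => x _; rewrite patchE.
  case: ifPn => //; rewrite notin_setE/= in_itv/= andbT => /negP; rewrite -ltNge => x0.
  by rewrite max_r ?ltW// mul0r.
transitivity (\int[mu]_(x in `]-oo, 0%R]) (g x)%:E)%E; last first.
  rewrite [LHS]integral_mkcond; apply: eq_integral => x _; rewrite patchE.
  case: ifPn => //; rewrite notin_setE/= in_itv/= => /negP; rewrite -ltNge => x0.
  by rewrite max_r ?mul0r// oppr_le0 ltW.
rewrite h.
- by apply: eq_integral => x _; rewrite /g /= opprK sym.
- exact: continuous_subspaceT.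
- by move=> x _; rewrite /g mulr_ge0 ?normal_pdf_ge0// le_max lexx orbT.
Qed.

End NormalMoments.

(** * Moments of Wiener increments *)

Section WienerMoments.
Context {disp : measure_display} {T : measurableType disp} {R : realType}.
Variable P : probability T R.
Variable W : R -> T -> R.
Hypothesis Pc : measure_is_complete P.
Hypothesis hW : two_sided_wiener P W.

Definition wvar : R := fine (\int[normal_prob (0:R) 1]_x (x ^+ 2)%:E)%E.

Lemma wvar_gt0 : 0 < wvar.
Proof.
by apply: fine_gt0; rewrite normal_second_moment_gt0//= normal_second_moment_lty.
Qed.

Lemma ge0_integral_increment v u (f : R -> R) : v < u -> measurable_fun setT f ->
  (forall x, 0 <= f x) ->
  (\int[P]_w (f (increment W v u w))%:E =
   \int[normal_prob 0 (Num.sqrt (u - v))]_x (f x)%:E)%E.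
Proof.
move=> vu mf f0.
have mi := measurable_increment hW v u.
pose X : {mfun T >-> measurableTypeR R} := HB.pack (increment W v u : T -> measurableTypeR R)
  (isMeasurableFun.Build _ _ _ (measurableTypeR R) (increment W v u) mi).
have -> : (\int[P]_w (f (increment W v u w))%:E =
   \int[distribution P X]_x (f x)%:E)%E.
  by rewrite ge0_integral_distribution//; exact/measurable_EFinP.
rewrite (eq_measure_integral (normal_prob 0 (Num.sqrt (u - v))))//; last first.
  by move=> A mA _; exact: (wiener_gaussian hW vu mA).
Qed.

Lemma increment_eq v : increment W v v = cst 0.
Proof. by apply/funext => w; rewrite /increment subrr. Qed.

Lemma increment_second_moment v u : v <= u ->
  second_moment P (increment W v u) = (wvar * (u - v))%:E.
Proof.
rewrite le_eqVlt => /orP[/eqP<-|vu].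
  rewrite increment_eq subrr mulr0 second_momentE.
  by under eq_integral do rewrite expr0n/=; rewrite integral0.
rewrite second_momentE (@ge0_integral_increment v u (fun x => x ^+ 2))//; last by move=> x; exact: sqr_ge0.
have h : 0 < u - v by rewrite subr_gt0.
rewrite normal_second_moment_scale ?sqrtr_gt0// sqr_sqrtr ?ltW// mulrC EFinM fineK//.
rewrite ge0_fin_numE; first exact: normal_second_moment_lty.
by apply: integral_ge0 => x _; rewrite lee_fin sqr_ge0.
Qed.

Lemma increment_sqint v u : v <= u -> sqint P (increment W v u).
Proof.
move=> vu; split; first exact: (measurable_increment hW).
by rewrite increment_second_moment// ltry.
Qed.

Lemma increment_ip v u : v <= u -> ip P (increment W v u) (increment W v u) = wvar * (u - v).
Proof.
move=> vu; have := second_moment_ip (increment_sqint vu).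
by rewrite increment_second_moment// => -[].
Qed.

(** Positive and negative parts have the same expectation by symmetry. *)
Lemma increment_mean v u : v <= u -> \int[P]_w increment W v u w = 0.
Proof.
rewrite le_eqVlt => /orP[/eqP<-|vu].
  by rewrite increment_eq (Rintegral_cst P measurableT 0) mul0r.
have E : (\int[P]_w (Num.max (increment W v u w) 0)%:E =
          \int[P]_w (Num.max (- increment W v u w) 0)%:E)%E.
  rewrite (@ge0_integral_increment v u (fun x => Num.max x 0))//; last 2 first.
  - exact: measurable_maxr.
  - by move=> x; rewrite le_max lexx orbT.
  rewrite normal_pos_neg ?sqrtr_gt0 ?subr_gt0//.
  rewrite (@ge0_integral_increment v u (fun x => Num.max (- x) 0))//.
  - by apply: measurable_maxr => //; exact: measurableT_comp.
  - by move=> x; rewrite le_max lexx orbT.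
have int := sqint_integrable (increment_sqint (ltW vu)).
have mi := measurable_increment hW v u.
have ip : P.-integrable setT (EFin \o (fun w => Num.max (increment W v u w) 0)).
  apply: le_integrable int => //.
    by apply/measurable_EFinP; apply: measurable_maxr.
  move=> w _ /=; rewrite lee_fin.
  by case: (lerP (increment W v u w) 0) => h; rewrite ?normr0.
have im : P.-integrable setT (EFin \o (fun w => Num.max (- increment W v u w) 0)).
  apply: le_integrable int => //.
    by apply/measurable_EFinP; apply: measurable_maxr => //; exact: measurableT_comp.
  move=> w _ /=; rewrite lee_fin.
  by case: (lerP (- increment W v u w) 0) => h; rewrite ?normr0 ?normrN.
transitivity (\int[P]_w (Num.max (increment W v u w) 0 - Num.max (- increment W v u w) 0)).
  apply: eq_Rintegral => w _.
  by case: (lerP (increment W v u w) 0); case: (lerP (- increment W v u w) 0); lra.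
by rewrite RintegralB// /Rintegral E subrr.
Qed.

Lemma adapted_increment_indep a b xi : a <= b -> adapted_at P W a xi ->
  forall A B, measurable A -> measurable B ->
    P ((xi @^-1` A) `&` (increment W a b @^-1` B)) =
    (P (xi @^-1` A) * P (increment W a b @^-1` B))%E.
Proof.
move=> ab /adaptedP hxi A B mA mB; apply: (filtration_indep Pc hW ab mB).
exact: hxi.
Qed.

Lemma adapted_increment_mean a b xi : a <= b -> adapted_at P W a xi ->
  P.-integrable setT (EFin \o xi) ->
  P.-integrable setT (EFin \o (fun w => xi w * increment W a b w)) /\
  \int[P]_w (xi w * increment W a b w) = 0.
Proof.
move=> ab axi ixi.
have [] := indep_expectation (adapted_measurable Pc hW axi)
  (measurable_increment hW a b) (adapted_increment_indep ab axi) ixi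
  (sqint_integrable (increment_sqint ab)).
by rewrite increment_mean// mulr0.
Qed.

Lemma adapted_increment_var a b xi : a <= b -> adapted_at P W a xi ->
  P.-integrable setT (EFin \o xi) ->
  P.-integrable setT (EFin \o (fun w => xi w * increment W a b w ^+ 2)) /\
  \int[P]_w (xi w * increment W a b w ^+ 2) = wvar * (b - a) * \int[P]_w xi w.
Proof.
move=> ab axi ixi.
have m2 : measurable_fun setT (fun w => increment W a b w ^+ 2).
  by apply: measurable_funX; exact: (measurable_increment hW).
have [_ i2] := (sqintP _ _).1 (increment_sqint ab).
have ind A B : measurable A -> measurable B ->
    P ((xi @^-1` A) `&` ((fun w => (increment W a b w ^+ 2)%R) @^-1` B)) =
    (P (xi @^-1` A) * P ((fun w => (increment W a b w ^+ 2)%R) @^-1` B))%E.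
  move=> mA mB.
  rewrite -[X in _ `&` X]/(increment W a b @^-1` ((fun x : R => (x ^+ 2)%R) @^-1` B)).
  apply: adapted_increment_indep => //.
  by rewrite -[X in measurable X]setTI; exact: measurable_funX.
have [-> ->] := indep_expectation (adapted_measurable Pc hW axi) m2 ind ixi i2.
split => //; rewrite mulrC; congr (_ * _).
by rewrite -increment_ip//; apply: eq_Rintegral => w _; rewrite expr2.
Qed.

(** The scalar version of the state space at time t. *)
Definition L2at t h := adapted_at P W t h /\ (second_moment P h < +oo)%E.

Lemma L2at_sqint t h : L2at t h -> sqint P h.
Proof. by case=> ah h2; split => //; exact: adapted_measurable ah. Qed.

Lemma L2at_mono s t h : s <= t -> L2at s h -> L2at t h.
Proof. by move=> st [ah h2]; split => //; exact: adapted_mono ah. Qed.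

Lemma L2at_cst t c : L2at t (cst c).
Proof. by split; [exact: adapted_cst|case: (sqint_cst P c)]. Qed.

Lemma L2atD t f g : L2at t f -> L2at t g -> L2at t (fun w => f w + g w).
Proof.
move=> hf hg; split; first by apply: adaptedD; [case: hf|case: hg].
by have [] := sqintD (L2at_sqint hf) (L2at_sqint hg).
Qed.

Lemma L2atZ t c f : L2at t f -> L2at t (fun w => c * f w).
Proof.
move=> hf; split; first by apply: adaptedZ; case: hf.
by have [] := sqintZ c (L2at_sqint hf).
Qed.

Lemma L2at_sum t (I : Type) (r : seq I) (F : I -> T -> R) :
  (forall i, L2at t (F i)) -> L2at t (fun w => \sum_(i <- r) F i w).
Proof.
move=> h; split; first by apply: adapted_sum => i; case: (h i).
by have [] := sqint_sum r (fun i => L2at_sqint (h i)).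
Qed.

Lemma step_term_L2 a b h : a <= b -> L2at a h -> L2at b (fun w => h w * increment W a b w).
Proof.
move=> ab hh; have [ah _] := hh; split.
  apply: adaptedM; first exact: adapted_mono ah.
  exact: adapted_increment.
have [mh ih] := (sqintP _ _).1 (L2at_sqint hh).
have [i2 _] := adapted_increment_var ab (adaptedM ah ah)
  (sqint_integrableM (L2at_sqint hh) (L2at_sqint hh)).
have : sqint P (fun w => h w * increment W a b w).
  apply/sqintP; split.
    by apply: measurable_funM => //; exact: (measurable_increment hW).
  by apply: eq_integrable i2 => // w _ /=; congr EFin; ring.
by case.
Qed.

(** The product h h' is independent of the squared increment. *)
Lemma step_term_ip a b h h' : a <= b -> L2at a h -> L2at a h' ->
  ip P (fun w => h w * increment W a b w) (fun w => h' w * increment W a b w) =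
  wvar * (b - a) * ip P h h'.
Proof.
move=> ab hh hh'.
have [_ <-] := adapted_increment_var ab (adaptedM hh.1 hh'.1)
  (sqint_integrableM (L2at_sqint hh) (L2at_sqint hh')).
by apply: eq_Rintegral => w _; ring.
Qed.

Lemma step_term_orth a b h y : a <= b -> L2at a h -> L2at a y ->
  ip P y (fun w => h w * increment W a b w) = 0.
Proof.
move=> ab hh hy.
have [_ <-] := adapted_increment_mean ab (adaptedM hy.1 hh.1)
  (sqint_integrableM (L2at_sqint hy) (L2at_sqint hh)).
by apply: eq_Rintegral => w _; ring.
Qed.

End WienerMoments.

(** * Stochastic integrals of step processes *)

Section StepProcesses.
Context {disp : measure_display} {T : measurableType disp} {R : realType}.
Variable P : probability T R.
Variable W : R -> T -> R.
Hypothesis Pc : measure_is_complete P.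
Hypothesis hW : two_sided_wiener P W.

Section OneStepProcess.
Variables (s t : R) (e : step_process (T := T) (R := R)).
Hypothesis he : step_process_on P W s t e.
Local Notation n := (step_size e).
Local Notation g := (step_grid e).
Local Notation h := (step_height e).

Lemma step_grid_le i j : (i <= j)%N -> (j <= n)%N -> g i <= g j.
Proof.
have [_ _ hg _] := he.
elim: j => [|j ih]; first by rewrite leqn0 => /eqP->.
rewrite leq_eqVlt => /orP[/eqP->//|ij] jn.
by apply: le_trans (hg j jn); exact: ih (ltnW jn).
Qed.

Lemma step_grid_s : g 0%N = s. Proof. by case: he. Qed.
Lemma step_grid_t : g n = t. Proof. by case: he. Qed.

Lemma step_grid_ge k : (k <= n)%N -> s <= g k.
Proof. by move=> kn; rewrite -step_grid_s; exact: step_grid_le. Qed.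

Lemma step_grid_le_t k : (k <= n)%N -> g k <= t.
Proof. by move=> kn; rewrite -step_grid_t; exact: step_grid_le. Qed.

Lemma step_height_L2 k : (k < n)%N -> L2at P W (g k) (h k).
Proof. by have [_ _ _ hh] := he => kn; exact: hh. Qed.

Let J m w := \sum_(k < m) h k w * increment W (g k) (g k.+1) w.

(** By induction on the number of cells: each new term is orthogonal to everything
    known at the left end of its cell. *)
Let J_facts m : (m <= n)%N -> [/\ L2at P W (g m) (J m),
   ip P (J m) (J m) = wvar * \sum_(k < m) (g k.+1 - g k) * ip P (h k) (h k) &
   forall y, L2at P W s y -> ip P y (J m) = 0].
Proof.
elim: m => [_|m ih mn].
  have -> : J 0%N = cst 0 by apply/funext => w; rewrite /J big_ord0.
  split; first exact: L2at_cst.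
    by rewrite big_ord0 mulr0 ip_cst mulr0.
  by move=> y _; rewrite ipC; exact: ip0l.
have [hJ iJ oJ] := ih (ltnW mn).
have gm : g m <= g m.+1 by exact: step_grid_le.
have hm := step_height_L2 mn.
have hX := step_term_L2 Pc hW gm hm.
have -> : J m.+1 = (fun w => J m w + h m w * increment W (g m) (g m.+1) w).
  by apply/funext => w; rewrite /J big_ord_recr.
have hJ' := L2at_mono gm hJ.
split.
- exact: L2atD.
- rewrite ipDD; [|exact: (L2at_sqint Pc hW hJ)|exact: (L2at_sqint Pc hW hX)].
  rewrite (step_term_orth Pc hW gm hm hJ) mulr0 addr0 iJ (step_term_ip Pc hW gm hm hm).
  by rewrite big_ord_recr/=; ring.
- move=> y hy; rewrite ipDr; [|exact: (L2at_sqint Pc hW hJ)|exact: (L2at_sqint Pc hW hX)|exact: (L2at_sqint Pc hW hy)].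
  rewrite oJ// add0r; apply: (step_term_orth Pc hW gm hm).
  by apply: L2at_mono hy; exact: step_grid_ge (ltnW mn).
Qed.

Lemma step_integral_L2 : L2at P W t (step_integral W e).
Proof. by rewrite -step_grid_t; have [] := J_facts (leqnn n). Qed.

Lemma step_integral_orth y : L2at P W s y -> ip P y (step_integral W e) = 0.
Proof. by have [_ _] := J_facts (leqnn n); apply. Qed.

Lemma step_value_in k u w : (k < n)%N -> g k < u -> u <= g k.+1 ->
  step_value e u w = h k w.
Proof.
move=> kn gu ug; rewrite /step_value (bigD1 (Ordinal kn))//= big1 ?addr0.
  by rewrite indicE mem_set ?mulr1//= in_itv/= gu ug.
move=> [j jn] /=; rewrite -val_eqE/= => jk.
rewrite indicE memNset ?mulr0//= in_itv/= => /andP[gju ugj].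
have [jk'|jk'] := ltnP j k.
  have := step_grid_le jk' (ltnW kn).
  by rewrite leNgt (lt_le_trans gu ugj).
have kj : (k < j)%N by rewrite ltn_neqAle eq_sym jk jk'.
have := step_grid_le kj (ltnW jn).
by rewrite leNgt (lt_le_trans gju ug).
Qed.

Lemma step_cover u : s < u -> u <= t ->
  exists k, [/\ (k < n)%N, g k < u & u <= g k.+1].
Proof.
move=> su ut.
have key m : (m <= n)%N -> u <= g m -> exists k, [/\ (k < m)%N, g k < u & u <= g k.+1].
  elim: m => [_|m ih mn ug]; first by rewrite step_grid_s leNgt su.
  have [gm|gm] := ltP (g m) u; first by exists m.
  have [k [km ? ?]] := ih (ltnW mn) gm.
  by exists k; split => //; exact: ltnW.
by apply: key => //; rewrite step_grid_t.
Qed.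

Lemma step_value_out u w : ~~ (s < u <= t) -> step_value e u w = 0.
Proof.
move=> out; rewrite /step_value big1// => -[k kn] _ /=.
rewrite indicE memNset ?mulr0//= in_itv/= => /andP[gu ug].
move: out; rewrite (le_lt_trans (step_grid_ge (ltnW kn)) gu).
by rewrite (le_trans ug (step_grid_le_t kn)).
Qed.

Lemma step_value_measurable :
  measurable_fun setT (fun z : R * T => step_value e z.1 z.2).
Proof.
apply: measurable_sum => k.
apply: measurable_funM.
  apply: (measurableT_comp (f := h k)); last exact: measurable_snd.
  by have [] := L2at_sqint Pc hW (step_height_L2 (ltn_ord k)).
have m1 : measurable_fun [set: R] (\1_(`]g k, g k.+1]) : R -> R) by exact: measurable_indic.
exact: (measurableT_comp m1 measurable_fst).
Qed.

Lemma step_value_second_moment u : second_moment P (step_value e u) =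
  (\sum_(k < n) ip P (h k) (h k) * \1_(`]g k, g k.+1]) u)%:E.
Proof.
have [/andP[su ut]|out] := boolP (s < u <= t); last first.
  have -> : step_value e u = cst 0 by apply/funext => w; exact: step_value_out.
  rewrite (second_moment_ip (sqint_cst P 0)) ip_cst mulr0 big1// => -[k kn] _ /=.
  rewrite indicE memNset ?mulr0//= in_itv/= => /andP[gu ug].
  move: out; rewrite (le_lt_trans (step_grid_ge (ltnW kn)) gu).
  by rewrite (le_trans ug (step_grid_le_t kn)).
have [k [kn gu ug]] := step_cover su ut.
have -> : step_value e u = h k by apply/funext => w; exact: step_value_in.
rewrite (second_moment_ip (L2at_sqint Pc hW (step_height_L2 kn))); congr EFin.
rewrite (bigD1 (Ordinal kn))//= big1 ?addr0.
  by rewrite indicE mem_set ?mulr1//= in_itv/= gu ug.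
move=> [j jn] /=; rewrite -val_eqE/= => jk.
rewrite indicE memNset ?mulr0//= in_itv/= => /andP[gju ugj].
have [jk'|jk'] := ltnP j k.
  have := step_grid_le jk' (ltnW kn).
  by rewrite leNgt (lt_le_trans gu ugj).
have kj : (k < j)%N by rewrite ltn_neqAle eq_sym jk jk'.
have := step_grid_le kj (ltnW jn).
by rewrite leNgt (lt_le_trans gju ug).
Qed.

Lemma step_isometry : second_moment P (step_integral W e) =
  (wvar%:E * \int[lebesgue_measure]_(u in `[s, t]) second_moment P (step_value e u))%E.
Proof.
rewrite (second_moment_ip (L2at_sqint Pc hW step_integral_L2)).
have [_ -> _] := J_facts (leqnn n).
rewrite EFinM; congr (_ * _)%E.
under eq_integral do rewrite step_value_second_moment -sumEFin.
rewrite ge0_integral_sum//; last 2 first.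
- move=> k; apply/measurable_EFinP; apply: measurable_funM; first exact: measurable_cst.
  have m1 : measurable_fun `[s, t] (\1_(`]g k, g k.+1]) : R -> R).
    by apply: measurable_funTS; exact: measurable_indic.
  exact: m1.
- by move=> k u _; rewrite lee_fin mulr_ge0 ?ip_ge0.
rewrite -sumEFin; apply: eq_bigr => -[k kn] _ /=.
under eq_integral do rewrite EFinM.
rewrite ge0_integralZl ?lee_fin ?ip_ge0//; last first.
  by apply/measurable_EFinP; exact: measurable_indic.
rewrite integral_indic// setIidl; last first.
  move=> u /=; rewrite !in_itv/= => /andP[gu ug].
  by rewrite (le_trans (step_grid_ge (ltnW kn)) (ltW gu)) (le_trans ug (step_grid_le_t kn)).
have lm : lebesgue_measure (`]g k, g k.+1]%classic : set R) = (g k.+1 - g k)%:E.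
  rewrite lebesgue_measure_itv/= lte_fin.
  have := step_grid_le (leqnSn k) kn.
  by rewrite le_eqVlt => /orP[/eqP->|->//]; rewrite ltxx subrr.
by rewrite [X in (_ * X)%E]lm muleC EFinM.
Qed.

End OneStepProcess.

Section Refinement.
Variables (s t : R) (N : nat) (tau : nat -> R).
Hypothesis tau0 : tau 0%N = s.
Hypothesis tauN : tau N = t.
Hypothesis tau_le : forall i j, (i <= j)%N -> (j <= N)%N -> tau i <= tau j.

Definition step_refine (e : step_process (T := T) (R := R)) :=
  StepProcess N tau (fun k => step_value e (tau k.+1)).

Variable e : step_process (T := T) (R := R).
Hypothesis he : step_process_on P W s t e.
Hypothesis esub : forall j, (j <= step_size e)%N ->
  exists2 p, (p <= N)%N & step_grid e j = tau p.

Let nocross j k : (j <= step_size e)%N -> (k < N)%N ->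
  step_grid e j <= tau k \/ tau k.+1 <= step_grid e j.
Proof.
move=> jn kN; have [p pN ->] := esub jn.
have [pk|pk] := leqP p k; [left|right].
  exact: (tau_le pk (ltnW kN)).
exact: (tau_le pk pN).
Qed.

Lemma step_refine_on : step_process_on P W s t (step_refine e).
Proof.
split => //= k kN; first exact: (tau_le (leqnSn k) kN).
suff : L2at P W (tau k) (step_value e (tau k.+1)) by [].
have [/andP[su ut]|out] := boolP (s < tau k.+1 <= t); last first.
  have -> : step_value e (tau k.+1) = cst 0.
    by apply/funext => w; exact: step_value_out he _ _ out.
  exact: L2at_cst.
have [j [jn gu ug]] := step_cover he su ut.
have -> : step_value e (tau k.+1) = step_height e j.
  by apply/funext => w; apply: (step_value_in he).
apply: L2at_mono (step_height_L2 he jn).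
by have [//|] := nocross (ltnW jn) kN; rewrite leNgt gu.
Qed.

Lemma step_refine_value u w : step_value (step_refine e) u w = step_value e u w.
Proof.
have ho := step_refine_on.
have [/andP[su ut]|out] := boolP (s < u <= t); last first.
  by rewrite (step_value_out he) ?(step_value_out ho).
have [k [/= kN tu ut']] := step_cover ho su ut.
rewrite (step_value_in ho _ kN tu ut') /=.
have kt : tau k.+1 <= t by rewrite -tauN; exact: tau_le.
have [j [jn gu ug]] := step_cover he (lt_le_trans su ut') kt.
rewrite (step_value_in he _ jn gu ug).
have gk : step_grid e j <= tau k.
  by have [//|] := nocross (ltnW jn) kN; rewrite leNgt gu.
by rewrite (step_value_in he _ jn (le_lt_trans gk tu) (le_trans ut' ug)).
Qed.

Let telescope_min b w : s <= b -> b <= t -> (exists2 p, (p <= N)%N & b = tau p) ->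
  \sum_(k < N) (tau k.+1 <= b)%R%:R * increment W (tau k) (tau k.+1) w = W b w - W s w.
Proof.
move=> sb bt [p pN bp].
transitivity (\sum_(k < N) (W (Num.min (tau k.+1) b) w - W (Num.min (tau k) b) w)).
  apply: eq_bigr => -[k kN] _ /=; rewrite /increment.
  have kk : tau k <= tau k.+1 by exact: (tau_le (leqnSn k) kN).
  have [h|h] := leP (tau k.+1) b.
    by rewrite mul1r (min_l (le_trans kk h)).
  rewrite mul0r min_r ?subrr//.
  have [pk|pk] := leqP p k; first by rewrite bp; apply: tau_le => //; exact: ltnW.
  by move: h; rewrite ltNge bp tau_le.
rewrite -(big_mkord xpredT (fun k => W (Num.min (tau k.+1) b) w - W (Num.min (tau k) b) w)).
rewrite telescope_sumr// tau0 tauN min_r//; by rewrite min_l.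
Qed.

Lemma step_refine_integral w : step_integral W (step_refine e) w = step_integral W e w.
Proof.
rewrite /step_integral/= /step_value.
under eq_bigr do rewrite mulr_suml.
rewrite exchange_big/=; apply: eq_bigr => -[j jn] _ /=.
under eq_bigr do rewrite -mulrA.
rewrite -mulr_sumr; congr (_ * _).
have gg : step_grid e j <= step_grid e j.+1 by exact: (step_grid_le he (leqnSn j) jn).
transitivity (\sum_(k < N) ((tau k.+1 <= step_grid e j.+1)%R%:R * increment W (tau k) (tau k.+1) w
   - (tau k.+1 <= step_grid e j)%R%:R * increment W (tau k) (tau k.+1) w)).
  apply: eq_bigr => k _; rewrite -mulrBl; congr (_ * _).
  rewrite indicE.
  have [h|h] := leP (tau k.+1) (step_grid e j).
    by rewrite (le_trans h gg) memNset ?subrr//= in_itv/= ltNge h.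
  have [h'|h'] := leP (tau k.+1) (step_grid e j.+1).
    by rewrite mem_set ?subr0//= in_itv/= h h'.
  by rewrite memNset ?subr0//= in_itv/= h leNgt h'.
rewrite sumrB !telescope_min.
- by rewrite /increment; ring.
- exact: (step_grid_ge he (ltnW jn)).
- exact: (step_grid_le_t he (ltnW jn)).
- exact: esub (ltnW jn).
- exact: (step_grid_ge he jn).
- exact: (step_grid_le_t he jn).
- exact: esub jn.
Qed.

End Refinement.

(** Sums of step processes make sense only on a grid that refines both. *)
Lemma common_grid s t e1 e2 :
  step_process_on P W s t e1 -> step_process_on P W s t e2 ->
  exists N (tau : nat -> R), [/\ tau 0%N = s, tau N = t,
    forall i j, (i <= j)%N -> (j <= N)%N -> tau i <= tau j,
    (forall j, (j <= step_size e1)%N -> exists2 p, (p <= N)%N & step_grid e1 j = tau p) &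
    (forall j, (j <= step_size e2)%N -> exists2 p, (p <= N)%N & step_grid e2 j = tau p)].
Proof.
move=> h1 h2.
pose pts (e : step_process (T := T) (R := R)) := [seq step_grid e k | k <- iota 0 (step_size e).+1].
pose r := sort <=%O (pts e1 ++ pts e2).
have memp e j : (j <= step_size e)%N -> step_grid e j \in pts e.
  by move=> jn; apply: map_f; rewrite mem_iota/= add0n ltnS.
have memr1 j : (j <= step_size e1)%N -> step_grid e1 j \in r.
  by move=> jn; rewrite mem_sort mem_cat memp.
have memr2 j : (j <= step_size e2)%N -> step_grid e2 j \in r.
  by move=> jn; rewrite mem_sort mem_cat memp ?orbT.
have bnd x : x \in r -> s <= x <= t.
  rewrite mem_sort mem_cat => /orP[] /mapP[k]; rewrite mem_iota/= add0n ltnS => kn ->.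
    by rewrite (step_grid_ge h1)// (step_grid_le_t h1).
  by rewrite (step_grid_ge h2)// (step_grid_le_t h2).
have sr : sorted <=%O r by apply: sort_sorted; exact: le_total.
pose N := (size r).-1; pose tau := nth t r.
have r0 : (0 < size r)%N by rewrite size_sort size_cat size_map size_iota.
have sz j : (j <= N)%N -> (j < size r)%N by rewrite -[size r](prednK r0) ltnS.
have tle i j : (i <= j)%N -> (j <= N)%N -> tau i <= tau j.
  move=> ij jN; apply: (sorted_leq_nth le_trans lexx) => //; rewrite inE.
    exact: leq_ltn_trans ij (sz _ jN).
  exact: sz.
have idx x : x \in r -> exists2 p, (p <= N)%N & x = tau p.
  move=> xr; exists (index x r); last by rewrite /tau nth_index.
  by rewrite -ltnS /N prednK// index_mem.
have tb j : (j <= N)%N -> s <= tau j <= t.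
  by move=> jN; apply: bnd; apply: mem_nth; exact: sz.
exists N, tau; split => //.
- apply/eqP; rewrite eq_le; have /andP[-> _] := tb 0%N (leq0n _); rewrite andbT.
  have := memr1 0%N (leq0n _); rewrite (step_grid_s h1) => /idx[p pN ->].
  exact: tle.
- apply/eqP; rewrite eq_le; have /andP[_ ->] := tb N (leqnn _) => /=.
  have := memr1 _ (leqnn _); rewrite (step_grid_t h1) => /idx[p pN {1}->].
  exact: tle.
- by move=> j /memr1 /idx.
- by move=> j /memr2 /idx.
Qed.

Lemma step_comb s t c e1 e2 :
  step_process_on P W s t e1 -> step_process_on P W s t e2 ->
  exists e, [/\ step_process_on P W s t e,
    forall u w, step_value e u w = c * step_value e1 u w + step_value e2 u w &
    forall w, step_integral W e w = c * step_integral W e1 w + step_integral W e2 w].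
Proof.
move=> h1 h2.
have [N [tau [t0 tN tle sub1 sub2]]] := common_grid h1 h2.
have o1 := step_refine_on t0 tN tle h1 sub1.
have o2 := step_refine_on t0 tN tle h2 sub2.
exists (StepProcess N tau (fun k w => c * step_value e1 (tau k.+1) w + step_value e2 (tau k.+1) w)).
split.
- split => //= k kN; first exact: (tle _ _ (leqnSn k) kN).
  apply: (L2atD Pc hW).
    by apply: (L2atZ Pc hW); exact: (step_height_L2 o1 (k := k)).
  exact: (step_height_L2 o2 (k := k)).
- move=> u w.
  rewrite -(step_refine_value t0 tN tle h1 sub1) -(step_refine_value t0 tN tle h2 sub2).
  rewrite /step_value/= mulr_sumr -big_split/=; apply: eq_bigr => k _.
  by rewrite mulrDl mulrA.
- move=> w.
  rewrite -(step_refine_integral t0 tN tle h1 sub1) -(step_refine_integral t0 tN tle h2 sub2).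
  rewrite /step_integral/= mulr_sumr -big_split/=; apply: eq_bigr => k _.
  by rewrite mulrDl mulrA.
Qed.

Lemma step_concat s r t e1 e2 :
  step_process_on P W s r e1 -> step_process_on P W r t e2 ->
  exists e, [/\ step_process_on P W s t e,
    forall u w, step_value e u w = step_value e1 u w + step_value e2 u w &
    forall w, step_integral W e w = step_integral W e1 w + step_integral W e2 w].
Proof.
move=> h1 h2.
set n1 := step_size e1; set n2 := step_size e2.
pose g k := if (k <= n1)%N then step_grid e1 k else step_grid e2 (k - n1).
pose h k := if (k < n1)%N then step_height e1 k else step_height e2 (k - n1).
have g1 k : (k <= n1)%N -> g k = step_grid e1 k by rewrite /g => ->.
have g2 k : g (n1 + k)%N = step_grid e2 k.
  rewrite /g; case: k => [|k].
    by rewrite addn0 leqnn (step_grid_t h1) (step_grid_s h2).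
  by rewrite leqNgt addnS ltnS leq_addr/= -addnS addnC addnK.
have hh1 k : (k < n1)%N -> h k = step_height e1 k by rewrite /h => ->.
have hh2 k : h (n1 + k)%N = step_height e2 k.
  by rewrite /h ltnNge leq_addr/= addnC addnK.
exists (StepProcess (n1 + n2) g h); split.
- split => /=.
  + by rewrite g1// (step_grid_s h1).
  + by rewrite g2 (step_grid_t h2).
  + move=> k kn; have [k1|k1] := ltnP k n1.
      by rewrite !g1// ?(ltnW k1)//; exact: (step_grid_le h1 (leqnSn k) k1).
    rewrite -(subnKC k1) -addnS !g2.
    apply: (step_grid_le h2 (leqnSn _)).
    by rewrite -(ltn_add2l n1) subnKC.
  + move=> k kn; have [k1|k1] := ltnP k n1.
      by rewrite g1 ?hh1// ?(ltnW k1)//; exact: (step_height_L2 h1).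
    rewrite -(subnKC k1) g2 hh2; apply: (step_height_L2 h2).
    by rewrite -(ltn_add2l n1) subnKC.
- move=> u w; rewrite /step_value/= big_split_ord/=; congr (_ + _).
    by apply: eq_bigr => -[k kn] _ /=; rewrite !g1 ?hh1// ltnW.
  by apply: eq_bigr => -[k kn] _ /=; rewrite -addnS !g2 hh2.
- move=> w; rewrite /step_integral/= big_split_ord/=; congr (_ + _).
    by apply: eq_bigr => -[k kn] _ /=; rewrite !g1 ?hh1// ltnW.
  by apply: eq_bigr => -[k kn] _ /=; rewrite -addnS !g2 hh2.
Qed.

End StepProcesses.

(** * Square integrable processes *)

Section L2Processes.
Context {disp : measure_display} {T : measurableType disp} {R : realType}.
Variable P : probability T R.
Local Notation lam := (@lebesgue_measure R).

Definition joint (s t : R) (f : R -> T -> R) :=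
  measurable_fun (`[s, t] `*` [set: T]) (fun z : R * T => f z.1 z.2).

(** The extension by zero turns integrals over [s, t] into integrals over the whole
    line, for which Fubini's theorem is available. *)
Definition cut (s t : R) (f : R -> T -> R) (z : R * T) : R :=
  ((fun z : R * T => f z.1 z.2) \_ (`[s, t] `*` [set: T])) z.

Lemma measurable_box (s t : R) : measurable (`[s, t] `*` [set: T] : set (R * T)).
Proof. by apply: measurableX. Qed.

Lemma cutE s t f u w : cut s t f (u, w) = if s <= u <= t then f u w else 0.
Proof.
rewrite /cut patchE in_setX /= [w \in _]mem_set// andbT.
by rewrite mem_setE in_itv/=.
Qed.

Lemma cut_measurable s t f : joint s t f -> measurable_fun setT (cut s t f).
Proof. by move=> jf; apply/(measurable_restrictT _ (measurable_box s t)). Qed.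

Lemma joint_slice s t f u : joint s t f -> s <= u <= t -> measurable_fun setT (f u).
Proof.
move=> jf su; have := measurableT_comp (cut_measurable jf) (@pair1_measurable _ _ _ T u).
by apply: eq_measurable_fun => w _ /=; rewrite cutE su.
Qed.

Lemma cut_int s t f u : (\int[P]_w (cut s t f (u, w) ^+ 2)%:E =
  ((fun u => second_moment P (f u)) \_ `[s, t]) u)%E.
Proof.
rewrite patchE mem_setE in_itv/=; case: ifPn => su.
  by rewrite second_momentE; apply: eq_integral => w _; rewrite cutE su.
by under eq_integral do rewrite cutE (negbTE su) expr0n/=; rewrite integral0.
Qed.

Lemma measurable_second_moment s t f : joint s t f ->
  measurable_fun `[s, t] (fun u => second_moment P (f u)).
Proof.
move=> jf; apply/(measurable_restrictT _ (measurable_itv _)).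
rewrite (_ : _ \_ _ = fun u => (\int[P]_w (cut s t f (u, w) ^+ 2)%:E)%E); last first.
  by apply/funext => u; rewrite cut_int.
apply: (measurable_fun_fubini_tonelli_F (m2 := P) (fun z => (cut s t f z ^+ 2)%:E)).
  by apply/measurable_EFinP; apply: measurable_funX; exact: cut_measurable.
by move=> z; rewrite lee_fin sqr_ge0.
Qed.

Lemma jointD s t f g : joint s t f -> joint s t g -> joint s t (fun u w => f u w + g u w).
Proof. by move=> jf jg; exact: measurable_funD. Qed.

Lemma jointM s t f g : joint s t f -> joint s t g -> joint s t (fun u w => f u w * g u w).
Proof. by move=> jf jg; exact: measurable_funM. Qed.

Lemma joint_time s t (c : R -> R) : measurable_fun setT c -> joint s t (fun u _ => c u).
Proof.
move=> mc; apply: measurable_funTS.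
exact: (measurableT_comp mc measurable_fst).
Qed.

Lemma joint_const s t c : joint s t (fun _ _ => c).
Proof. exact: measurable_cst. Qed.

Definition l2proc s t f := [/\ joint s t f, (forall u, s <= u <= t -> sqint P (f u)) &
  (\int[lam]_(u in `[s, t]) second_moment P (f u) < +oo)%E].

Lemma second_moment_addle (f g : T -> R) : measurable_fun setT f -> measurable_fun setT g ->
  (second_moment P (fun w => f w + g w)%R <= 2%:E * (second_moment P f + second_moment P g))%E.
Proof.
move=> mf mg; rewrite !second_momentE -ge0_integralD//; last 4 first.
- by move=> w _; rewrite lee_fin sqr_ge0.
- by apply/measurable_EFinP; exact: measurable_funX.
- by move=> w _; rewrite lee_fin sqr_ge0.
- by apply/measurable_EFinP; exact: measurable_funX.
rewrite -ge0_integralZl//; last 2 first.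
- by apply/measurable_EFinP; apply: measurable_funD; exact: measurable_funX.
- by move=> w _; rewrite -EFinD lee_fin addr_ge0 ?sqr_ge0.
apply: ge0_le_integral => //.
- by move=> w _; rewrite lee_fin sqr_ge0.
- by apply/measurable_EFinP; apply: measurable_funX; exact: measurable_funD.
- by apply/measurable_EFinP; apply: measurable_funM => //; apply: measurable_funD; exact: measurable_funX.
- by move=> w _; rewrite -EFinD -EFinM lee_fin; have := sqr_ge0 (f w - g w); lra.
Qed.

Lemma l2procD s t f g : l2proc s t f -> l2proc s t g -> l2proc s t (fun u w => f u w + g u w).
Proof.
move=> [jf sf hf] [jg sg hg]; split; first exact: jointD.
  by move=> u su; apply: sqintD; [exact: sf|exact: sg].
apply: (@le_lt_trans _ _ (\int[lam]_(u in `[s, t])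
   (2%:E * (second_moment P (f u) + second_moment P (g u))))%E).
  apply: ge0_le_integral => //.
  - by move=> u _; exact: second_moment_ge0.
  - by apply: measurable_second_moment; exact: jointD.
  - apply: measurable_funeM; apply: emeasurable_funD; exact: measurable_second_moment.
  - move=> u /=; rewrite in_itv/= => su; apply: second_moment_addle.
      exact: joint_slice su.
    exact: joint_slice su.
rewrite ge0_integralZl//; last 2 first.
- apply: emeasurable_funD; exact: measurable_second_moment.
- by move=> u _; rewrite adde_ge0 ?second_moment_ge0.
rewrite ge0_integralD//; try exact: measurable_second_moment;
  try by move=> u _; exact: second_moment_ge0.
have i0 (k : R -> T -> R) : (0 <= \int[lam]_(u in `[s, t]) second_moment P (k u))%E.
  by apply: integral_ge0 => u _; exact: second_moment_ge0.
by rewrite lte_mul_pinfty ?lee_fin// lte_add_pinfty.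
Qed.

Lemma second_momentZ c (f : T -> R) : measurable_fun setT f ->
  second_moment P (fun w => c * f w)%R = ((c ^+ 2)%:E * second_moment P f)%E.
Proof.
move=> mf; rewrite !second_momentE -ge0_integralZl//.
- by apply: eq_integral => w _; rewrite exprMn EFinM.
- by apply/measurable_EFinP; exact: measurable_funX.
- by move=> w _; rewrite lee_fin sqr_ge0.
- by rewrite lee_fin sqr_ge0.
Qed.

Lemma l2procM s t (c : R -> R) M f : measurable_fun setT c ->
  (forall u, s <= u <= t -> `|c u| <= M) ->
  l2proc s t f -> l2proc s t (fun u w => c u * f u w).
Proof.
move=> mc cM [jf sf hf]; split.
- by apply: jointM => //; exact: joint_time.
- by move=> u su; apply: sqintZ; exact: sf.
apply: (@le_lt_trans _ _ (\int[lam]_(u in `[s, t])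
   ((M ^+ 2)%:E * second_moment P (f u)))%E).
  apply: ge0_le_integral => //.
  - by move=> u _; exact: second_moment_ge0.
  - by apply: measurable_second_moment; apply: jointM => //; exact: joint_time.
  - by apply: measurable_funeM; exact: measurable_second_moment.
  - move=> u /=; rewrite in_itv/= => su; rewrite second_momentZ.
      apply: lee_wpmul2r; first exact: second_moment_ge0.
      have M0 : 0 <= M by apply: le_trans (cM u su).
      by rewrite lee_fin -real_normK ?num_real// ler_sqr ?nnegrE// cM.
    exact: joint_slice su.
rewrite ge0_integralZl//; last 3 first.
- exact: measurable_second_moment.
- by move=> u _; exact: second_moment_ge0.
- by rewrite lee_fin sqr_ge0.
by rewrite lte_mul_pinfty ?lee_fin ?sqr_ge0.
Qed.

Lemma l2proc_const s t y : sqint P y -> l2proc s t (fun _ => y).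
Proof.
move=> sy; split => //.
  apply: measurable_funTS; apply: (measurableT_comp _ measurable_snd).
  by case: sy.
rewrite integral_cst//= lebesgue_measure_itv/=.
rewrite -[X in (X * _)%E]/(second_moment P y) second_moment_ip//; case: ifP => _; last by rewrite mule0 ltry.
by rewrite -EFinB -EFinM ltry.
Qed.

Lemma l2proc_sum s t (I : Type) (r : seq I) (F : I -> R -> T -> R) :
  (forall i, l2proc s t (F i)) -> l2proc s t (fun u w => \sum_(i <- r) F i u w).
Proof.
move=> h; elim: r => [|i r ih].
  under eq_fun do under eq_fun do rewrite big_nil.
  exact: (l2proc_const s t (sqint_cst P 0)).
under eq_fun do under eq_fun do rewrite big_cons.
exact: l2procD.
Qed.

Lemma l2proc_sub s t s' t' f : s <= s' -> t' <= t -> l2proc s t f -> l2proc s' t' f.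
Proof.
move=> ss tt [jf sf hf].
have sub : `[s', t'] `<=` `[s, t].
  by move=> u /=; rewrite !in_itv/= => /andP[h1 h2]; rewrite (le_trans ss h1) (le_trans h2 tt).
split.
- apply: measurable_funS jf; first exact: measurable_box.
  by move=> [u w] /= [hu _]; split => //; exact: sub.
- by move=> u su; apply: sf; have := sub u; rewrite /= !in_itv/=; apply.
- apply: le_lt_trans hf; apply: ge0_subset_integral => //.
    exact: measurable_second_moment.
  by move=> u _; exact: second_moment_ge0.
Qed.

End L2Processes.

(** * Pathwise time integrals *)

Section TimeIntegral.
Context {disp : measure_display} {T : measurableType disp} {R : realType}.
Variable P : probability T R.
Local Notation lam := (@lebesgue_measure R).

(** By polarization it suffices to treat f = g. *)
Lemma ip_time_integrable s t f g : l2proc P s t f -> l2proc P s t g ->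
  lam.-integrable `[s, t] (EFin \o (fun u => ip P (f u) (g u))).
Proof.
have diag k : l2proc P s t k ->
  lam.-integrable `[s, t] (EFin \o (fun u => ip P (k u) (k u))).
  move=> [jk sk hk].
  have ik : lam.-integrable `[s, t] (fun u => second_moment P (k u)).
    apply/integrableP; split; first exact: measurable_second_moment.
    by under eq_integral do rewrite gee0_abs ?second_moment_ge0//.
  apply: eq_integrable ik => //.
  by move=> u; rewrite mem_setE in_itv/= => su; rewrite (second_moment_ip (sk _ su)).
move=> hf hg; have hfg := l2procD hf hg.
have i3 : lam.-integrable `[s, t] (fun u => (2^-1)%:E *
  ((ip P (fun w => f u w + g u w)%R (fun w => f u w + g u w)%R)%:E
    - (ip P (f u) (f u))%:E - (ip P (g u) (g u))%:E))%E.
  apply: integrableZl => //.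
  apply: integrableB => //; last exact: diag hg.
  by apply: integrableB => //; [exact: diag hfg|exact: diag hf].
apply: eq_integrable i3 => //.
move=> u; rewrite mem_setE in_itv/= => su.
have [[_ sf _] [_ sg _]] := (hf, hg).
rewrite ipDD; [|exact: sf|exact: sg].
by rewrite -!EFinB -EFinM; congr EFin; field.
Qed.

Definition tint s t (f : R -> T -> R) (w : T) : R := \int[lam]_(u in `[s, t]) f u w.

Section Fubini.
Variables (s t : R) (f : R -> T -> R) (y : T -> R).
Hypotheses (st : s <= t) (hf : l2proc P s t f) (sy : sqint P y).

Let phi (z : R * T) : \bar R := (y z.2 * cut s t f z)%:E.

Let mphi : measurable_fun setT phi.
Proof.
apply/measurable_EFinP; apply: measurable_funM; last by apply: cut_measurable; case: hf.
by apply: (measurableT_comp _ measurable_snd); case: sy.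
Qed.

Let phi_section u : (\int[P]_w phi (u, w) = ((fun u => (ip P y (f u))%:E) \_ `[s, t]) u)%E.
Proof.
rewrite patchE mem_setE in_itv/= /phi; case: ifPn => su.
  have [_ sf _] := hf.
  rewrite /ip /Rintegral fineK; last exact: integrable_fin_num (sqint_integrableM sy (sf _ su)).
  by apply: eq_integral => w _; rewrite cutE su.
by under eq_integral do rewrite cutE (negbTE su) mulr0; rewrite integral0.
Qed.

Let iphi : (lam \x P)%E.-integrable setT phi.
Proof.
have [jf sf ff] := hf.
apply/integrable12ltyP => //.
apply: (@le_lt_trans _ _ (\int[lam]_u ((fun u => (second_moment P y + second_moment P (f u))%E) \_ `[s, t]) u)%E).
  apply: ge0_le_integral => //.
  - by move=> u _; apply: integral_ge0 => w _; exact: abse_ge0.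
  - apply: (measurable_fun_fubini_tonelli_F (m2 := P) (fun z => `|phi z|%E)) => //.
    exact: measurableT_comp.
  - apply/(measurable_restrictT _ (measurable_itv _)).
    by apply: emeasurable_funD => //; exact: measurable_second_moment.
  - move=> u _; rewrite patchE mem_setE in_itv/=; case: ifPn => su; last first.
      rewrite (_ : (fun _ => _) = (fun=> 0%E)) ?integral0//.
      by apply/funext => w; rewrite /phi cutE (negbTE su) mulr0 /= normr0.
    have [/sqintP[my iy] /sqintP[mf if_]] := (sy, sf u su).
    rewrite !second_momentE -ge0_integralD//; last 4 first.
    - by move=> w _; rewrite lee_fin sqr_ge0.
    - by apply/measurable_EFinP; exact: measurable_funX.
    - by move=> w _; rewrite lee_fin sqr_ge0.
    - by apply/measurable_EFinP; exact: measurable_funX.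
    apply: ge0_le_integral => //.
    - apply: measurableT_comp => //.
      apply: measurableT_comp => //; apply: measurable_funM => //.
      exact: (measurableT_comp (cut_measurable jf) (@pair1_measurable _ _ _ T u)).
    - by apply: emeasurable_funD; apply/measurable_EFinP; exact: measurable_funX.
    - move=> w _; rewrite /phi cutE su lee_fin normrM.
      have := sqr_ge0 (`|y w| - `|f u w|); rewrite sqrrB !real_normK ?num_real// => h.
      have h2 : 0 <= `|y w| * `|f u w| by rewrite mulr_ge0.
      lra.
rewrite -integral_mkcond ge0_integralD//; last 3 first.
- by move=> u _; exact: second_moment_ge0.
- by move=> u _; exact: second_moment_ge0.
- exact: measurable_second_moment.
apply: lte_add_pinfty => //.
by have [] := l2proc_const s t sy.
Qed.

Lemma tint_ae_integrable_mul :
  {ae P, forall w, lam.-integrable `[s, t] (EFin \o (fun u => y w * f u w))}.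
Proof.
have := ae_integrable2 iphi; apply: filterS => w.
move=> h; have E := @integrable_mkcond _ _ _ lam `[s, t]%classic (EFin \o (fun u => y w * f u w)) (measurable_itv _).
apply: E.2.
apply: eq_integrable h => // u _; rewrite /phi cutE patchE mem_setE in_itv/=.
by case: ifP => //; rewrite mulr0.
Qed.

Lemma tint_integralE w : (\int[lam]_u phi (u, w) = \int[lam]_(u in `[s, t]) (y w * f u w)%:E)%E.
Proof.
rewrite [RHS]integral_mkcond; apply: eq_integral => u _.
by rewrite /phi cutE patchE mem_setE in_itv/=; case: ifP => //; rewrite mulr0.
Qed.

Lemma tint_measurable_mul :
  measurable_fun setT (fun w => fine (\int[lam]_(u in `[s, t]) (y w * f u w)%:E)%E).
Proof.
apply: measurableT_comp => //.
rewrite (_ : (fun _ => _) = (fun w => \int[lam]_u phi (u, w))%E); last first.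
  by apply/funext => w; rewrite tint_integralE.
exact: (measurable_fubini_G iphi).
Qed.

Lemma tint_fubini : \int[P]_w (\int[lam]_(u in `[s, t]) (y w * f u w)) =
  \int[lam]_(u in `[s, t]) ip P y (f u).
Proof.
rewrite /Rintegral; congr fine.
transitivity (\int[P]_w \int[lam]_u phi (u, w))%E.
  apply: ae_eq_integral => //.
  - by apply/measurable_EFinP; exact: tint_measurable_mul.
  - exact: (measurable_fubini_G iphi).
  - have := tint_ae_integrable_mul; apply: filterS => w iw _.
    by rewrite fineK ?tint_integralE//; exact: integrable_fin_num.
rewrite -(Fubini iphi).
rewrite [RHS]integral_mkcond; apply: eq_integral => u _.
exact: phi_section.
Qed.

End Fubini.

Section TimeIntegralFacts.
Variables (s t : R) (f : R -> T -> R).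
Hypotheses (st : s <= t) (hf : l2proc P s t f).

Lemma tint_ae_integrable : {ae P, forall w, lam.-integrable `[s, t] (EFin \o f^~ w)}.
Proof.
have := tint_ae_integrable_mul hf (sqint_cst P 1); apply: filterS => w.
by apply: eq_integrable => // u _ /=; rewrite mul1r.
Qed.

Lemma tint_measurable : measurable_fun setT (tint s t f).
Proof.
have := tint_measurable_mul hf (sqint_cst P 1); apply: eq_measurable_fun => w _.
by rewrite /tint /Rintegral; congr fine; apply: eq_integral => u _ /=; rewrite mul1r.
Qed.

Lemma tint_sq_ae_integrable : {ae P, forall w, lam.-integrable `[s, t] (EFin \o (fun u => f u w ^+ 2))}.
Proof.
have [jf sf ff] := hf.
have mc2 : measurable_fun setT (fun z => (cut s t f z ^+ 2)%:E).
  by apply/measurable_EFinP; apply: measurable_funX; exact: cut_measurable.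
have i2 : (lam \x P)%E.-integrable setT (fun z => (cut s t f z ^+ 2)%:E).
  apply/integrable12ltyP => //.
  under eq_integral do under eq_integral do rewrite /= ger0_norm ?sqr_ge0//.
  under eq_integral do rewrite cut_int.
  by rewrite -integral_mkcond.
have := ae_integrable2 i2; apply: filterS => w.
move=> h; have E := @integrable_mkcond _ _ _ lam `[s, t]%classic (EFin \o (fun u => f u w ^+ 2)) (measurable_itv _).
apply: E.2.
apply: eq_integrable h => // u _; rewrite cutE patchE mem_setE in_itv/=.
by case: ifP => //; rewrite expr0n.
Qed.

(** Pathwise Cauchy-Schwarz in the time variable, integrated over the probability
    space. *)
Lemma tint_second_moment : (second_moment P (tint s t f) <=
  (t - s)%:E * \int[lam]_(u in `[s, t]) second_moment P (f u))%E.
Proof.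
have [jf sf ff] := hf.
have mc2 : measurable_fun setT (fun z => (cut s t f z ^+ 2)%:E).
  by apply/measurable_EFinP; apply: measurable_funX; exact: cut_measurable.
have -> : (\int[lam]_(u in `[s, t]) second_moment P (f u) =
   \int[P]_w \int[lam]_u (cut s t f (u, w) ^+ 2)%:E)%E.
  rewrite -(fubini_tonelli (m1 := lam) (m2 := P) (fun z => (cut s t f z ^+ 2)%:E))//.
    by rewrite integral_mkcond; apply: eq_integral => u _; rewrite -cut_int.
  by move=> z; rewrite lee_fin sqr_ge0.
have mG : measurable_fun setT (fun w => \int[lam]_u (cut s t f (u, w) ^+ 2)%:E)%E.
  apply: (measurable_fun_fubini_tonelli_G (m1 := lam) (fun z => (cut s t f z ^+ 2)%:E)) => //.
  by move=> z; rewrite lee_fin sqr_ge0.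
rewrite -ge0_integralZl//; last 2 first.
- by move=> w _; apply: integral_ge0 => u _; rewrite lee_fin sqr_ge0.
- by rewrite lee_fin subr_ge0.
rewrite second_momentE.
apply: ae_ge0_le_integral => //.
- by move=> w _; rewrite lee_fin sqr_ge0.
- by apply/measurable_EFinP; apply: measurable_funX; exact: tint_measurable.
- move=> w _; apply: mule_ge0; first by rewrite lee_fin subr_ge0.
  by apply: integral_ge0 => u _; rewrite lee_fin sqr_ge0.
- exact: measurable_funeM.
have := tint_ae_integrable; have := tint_sq_ae_integrable; apply: filterS2 => w i2 i1 _.
have -> : (\int[lam]_u (cut s t f (u, w) ^+ 2)%:E = \int[lam]_(u in `[s, t]) (f u w ^+ 2)%:E)%E.
  rewrite [RHS]integral_mkcond; apply: eq_integral => u _.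
  by rewrite cutE patchE mem_setE in_itv/=; case: ifP => //; rewrite expr0n.
rewrite -(fineK (integrable_fin_num _ i2))// -EFinM lee_fin.
rewrite -[fine _]/(\int[lam]_(u in `[s, t]) (f u w ^+ 2)).
have lamE : lam `[s, t]%classic = (t - s)%:E.
  rewrite lebesgue_measure_itv/= lte_fin.
  by move: st; rewrite le_eqVlt => /orP[/eqP->|->//]; rewrite ltxx subrr.
have lam_st : fine (lam `[s, t]%classic) = t - s by rewrite lamE.
set D := tint s t f w.
have key c : 0 <= \int[lam]_(u in `[s, t]) (f u w ^+ 2) - 2 * c * D + c ^+ 2 * (t - s).
  have ic : lam.-integrable `[s, t] (EFin \o (fun=> c ^+ 2)).
    have mc : measurable_fun `[s, t] (EFin \o (fun=> c ^+ 2) : R -> \bar R) by exact: measurable_cst.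
    apply/integrableP; split; first exact: mc.
    rewrite [X in (X < _)%E](@integral_cst _ _ _ lam _ (measurable_itv `[s, t]) `|(c ^+ 2)%:E|%E).
    by rewrite [X in (_ * X < _)%E]lamE -EFinM ltry.
  have i3 : lam.-integrable `[s, t] (EFin \o (fun u => 2 * c * f u w)).
    by apply: eq_integrable (integrableZl _ (2 * c) i1) => //.
  have -> : \int[lam]_(u in `[s, t]) (f u w ^+ 2) - 2 * c * D + c ^+ 2 * (t - s) =
     \int[lam]_(u in `[s, t]) ((f u w ^+ 2 - 2 * c * f u w) + c ^+ 2).
    rewrite RintegralD//; last first.
      by apply: eq_integrable (integrableB _ i2 i3) => //.
    rewrite RintegralB// Rintegral_cst// lam_st /D /tint -RintegralZl//.
  apply: Rintegral_ge0 => u _.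
  by have := sqr_ge0 (f u w - c); rewrite sqrrB; lra.
have [e|ne] := eqVneq s t.
  have := key 0; have D0 : D = 0.
    rewrite /D /tint e set_itv1; exact: Rintegral_set1.
  by rewrite D0 e subrr !mul0r expr0n.
have h : 0 < t - s by rewrite subr_gt0 lt_neqAle ne st.
have := key (D / (t - s)).
have -> : 2 * (D / (t - s)) * D = 2 * (D ^+ 2 / (t - s)) by field; rewrite gt_eqF.
have -> : (D / (t - s)) ^+ 2 * (t - s) = D ^+ 2 / (t - s) by field; rewrite gt_eqF.
move=> h1; rewrite mulrC -ler_pdivrMr//; lra.
Qed.

Lemma tint_sqint : sqint P (tint s t f).
Proof.
split; first exact: tint_measurable.
have [_ _ ff] := hf.
apply: le_lt_trans tint_second_moment _; rewrite lte_mul_pinfty ?lee_fin ?subr_ge0//.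
Qed.

Lemma tint_ip y : sqint P y -> ip P y (tint s t f) = \int[lam]_(u in `[s, t]) ip P y (f u).
Proof.
move=> sy; rewrite -(tint_fubini hf sy) /ip /Rintegral; congr fine.
apply: ae_eq_integral => //.
- by apply/measurable_EFinP; apply: measurable_funM; [case: sy|exact: tint_measurable].
- by apply/measurable_EFinP; exact: tint_measurable_mul.
- have := tint_ae_integrable; apply: filterS => w iw _.
  by congr EFin; rewrite -[LHS]RintegralZl.
Qed.

End TimeIntegralFacts.

End TimeIntegral.

(** * The Ito integral: isometry and linearity *)

Section ItoIntegral.
Context {disp : measure_display} {T : measurableType disp} {R : realType}.
Variable P : probability T R.
Variable W : R -> T -> R.
Hypothesis Pc : measure_is_complete P.
Hypothesis hW : two_sided_wiener P W.
Local Notation lam := (@lebesgue_measure R).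

(** Young's inequality in this weighted form compares second moments of nearby
    functions without knowing that they are finite. *)
Lemma second_moment_young (eta : R) (f g : T -> R) : 0 < eta ->
  measurable_fun setT f -> measurable_fun setT g ->
  (second_moment P f <= (1 + eta)%:E * second_moment P g +
    (1 + eta^-1)%:E * second_moment P (fun w => f w - g w)%R)%E.
Proof.
move=> e0 mf mg.
have me1 : (0 : R) <= 1 + eta by rewrite addr_ge0// ltW.
have me2 : (0 : R) <= 1 + eta^-1 by rewrite addr_ge0// invr_ge0 ltW.
have mfg : measurable_fun setT (fun w => f w - g w) by exact: measurable_funB.
have mg2 : measurable_fun setT (fun w => (g w ^+ 2)%:E).
  by apply/measurable_EFinP; exact: measurable_funX.
have mfg2 : measurable_fun setT (fun w => ((f w - g w) ^+ 2)%:E).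
  by apply/measurable_EFinP; exact: measurable_funX.
rewrite !second_momentE.
rewrite -!ge0_integralZl ?lee_fin//; try by move=> w _; rewrite lee_fin sqr_ge0.
rewrite -ge0_integralD//; last 4 first.
- by move=> w _; rewrite -EFinM lee_fin mulr_ge0 ?sqr_ge0.
- exact: measurable_funeM.
- by move=> w _; rewrite -EFinM lee_fin mulr_ge0 ?sqr_ge0.
- exact: measurable_funeM.
apply: ge0_le_integral => //.
- by move=> w _; rewrite lee_fin sqr_ge0.
- by apply/measurable_EFinP; exact: measurable_funX.
- by apply: emeasurable_funD; exact: measurable_funeM.
- move=> w _; rewrite -!EFinM -EFinD lee_fin.
  rewrite -subr_ge0.
  set x := f w; set y := g w.
  have -> : (1 + eta) * y ^+ 2 + (1 + eta^-1) * (x - y) ^+ 2 - x ^+ 2 =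
    eta^-1 * (eta * y - (x - y)) ^+ 2 by field; rewrite gt_eqF.
  by rewrite mulr_ge0 ?sqr_ge0// invr_ge0 ltW.
Qed.

Lemma time_young (eta s t : R) (f g : R -> T -> R) : 0 < eta ->
  joint s t f -> joint s t g ->
  (\int[lam]_(u in `[s, t]) second_moment P (f u) <=
    (1 + eta)%:E * \int[lam]_(u in `[s, t]) second_moment P (g u) +
    (1 + eta^-1)%:E * \int[lam]_(u in `[s, t]) second_moment P (fun w => f u w - g u w)%R)%E.
Proof.
move=> e0 jf jg.
have me1 : (0 : R) <= 1 + eta by rewrite addr_ge0// ltW.
have me2 : (0 : R) <= 1 + eta^-1 by rewrite addr_ge0// invr_ge0 ltW.
have jfg : joint s t (fun u w => f u w - g u w) by exact: measurable_funB.
have m1 := measurable_second_moment P jf.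
have m2 := measurable_second_moment P jg.
have m3 := measurable_second_moment P jfg.
rewrite -!ge0_integralZl ?lee_fin//; try by move=> u _; exact: second_moment_ge0.
rewrite -ge0_integralD//; last 4 first.
- by move=> u _; rewrite mule_ge0 ?second_moment_ge0.
- exact: measurable_funeM.
- by move=> u _; rewrite mule_ge0 ?second_moment_ge0.
- exact: measurable_funeM.
apply: ge0_le_integral => //.
- by move=> u _; exact: second_moment_ge0.
- by apply: emeasurable_funD; exact: measurable_funeM.
- move=> u /=; rewrite in_itv/= => su; apply: second_moment_young => //.
    exact: joint_slice su.
  exact: joint_slice su.
Qed.

Lemma cvg0_small (a : nat -> \bar R) (eps : R) : 0 < eps -> a n @[n --> \oo] --> 0%E ->
  \forall n \near \oo, (a n < eps%:E)%E.
Proof.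
move=> e0 ha.
have h : nbhs (0%E : \bar R) [set y | (y < eps%:E)%E].
  apply: open_nbhs_nbhs; split; first exact: open_ereal_lt_ereal.
  by rewrite /= lte_fin.
exact: (ha _ h).
Qed.

(** Passage to the limit in the isometry.  In the application x is the second
    moment of the integral, y the energy of the integrand, c the energy of an
    approximating step process, v c the second moment of its integral, and a, b are
    the two approximation errors. *)
Lemma squeeze_eq (x y v : R) : 0 <= x -> 0 <= y -> 0 <= v ->
  (forall eps, 0 < eps -> exists a b c : R, [/\ a < eps, b < eps &
     forall eta, 0 < eta -> [/\ x <= (1 + eta) * (v * c) + (1 + eta^-1) * a,
       v * c <= (1 + eta) * x + (1 + eta^-1) * a,
       c <= (1 + eta) * y + (1 + eta^-1) * b &
       y <= (1 + eta) * c + (1 + eta^-1) * b]]) ->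
  x = v * y.
Proof.
move=> x0 y0 v0 h.
pose C := 3 * v * y + 3 * x + 8 * v + 8.
have C0 : 0 < C.
  have vy0 : 0 <= v * y by exact: mulr_ge0.
  rewrite /C; nra.
have key eta : 0 < eta -> eta <= 1 -> `|x - v * y| <= eta * C.
  move=> e0 e1.
  have [a [b [c [ae be /(_ _ e0)[h1 h2 h3 h4]]]]] := h (eta ^+ 2) (exprn_gt0 2 e0).
  have k0 : 0 < 1 + eta^-1 by rewrite ltr_wpDl// ?invr_gt0.
  have ek : (1 + eta^-1) * eta ^+ 2 <= 2 * eta.
    have -> : (1 + eta^-1) * eta ^+ 2 = eta ^+ 2 + eta by field; rewrite gt_eqF.
    nra.
  have ka : (1 + eta^-1) * a <= 2 * eta.
    by apply: le_trans ek; rewrite ler_pM2l// ltW.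
  have kb : (1 + eta^-1) * b <= 2 * eta.
    by apply: le_trans ek; rewrite ler_pM2l// ltW.
  have h1' : x <= (1 + eta) * (v * c) + 2 * eta by lra.
  have h2' : v * c <= (1 + eta) * x + 2 * eta by lra.
  have h3' : v * c <= v * ((1 + eta) * y + 2 * eta) by apply: ler_wpM2l => //; lra.
  have h4' : v * y <= v * ((1 + eta) * c + 2 * eta) by apply: ler_wpM2l => //; lra.
  have h1e : x <= (1 + eta) * (v * ((1 + eta) * y + 2 * eta)) + 2 * eta.
    apply: le_trans h1' _; rewrite lerD2r ler_wpM2l//; lra.
  have h4e : v * y <= (1 + eta) * ((1 + eta) * x + 2 * eta) + 2 * eta * v.
    apply: le_trans h4' _.
    have -> : v * ((1 + eta) * c + 2 * eta) = (1 + eta) * (v * c) + 2 * eta * v by ring.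
    rewrite lerD2r ler_wpM2l//; lra.
  have vy0 : 0 <= v * y by exact: mulr_ge0.
  have E1 : (1 + eta) * (v * ((1 + eta) * y + 2 * eta)) + 2 * eta - v * y =
     eta * (2 * (v * y) + 2 * v + 2) + eta * eta * ((v * y) + 2 * v) by ring.
  have E2 : (1 + eta) * ((1 + eta) * x + 2 * eta) + 2 * eta * v - x =
     eta * (2 * x + 2 + 2 * v) + eta * eta * (x + 2) by ring.
  have ee : eta * eta <= eta by rewrite ler_piMr// ltW.
  have B1 : eta * eta * (v * y + 2 * v) <= eta * (v * y + 2 * v).
    by apply: ler_wpM2r => //; rewrite addr_ge0// mulr_ge0.
  have B2 : eta * eta * (x + 2) <= eta * (x + 2) by apply: ler_wpM2r => //; lra.
  have vye : 0 <= eta * (v * y) by rewrite mulr_ge0// ltW.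
  have ve : 0 <= eta * v by rewrite mulr_ge0// ltW.
  have xe : 0 <= eta * x by rewrite mulr_ge0// ltW.
  rewrite ler_norml /C; apply/andP; split; nra.
apply/eqP; rewrite -subr_eq0 -normr_eq0 eq_le normr_ge0 andbT.
apply/ler_addgt0Pl => eps e0; rewrite addr0.
have eC : 0 < Num.min 1 (eps / C) by rewrite lt_min ltr01 divr_gt0.
apply: le_trans (key _ eC _) _; first by rewrite ge_min lexx.
by rewrite -ler_pdivlMr// ge_min lexx orbT.
Qed.

(** The isometry holds for step processes and both sides are continuous for the two
    convergences in the definition of the integral. *)
Lemma ito_isometry_ereal s t f I : is_ito_integral P W s t f I ->
  sqint P I /\ second_moment P I =
    (wvar%:E * \int[lam]_(u in `[s, t]) second_moment P (f u))%E.
Proof.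
move=> [jf af hf mI [e [he ef eI]]].
have w0 := @wvar_gt0 R.
set Y := (\int[lam]_(u in `[s, t]) second_moment P (f u))%E in hf *.
pose J n := step_integral W (e n).
have sJ n : sqint P (J n) := L2at_sqint Pc hW (step_integral_L2 Pc hW (he n)).
pose a n := second_moment P (fun w => I w - J n w).
pose b n := (\int[lam]_(u in `[s, t]) second_moment P (fun w => f u w - step_value (e n) u w)%R)%E.
pose G n := (\int[lam]_(u in `[s, t]) second_moment P (step_value (e n) u))%E.
have iso n : second_moment P (J n) = (wvar%:E * G n)%E := step_isometry Pc hW (he n).
have je n : joint s t (step_value (e n)).
  by apply: measurable_funTS; exact: (step_value_measurable Pc hW (he n)).
have Y0 : (0 <= Y)%E by apply: integral_ge0 => u _; exact: second_moment_ge0.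
have G0 n : (0 <= G n)%E by apply: integral_ge0 => u _; exact: second_moment_ge0.
have b0 n : (0 <= b n)%E by apply: integral_ge0 => u _; exact: second_moment_ge0.
have a0 n : (0 <= a n)%E by exact: second_moment_ge0.
have small eps : 0 < eps -> exists n, (a n < eps%:E)%E /\ (b n < eps%:E)%E.
  move=> e0; have [n [an bn]] := filter_ex (filterI (cvg0_small e0 eI) (cvg0_small e0 ef)).
  by exists n.
have yx eta n : 0 < eta -> (second_moment P I <= (1 + eta)%:E * second_moment P (J n) + (1 + eta^-1)%:E * a n)%E.
  by move=> e0; apply: second_moment_young => //; case: (sJ n).
have xy eta n : 0 < eta -> (second_moment P (J n) <= (1 + eta)%:E * second_moment P I + (1 + eta^-1)%:E * a n)%E.
  move=> e0; have := second_moment_young e0 (proj1 (sJ n)) mI.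
  congr (_ <= _ + _ * _)%E; rewrite /a !second_momentE; apply: eq_integral => w _.
  by rewrite -sqrrN opprB.
have tyx eta n : 0 < eta -> (Y <= (1 + eta)%:E * G n + (1 + eta^-1)%:E * b n)%E.
  by move=> e0; exact: time_young.
have txy eta n : 0 < eta -> (G n <= (1 + eta)%:E * Y + (1 + eta^-1)%:E * b n)%E.
  move=> e0; have := time_young e0 (je n) jf.
  congr (_ <= _ + _ * _)%E; apply: eq_integral => u _; rewrite !second_momentE; apply: eq_integral => w _.
  by rewrite -sqrrN opprB.
have sI : sqint P I.
  split => //.
  have [n [an _]] := small 1 ltr01.
  apply: le_lt_trans (yx 1 n ltr01) _.
  have fa : a n \is a fin_num by rewrite ge0_fin_numE//; exact: lt_trans an (ltry _).
  rewrite (second_moment_ip (sJ n)) -(fineK fa) -!EFinM -EFinD; exact: ltry.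
split => //.
have fY : Y \is a fin_num by rewrite ge0_fin_numE.
rewrite (second_moment_ip sI) -(fineK fY) -EFinM; congr EFin.
apply: squeeze_eq; [exact: ip_ge0|exact: fine_ge0|exact: ltW|].
move=> eps e0; have [n [an bn]] := small eps e0.
have fa : a n \is a fin_num by rewrite ge0_fin_numE//; exact: lt_trans an (ltry _).
have fb : b n \is a fin_num by rewrite ge0_fin_numE//; exact: lt_trans bn (ltry _).
have fG : G n \is a fin_num.
  rewrite ge0_fin_numE//; apply: le_lt_trans (txy 1 n ltr01) _.
  by rewrite -(fineK fY) -(fineK fb) -!EFinM -EFinD ltry.
exists (fine (a n)), (fine (b n)), (fine (G n)); split.
- by rewrite -lte_fin fineK.
- by rewrite -lte_fin fineK.
move=> eta h0.
have Ec : wvar * fine (G n) = ip P (J n) (J n).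
  by apply: EFin_inj; rewrite -(second_moment_ip (sJ n)) iso EFinM (fineK fG).
rewrite Ec; split; rewrite -lee_fin EFinD [X in (_ <= X + _)%E]EFinM [X in (_ <= _ + X)%E]EFinM.
- by rewrite (fineK fa) -(second_moment_ip sI) -(second_moment_ip (sJ n)); exact: yx.
- by rewrite (fineK fa) -(second_moment_ip sI) -(second_moment_ip (sJ n)); exact: xy.
- by rewrite (fineK fb) (fineK fG) (fineK fY); exact: txy.
- by rewrite (fineK fb) (fineK fG) (fineK fY); exact: tyx.
Qed.

Lemma ito_isometry s t f I : l2proc P s t f -> is_ito_integral P W s t f I ->
  sqint P I /\ ip P I I = wvar * \int[lam]_(u in `[s, t]) ip P (f u) (f u).
Proof.
move=> [_ sf ff] /ito_isometry_ereal[sI E]; split => //.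
apply: EFin_inj; rewrite -(second_moment_ip sI) E EFinM; congr (_ * _)%E.
rewrite /Rintegral fineK.
  by apply: eq_integral => u; rewrite mem_setE in_itv/= => su; rewrite (second_moment_ip (sf _ su)).
rewrite (_ : (\int[lam]_(u in `[s, t]) (ip P (f u) (f u))%:E)%E =
   (\int[lam]_(u in `[s, t]) second_moment P (f u))%E).
  by rewrite ge0_fin_numE//; apply: integral_ge0 => u _; exact: second_moment_ge0.
by apply: eq_integral => u; rewrite mem_setE in_itv/= => su; rewrite (second_moment_ip (sf _ su)).
Qed.

Lemma ito_orth s t f I y : is_ito_integral P W s t f I -> L2at P W s y -> ip P y I = 0.
Proof.
move=> hI hy; have [sI _] := ito_isometry_ereal hI.
have [jf af hf mI [e [he ef eI]]] := hI.
have sy := L2at_sqint Pc hW hy.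
apply/eqP; rewrite -normr_eq0 eq_le normr_ge0 andbT.
apply/ler_addgt0Pl => eps e0; rewrite addr0.
have d0 : 0 < (eps / (nrm P y + 1)) ^+ 2.
  by rewrite exprn_gt0// divr_gt0// ltr_wpDl// nrm_ge0.
have [n an] := filter_ex (cvg0_small d0 eI).
have sJ := L2at_sqint Pc hW (step_integral_L2 Pc hW (he n)).
have sD : sqint P (fun w => I w + (-1) * step_integral W (e n) w).
  by apply: sqintD => //; exact: sqintZ.
have E : ip P y I = ip P y (fun w => I w + (-1) * step_integral W (e n) w).
  by rewrite ipDr// ?ipZr// ?(step_integral_orth Pc hW (he n) hy) ?mulr0 ?addr0//; exact: sqintZ.
rewrite E; apply: le_trans (ip_CS sy sD) _.
have : nrm P (fun w => I w + (-1) * step_integral W (e n) w) <= eps / (nrm P y + 1).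
  rewrite /nrm -[leRHS]ger0_norm; last by rewrite divr_ge0 ?ltW// ltr_wpDl// nrm_ge0.
  rewrite -sqrtr_sqr ler_sqrt ?sqr_ge0// -lee_fin -(second_moment_ip sD).
  apply: ltW; move: an; congr (_ < _)%E; rewrite !second_momentE.
  by apply: eq_integral => w _; rewrite mulN1r.
move=> h; apply: (@le_trans _ _ (nrm P y * (eps / (nrm P y + 1)))).
  by apply: ler_wpM2l => //; exact: nrm_ge0.
have y0 := nrm_ge0 P y.
rewrite [leLHS]mulrCA ler_piMr ?(ltW e0)// ler_pdivrMr ?mul1r ?lerDl//.
by rewrite ltr_wpDl.
Qed.

Lemma second_moment_comb_le (c : R) (f g : T -> R) : measurable_fun setT f -> measurable_fun setT g ->
  (second_moment P (fun w => c * f w + g w)%R <=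
   2%:E * ((c ^+ 2)%:E * second_moment P f + second_moment P g))%E.
Proof.
move=> mf mg; have mcf : measurable_fun setT (fun w => c * f w) by exact: measurable_funM.
by have := second_moment_addle P mcf mg; rewrite second_momentZ.
Qed.

Lemma ito_comb s t c f g I J : is_ito_integral P W s t f I -> is_ito_integral P W s t g J ->
  is_ito_integral P W s t (fun u w => c * f u w + g u w) (fun w => c * I w + J w).
Proof.
move=> [jf af hf mI [e1 [he1 ef1 eI1]]] [jg ag hg mJ [e2 [he2 ef2 eI2]]].
have mst u : s <= u <= t -> measurable_fun setT (f u) /\ measurable_fun setT (g u).
  by move=> su; split; [exact: joint_slice jf su|exact: joint_slice jg su].
have jcf : joint s t (fun u w => c * f u w).
  by apply: jointM => //; exact: joint_const.
have jh : joint s t (fun u w => c * f u w + g u w) by exact: jointD.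
have int_le (k1 k2 : R -> T -> R) : joint s t k1 -> joint s t k2 ->
  (\int[lam]_(u in `[s, t]) second_moment P (fun w => c * k1 u w + k2 u w)%R <=
   2%:E * ((c ^+ 2)%:E * \int[lam]_(u in `[s, t]) second_moment P (k1 u)
      + \int[lam]_(u in `[s, t]) second_moment P (k2 u)))%E.
  move=> j1 j2.
  have m1 := measurable_second_moment P j1.
  have m2 := measurable_second_moment P j2.
  rewrite -!ge0_integralZl ?lee_fin ?sqr_ge0//; try by move=> u _; exact: second_moment_ge0.
  rewrite -ge0_integralD//; last 3 first.
  - by move=> u _; rewrite mule_ge0 ?second_moment_ge0// lee_fin sqr_ge0.
  - exact: measurable_funeM.
  - by move=> u _; exact: second_moment_ge0.
  have m3 : measurable_fun `[s, t] (fun u => (c ^+ 2)%:E * second_moment P (k1 u) + second_moment P (k2 u))%E.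
    by apply: emeasurable_funD => //; exact: measurable_funeM.
  rewrite -ge0_integralZl//; last first.
  - by move=> u _; rewrite adde_ge0 ?second_moment_ge0// mule_ge0 ?second_moment_ge0// lee_fin sqr_ge0.
  apply: ge0_le_integral => //.
  - by move=> u _; exact: second_moment_ge0.
  - apply: measurable_second_moment; apply: jointD => //.
    by apply: jointM => //; exact: joint_const.
  - exact: measurable_funeM.
  - move=> u /=; rewrite in_itv/= => su; apply: second_moment_comb_le.
      exact: joint_slice j1 su.
    exact: joint_slice j2 su.
have hn n := step_comb Pc hW c (he1 n) (he2 n).
have [e he] := choice hn.
have je1 n : joint s t (step_value (e1 n)).
  by apply: measurable_funTS; exact: (step_value_measurable Pc hW (he1 n)).
have je2 n : joint s t (step_value (e2 n)).
  by apply: measurable_funTS; exact: (step_value_measurable Pc hW (he2 n)).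
have lim0 (a b : nat -> \bar R) : a n @[n --> \oo] --> 0%E -> b n @[n --> \oo] --> 0%E ->
   (2%:E * ((c ^+ 2)%:E * a n + b n))%E @[n --> \oo] --> 0%E.
  move=> ha hb.
  have -> : (0 = 2%:E * ((c ^+ 2)%:E * 0 + 0) :> \bar R)%E by rewrite mule0 adde0 mule0.
  by apply: cvgeZl => //; apply: cvgeD => //; apply: cvgeZl.
split => //.
- move=> u su; apply: adaptedD; last exact: ag.
  by apply: adaptedZ; exact: af.
- apply: le_lt_trans (int_le _ _ jf jg) _.
  rewrite lte_mul_pinfty ?lee_fin// lte_add_pinfty// lte_mul_pinfty ?lee_fin ?sqr_ge0//.
- by apply: measurable_funD => //; exact: measurable_funM.
exists e; split.
- by move=> n; have [] := he n.
- apply: (squeeze_cvge _ (cvg_cst 0%E) (lim0 _ _ ef1 ef2)).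
  near=> n; apply/andP; split.
    by apply: integral_ge0 => u _; exact: second_moment_ge0.
  have [_ ev _] := he n.
  rewrite (_ : (\int[lam]_(u in `[s, t]) second_moment P (fun w => c * f u w + g u w - step_value (e n) u w)%R)%E =
    (\int[lam]_(u in `[s, t]) second_moment P (fun w => c * (f u w - step_value (e1 n) u w) + (g u w - step_value (e2 n) u w))%R)%E).
    apply: (int_le (fun u w => f u w - step_value (e1 n) u w) (fun u w => g u w - step_value (e2 n) u w)).
      exact: (measurable_funB jf (je1 n)).
    exact: (measurable_funB jg (je2 n)).
  by apply: eq_integral => u _; congr second_moment; apply/funext => w; rewrite ev; ring.
- apply: (squeeze_cvge _ (cvg_cst 0%E) (lim0 _ _ eI1 eI2)).
  near=> n; apply/andP; split; first exact: second_moment_ge0.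
  have [_ _ ei] := he n.
  rewrite (_ : (fun w => _) = (fun w => c * (I w - step_integral W (e1 n) w) + (J w - step_integral W (e2 n) w))).
    apply: second_moment_comb_le; apply: measurable_funB => //.
      by case: (L2at_sqint Pc hW (step_integral_L2 Pc hW (he1 n))).
    by case: (L2at_sqint Pc hW (step_integral_L2 Pc hW (he2 n))).
  by apply/funext => w; rewrite ei; ring.
Unshelve. all: end_near. Qed.

End ItoIntegral.

(** * The Ito integral: polarization and concatenation *)

Section ItoMore.
Context {disp : measure_display} {T : measurableType disp} {R : realType}.
Variable P : probability T R.
Variable W : R -> T -> R.
Hypothesis Pc : measure_is_complete P.
Hypothesis hW : two_sided_wiener P W.
Local Notation lam := (@lebesgue_measure R).

Lemma joint_congr s t (f g : R -> T -> R) :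
  (forall u w, s <= u <= t -> f u w = g u w) -> joint s t f -> joint s t g.
Proof.
move=> fg; apply: eq_measurable_fun => -[u w].
by rewrite in_setX/= mem_setE in_itv/= => /andP[su _]; exact: fg.
Qed.

Lemma ito_congr s t f g I : (forall u w, s <= u <= t -> f u w = g u w) ->
  is_ito_integral P W s t f I -> is_ito_integral P W s t g I.
Proof.
move=> fg [jf af hf mI [e [he ef eI]]].
have fg' u : s <= u <= t -> f u = g u by move=> su; apply/funext => w; exact: fg.
split => //.
- exact: joint_congr fg jf.
- by move=> u su; rewrite -fg'//; exact: af.
- rewrite (_ : (\int[lam]_(u in `[s, t]) _)%E = (\int[lam]_(u in `[s, t]) second_moment P (f u))%E)//.
  by apply: eq_integral => u; rewrite mem_setE in_itv/= => /fg' ->.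
exists e; split => //.
apply: cvg_trans ef; apply: near_eq_cvg; near=> n.
by apply: eq_integral => u; rewrite mem_setE in_itv/= => /fg' ->.
Unshelve. all: end_near. Qed.

(** Polarization of the isometry. *)
Lemma ito_ip s t f g I J : s <= t -> l2proc P s t f -> l2proc P s t g ->
  is_ito_integral P W s t f I -> is_ito_integral P W s t g J ->
  ip P I J = wvar * \int[lam]_(u in `[s, t]) ip P (f u) (g u).
Proof.
move=> st lf lg hI hJ.
have hIJ := ito_comb Pc hW 1 hI hJ.
have lfg : l2proc P s t (fun u w => 1 * f u w + g u w).
  apply: l2procD => //; apply: (l2procM (M := 1)) => //.
  by move=> u _; rewrite normr1.
have [sI iI] := ito_isometry Pc hW lf hI.
have [sJ iJ] := ito_isometry Pc hW lg hJ.
have [_ iIJ] := ito_isometry Pc hW lfg hIJ.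
have [_ sf _] := lf; have [_ sg _] := lg.
have -> : ip P I J = 2^-1 * (ip P (fun w => 1 * I w + J w) (fun w => 1 * I w + J w) - ip P I I - ip P J J).
  have -> : (fun w => 1 * I w + J w) = (fun w => I w + J w) by apply/funext => w; rewrite mul1r.
  by rewrite ipDD//; field.
rewrite iIJ iI iJ -!mulrBr mulrCA; congr (_ * _).
have i1 := ip_time_integrable lfg lfg.
have i2 := ip_time_integrable lf lf.
have i3 := ip_time_integrable lg lg.
have i4 := ip_time_integrable lf lg.
rewrite -RintegralB// -RintegralB//; last by apply: eq_integrable (integrableB _ i1 i2).
rewrite -RintegralZl//; last first.
  by apply: eq_integrable (integrableB _ (integrableB _ i1 i2) i3).
apply: eq_Rintegral => u; rewrite mem_setE in_itv/= => su.
have -> : (fun w => 1 * f u w + g u w) = (fun w => f u w + g u w) by apply/funext => w; rewrite mul1r.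
rewrite ipDD; [|exact: sf|exact: sg].
by field.
Qed.

Lemma itv_split (s r t : R) : s <= r -> r <= t -> `[s, t]%classic = `[s, r]%classic `|` `]r, t]%classic.
Proof.
move=> sr rt; apply/seteqP; split => u /=; rewrite !in_itv/=.
  move=> /andP[su ut]; have [ur|ur] := leP u r; first by left; rewrite su.
  by right; rewrite ut.
by case=> /andP[h1 h2]; [rewrite h1 (le_trans h2 rt)|rewrite h2 (le_trans sr (ltW h1))].
Qed.

Lemma itv_split_disj (s r t : R) : [disjoint `[s, r]%classic & `]r, t]%classic].
Proof.
apply/disj_setPS => u [] /=; rewrite !in_itv/= => /andP[_ h1] /andP[h2 _].
by move: h2; rewrite ltNge h1.
Qed.

(** The value at the junction r is taken from the first process, in accordance with
    step processes being left-continuous. *)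
Definition concat r (f g : R -> T -> R) (u : R) (w : T) : R :=
  if u <= r then f u w else g u w.

Lemma concat_joint s r t f g : s <= r -> r <= t ->
  joint s r f -> joint r t g -> joint s t (concat r f g).
Proof.
move=> sr rt jf jg; have E : (`[s, t] `*` [set: T] : set (R * T)) = (`[s, r] `*` [set: T]) `|` (`]r, t] `*` [set: T]).
  rewrite (itv_split sr rt); apply/seteqP; split => -[u w] /=.
    by move=> [[h|h] _]; [left|right].
  by move=> [[h _]|[h _]]; split => //; [left|right].
rewrite /joint E.
apply/measurable_funU.
- exact: measurable_box.
- by apply: measurableX.
split.
  apply: eq_measurable_fun jf => -[u w].
  by rewrite in_setX/= mem_setE in_itv/= /concat => /andP[/andP[_ ->]].
have jg' : measurable_fun (`]r, t] `*` [set: T]) (fun z : R * T => g z.1 z.2).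
  apply: measurable_funS jg; first exact: measurable_box.
  by move=> [u w] /= []; rewrite !in_itv/= => /andP[/ltW -> ->].
apply: eq_measurable_fun jg' => -[u w].
by rewrite in_setX/= mem_setE in_itv/= /concat => /andP[/andP[+ _]]; rewrite ltNge => /negbTE ->.
Qed.

Lemma integral_concat_le s r t (f g : R -> T -> R) : s <= r -> r <= t ->
  joint s r f -> joint r t g ->
  (\int[lam]_(u in `[s, t]) second_moment P (concat r f g u) <=
   \int[lam]_(u in `[s, r]) second_moment P (f u) +
   \int[lam]_(u in `[r, t]) second_moment P (g u))%E.
Proof.
move=> sr rt jf jg.
rewrite (itv_split sr rt) ge0_integral_setU//; last 3 first.
- by rewrite -(itv_split sr rt); apply: measurable_second_moment; exact: concat_joint.
- by move=> u _; exact: second_moment_ge0.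
- exact: itv_split_disj.
apply: leeD.
  rewrite le_eqVlt; apply/orP; left; apply/eqP; apply: eq_integral => u.
  rewrite mem_setE in_itv/= => /andP[_ ur].
  by congr second_moment; apply/funext => w; rewrite /concat ur.
apply: (@le_trans _ _ (\int[lam]_(u in `]r, t]) second_moment P (g u))%E).
  rewrite le_eqVlt; apply/orP; left; apply/eqP; apply: eq_integral => u.
  rewrite mem_setE in_itv/= => /andP[ur _].
  by congr second_moment; apply/funext => w; rewrite /concat leNgt ur.
apply: ge0_subset_integral => //.
- exact: measurable_second_moment.
- by move=> u _; exact: second_moment_ge0.
- by move=> u /=; rewrite !in_itv/= => /andP[/ltW -> ->].
Qed.

Lemma ito_concat s r t f g I J : s <= r -> r <= t ->
  is_ito_integral P W s r f I -> is_ito_integral P W r t g J ->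
  is_ito_integral P W s t (concat r f g) (fun w => I w + J w).
Proof.
move=> sr rt [jf af hf mI [e1 [he1 ef1 eI1]]] [jg ag hg mJ [e2 [he2 ef2 eI2]]].
have hn n := step_concat (he1 n) (he2 n).
have [e he] := choice hn.
split.
- exact: concat_joint.
- move=> u /andP[su ut].
  have -> : concat r f g u = (if u <= r then f u else g u).
    by apply/funext => w; rewrite /concat; case: ifP.
  by case: (leP u r) => ur; [apply: af; rewrite su|apply: ag; rewrite (ltW ur)].
- by apply: le_lt_trans (integral_concat_le sr rt jf jg) _; rewrite lte_add_pinfty.
- exact: measurable_funD.
exists e; split.
- by move=> n; have [] := he n.
- have lim0 : (\int[lam]_(u in `[s, r]) second_moment P (fun w => f u w - step_value (e1 n) u w)%R
      + \int[lam]_(u in `[r, t]) second_moment P (fun w => g u w - step_value (e2 n) u w)%R)%E @[n --> \oo] --> 0%E.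
    have -> : (0 = 0 + 0 :> \bar R)%E by rewrite adde0.
    exact: cvgeD.
  apply: (squeeze_cvge _ (cvg_cst 0%E) lim0).
  near=> n; apply/andP; split.
    by apply: integral_ge0 => u _; exact: second_moment_ge0.
  have [_ ev _] := he n.
  have je1 : joint s r (fun u w => f u w - step_value (e1 n) u w).
    apply: (measurable_funB jf); apply: measurable_funTS.
    exact: (step_value_measurable Pc hW (he1 n)).
  have je2 : joint r t (fun u w => g u w - step_value (e2 n) u w).
    apply: (measurable_funB jg); apply: measurable_funTS.
    exact: (step_value_measurable Pc hW (he2 n)).
  apply: le_trans (integral_concat_le sr rt je1 je2).
  rewrite le_eqVlt; apply/orP; left; apply/eqP; apply: eq_integral => u _.
  congr second_moment; apply/funext => w; rewrite ev /concat.
  case: (leP u r) => ur.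
    by rewrite (step_value_out (he2 n)) ?addr0// negb_and -leNgt ur.
  by rewrite (step_value_out (he1 n)) ?add0r// negb_and -[X in _ || X]ltNge ur orbT.
- have lim0 : (2%:E * (second_moment P (fun w => I w - step_integral W (e1 n) w)%R
      + second_moment P (fun w => J w - step_integral W (e2 n) w)%R))%E @[n --> \oo] --> 0%E.
    have -> : (0 = 2%:E * (0 + 0) :> \bar R)%E by rewrite adde0 mule0.
    by apply: cvgeZl => //; apply: cvgeD.
  apply: (squeeze_cvge _ (cvg_cst 0%E) lim0).
  near=> n; apply/andP; split; first exact: second_moment_ge0.
  have [_ _ ei] := he n.
  rewrite (_ : (fun w => _) = (fun w => (I w - step_integral W (e1 n) w) + (J w - step_integral W (e2 n) w))).
    apply: second_moment_addle; apply: measurable_funB => //.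
      by case: (L2at_sqint Pc hW (step_integral_L2 Pc hW (he1 n))).
    by case: (L2at_sqint Pc hW (step_integral_L2 Pc hW (he2 n))).
  by apply/funext => w; rewrite ei; ring.
Unshelve. all: end_near. Qed.

End ItoMore.

(** * Integrals over compact intervals *)

Section Helpers.
Context {R : realType}.
Local Notation lam := (@lebesgue_measure R).

Lemma lam_itv (s t : R) : s <= t -> lam `[s, t]%classic = (t - s)%:E.
Proof.
move=> st; rewrite lebesgue_measure_itv/= lte_fin.
by move: st; rewrite le_eqVlt => /orP[/eqP->|->//]; rewrite ltxx subrr.
Qed.

Lemma integrable_cst_itv (s t c : R) : lam.-integrable `[s, t] (EFin \o (fun=> c)).
Proof.
have mc : measurable_fun `[s, t] (EFin \o (fun=> c) : R -> \bar R) by exact: measurable_cst.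
apply/integrableP; split; first exact: mc.
rewrite [X in (X < _)%E](@integral_cst _ _ _ lam _ (measurable_itv `[s, t]) `|c%:E|%E).
have [st|st] := leP s t.
  by rewrite [X in (_ * X < _)%E](lam_itv st) -EFinM ltry.
by rewrite set_itv_ge ?measure0 ?mule0 ?ltry// -leNgt bnd_simp.
Qed.

Lemma Rintegral_itv_cst (s t c : R) : s <= t -> \int[lam]_(u in `[s, t]) c = c * (t - s).
Proof. by move=> st; rewrite (Rintegral_cst lam (measurable_itv `[s, t])) [X in _ * fine X](lam_itv st). Qed.

Lemma Rintegral_itv_le (s t : R) (f : R -> R) M : s <= t ->
  lam.-integrable `[s, t] (EFin \o f) -> (forall u, s <= u <= t -> f u <= M) ->
  \int[lam]_(u in `[s, t]) f u <= M * (t - s).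
Proof.
move=> st fi fM; rewrite -(Rintegral_itv_cst M st).
by apply: le_Rintegral => //; exact: integrable_cst_itv.
Qed.

Lemma Rintegral_itv_norm_le (s t : R) (f : R -> R) M : s <= t ->
  lam.-integrable `[s, t] (EFin \o f) -> (forall u, s <= u <= t -> `|f u| <= M) ->
  `|\int[lam]_(u in `[s, t]) f u| <= M * (t - s).
Proof.
move=> st fi fM; apply: le_trans (le_normr_Rintegral _ fi) _ => //.
by apply: Rintegral_itv_le => //; exact: integrable_norm fi.
Qed.

Lemma Rintegral_itv_sub (s r t : R) (f : R -> R) : r <= t ->
  lam.-integrable `[s, t] (EFin \o f) -> (forall u, s <= u <= t -> 0 <= f u) ->
  \int[lam]_(u in `[s, r]) f u <= \int[lam]_(u in `[s, t]) f u.
Proof.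
move=> rt fi f0.
have sub : `[s, r] `<=` `[s, t].
  by move=> u /=; rewrite !in_itv/= => /andP[-> /le_trans]; apply.
have fi' : lam.-integrable `[s, r] (EFin \o f) by apply: integrableS fi.
rewrite /Rintegral; apply: fine_le; try exact: integrable_fin_num.
apply: ge0_subset_integral => //.
by case/integrableP: fi.
Qed.

Lemma integrable_sum_itv (I : finType) (s t : R) (F : I -> R -> R) :
  (forall i, lam.-integrable `[s, t] (EFin \o F i)) ->
  lam.-integrable `[s, t] (EFin \o (fun u => \sum_i F i u)).
Proof.
move=> h; have : lam.-integrable `[s, t] (fun u => \sum_(i <- index_enum I) (EFin \o F i) u)%E.
  exact: integrable_sum.
by apply: eq_integrable => // u _ /=; rewrite sumEFin.
Qed.

Lemma Rintegral_sum_itv (I : finType) (s t : R) (F : I -> R -> R) :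
  (forall i, lam.-integrable `[s, t] (EFin \o F i)) ->
  \int[lam]_(u in `[s, t]) (\sum_i F i u) = \sum_i \int[lam]_(u in `[s, t]) F i u.
Proof.
move=> h; have key (r : seq I) : lam.-integrable `[s, t] (EFin \o (fun u => \sum_(i <- r) F i u)) /\
   \int[lam]_(u in `[s, t]) (\sum_(i <- r) F i u) = \sum_(i <- r) \int[lam]_(u in `[s, t]) F i u.
  elim: r => [|i r [ih1 ih2]].
    have -> : (fun u => \sum_(i <- [::]) F i u) = (fun=> 0).
      by apply/funext => u; rewrite big_nil.
    split; first exact: integrable_cst_itv.
    by rewrite big_nil (Rintegral_cst lam (measurable_itv `[s, t])) mul0r.
  have -> : (fun u => \sum_(j <- i :: r) F j u) = (fun u => F i u + \sum_(j <- r) F j u).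
    by apply/funext => u; rewrite big_cons.
  split; first by apply: eq_integrable (integrableD _ (h i) ih1).
  by rewrite RintegralD// ih2 big_cons.
by have [] := key (index_enum I).
Qed.

End Helpers.

(** * Short-time expansion of the Gram matrix of a linear equation *)

Section LocalExpansion.
Context {disp : measure_display} {T : measurableType disp} {R : realType}.
Variable P : probability T R.
Variable W : R -> T -> R.
Hypothesis Pc : measure_is_complete P.
Hypothesis hW : two_sided_wiener P W.
Local Notation lam := (@lebesgue_measure R).
Local Notation v := (@wvar R).

Variables (K : finType) (a c : R -> K -> K -> R) (M : R).
Hypothesis M0 : 0 <= M.
Hypothesis ma : forall k l, measurable_fun setT (fun u => a u k l).
Hypothesis mc : forall k l, measurable_fun setT (fun u => c u k l).
Hypothesis aM : forall u k l, `|a u k l| <= M.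
Hypothesis cM : forall u k l, `|c u k l| <= M.

Definition lincoef (b : R -> K -> K -> R) (eta : K -> R -> T -> R) k u w :=
  \sum_l b u k l * eta l u w.

(** A system of scalar linear equations with deterministic coefficients a (drift)
    and c (diffusion), indexed by a finite type K. *)
Record linear_sde (s t : R) (eta : K -> R -> T -> R) : Prop := LinearSde {
  lsde_proc : forall k, l2proc P s t (eta k) ;
  lsde_start : forall k, L2at P W s (eta k s) ;
  lsde_eq : forall k r, s <= r <= t -> exists I,
    is_ito_integral P W s r (lincoef c eta k) I /\
    {ae P, forall w, eta k r w = eta k s w + tint s r (lincoef a eta k) w + I w} }.

Definition gram (eta : K -> R -> T -> R) u k l := ip P (eta k u) (eta l u).

Definition energy (eta : K -> R -> T -> R) u := \sum_k gram eta u k k.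

(** The right-hand side a G + G a^T + v c G c^T of the differential equation
    satisfied by the Gram matrix G of a solution. *)
Definition gram_flow u (G : K -> K -> R) k l : R :=
  \sum_j a u l j * G k j + \sum_j a u k j * G j l +
  v * \sum_i \sum_j c u k i * c u l j * G i j.

Let n : R := #|K|%:R.

Lemma energy_ge0 eta u : 0 <= energy eta u.
Proof. by apply: sumr_ge0 => k _; exact: ip_ge0. Qed.

Lemma nrm_energy eta u k : nrm P (eta k u) <= Num.sqrt (energy eta u).
Proof.
rewrite /nrm ler_sqrt; last exact: energy_ge0.
by rewrite /energy (bigD1 k)//= lerDl; apply: sumr_ge0 => i _; exact: ip_ge0.
Qed.

Lemma nrm_sum (I : finType) (F : I -> T -> R) B : (forall i, sqint P (F i)) ->
  (forall i, nrm P (F i) <= B) ->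
  nrm P (fun w => \sum_i F i w) <= #|I|%:R * B.
Proof.
move=> sF bF.
have key (r : seq I) : nrm P (fun w => \sum_(i <- r) F i w) <= (size r)%:R * B.
  elim: r => [|i r ih].
    under eq_fun do rewrite big_nil.
    by rewrite mul0r /nrm ip0l sqrtr0.
  under eq_fun do rewrite big_cons.
  apply: le_trans (nrmD (sF i) (sqint_sum r sF)) _.
  by rewrite /= -addn1 natrD mulrDl mul1r addrC lerD.
by have := key (index_enum I); rewrite -[index_enum I]enumT -cardT.
Qed.

Lemma lincoef_l2proc s t (b : R -> K -> K -> R) eta k :
  (forall k l, measurable_fun setT (fun u => b u k l)) -> (forall u k l, `|b u k l| <= M) ->
  (forall k, l2proc P s t (eta k)) -> l2proc P s t (lincoef b eta k).
Proof.
move=> mb bM he; apply: l2proc_sum => l.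
exact: (l2procM (M := M) (mb k l) (fun u _ => bM u k l) (he l)).
Qed.

Lemma lincoef_nrm (b : R -> K -> K -> R) eta k u :
  (forall u k l, `|b u k l| <= M) -> (forall k, sqint P (eta k u)) ->
  nrm P (lincoef b eta k u) <= n * M * Num.sqrt (energy eta u).
Proof.
move=> bM se; rewrite /n -mulrA; apply: nrm_sum => l; first exact: sqintZ.
rewrite nrmZ//; apply: ler_pM => //; first exact: nrm_ge0.
exact: nrm_energy.
Qed.

Lemma lincoef_ip (b : R -> K -> K -> R) eta k u :
  (forall u k l, `|b u k l| <= M) -> (forall k, sqint P (eta k u)) ->
  ip P (lincoef b eta k u) (lincoef b eta k u) <= (n * M) ^+ 2 * energy eta u.
Proof.
move=> bM se; rewrite -sqr_nrm -[energy eta u]sqr_sqrtr ?energy_ge0// -exprMn.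
rewrite ler_sqr ?nnegrE ?nrm_ge0//; first exact: lincoef_nrm.
by rewrite !mulr_ge0 ?sqrtr_ge0// /n ler0n.
Qed.

Section OneSolution.
Variables (s t : R) (eta : K -> R -> T -> R).
Hypothesis st : s <= t.
Hypothesis he : linear_sde s t eta.

Let se k u : s <= u <= t -> sqint P (eta k u).
Proof. by have [_ + _] := lsde_proc he k; apply. Qed.

Let phi r : R := \int[lam]_(u in `[s, r]) energy eta u.

Let energy_int : lam.-integrable `[s, t] (EFin \o energy eta).
Proof.
by apply: integrable_sum_itv => k; apply: ip_time_integrable; exact: lsde_proc.
Qed.

Let energy_int_sub r : s <= r <= t -> lam.-integrable `[s, r] (EFin \o energy eta).
Proof.
move=> /andP[sr rt]; apply: integrableS energy_int => //.
by move=> u /=; rewrite !in_itv/= => /andP[-> /le_trans]; apply.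
Qed.

Let phi_le r : s <= r <= t -> phi r <= phi t.
Proof.
by move=> /andP[sr rt]; apply: Rintegral_itv_sub => // u _; exact: energy_ge0.
Qed.

Let beta := (n * M) ^+ 2.

Let beta0 : 0 <= beta. Proof. exact: sqr_ge0. Qed.

Let proc_sub k r : s <= r <= t -> l2proc P s r (eta k).
Proof. by move=> /andP[sr rt]; exact: l2proc_sub (lexx s) rt (lsde_proc he k). Qed.

Let int_lincoef (b : R -> K -> K -> R) k r : s <= r <= t ->
  (forall k l, measurable_fun setT (fun u => b u k l)) ->
  (forall u k l, `|b u k l| <= M) ->
  \int[lam]_(u in `[s, r]) ip P (lincoef b eta k u) (lincoef b eta k u) <= beta * phi t.
Proof.
move=> srt mb bM; have [sr rt] := andP srt.
have lb : l2proc P s r (lincoef b eta k) by apply: lincoef_l2proc => // l; exact: proc_sub.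
apply: (@le_trans _ _ (beta * phi r)); last by rewrite ler_wpM2l// phi_le.
rewrite /phi -RintegralZl//; last exact: energy_int_sub.
apply: le_Rintegral => //.
- exact: ip_time_integrable.
- by apply: eq_integrable (integrableZl _ beta (energy_int_sub srt)).
- move=> u /=; rewrite in_itv/= => /andP[su ur]; apply: lincoef_ip => // l.
  by apply: se; rewrite su (le_trans ur rt).
Qed.

Let drift_ip k r : s <= r <= t ->
  ip P (tint s r (lincoef a eta k)) (tint s r (lincoef a eta k)) <= (t - s) * (beta * phi t).
Proof.
move=> srt; have [sr rt] := andP srt.
have la : l2proc P s r (lincoef a eta k) by apply: lincoef_l2proc => // l; exact: proc_sub.
have [_ sa fa] := la.
have h1 := tint_second_moment sr la.
apply: (@le_trans _ _ ((r - s) * \int[lam]_(u in `[s, r]) ip P (lincoef a eta k u) (lincoef a eta k u))).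
  rewrite -lee_fin -(second_moment_ip (tint_sqint sr la)) EFinM.
  apply: le_trans h1 _; apply: lee_wpmul2l; first by rewrite lee_fin subr_ge0.
  have E : (\int[lam]_(u in `[s, r]) second_moment P (lincoef a eta k u) =
    \int[lam]_(u in `[s, r]) (ip P (lincoef a eta k u) (lincoef a eta k u))%:E)%E.
    by apply: eq_integral => u; rewrite mem_setE in_itv/= => su; rewrite (second_moment_ip (sa _ su)).
  rewrite E /Rintegral fineK// -E ge0_fin_numE//.
  by apply: integral_ge0 => u _; exact: second_moment_ge0.
apply: ler_pM => //.
- by rewrite subr_ge0.
- by apply: Rintegral_ge0 => u _; exact: ip_ge0.
- by rewrite lerD2r.
- exact: int_lincoef.
Qed.

Let noise_ip k r I : s <= r <= t -> is_ito_integral P W s r (lincoef c eta k) I ->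
  sqint P I /\ ip P I I <= v * (beta * phi t).
Proof.
move=> srt hI; have [sr rt] := andP srt.
have lc : l2proc P s r (lincoef c eta k) by apply: lincoef_l2proc => // l; exact: proc_sub.
have [sI ->] := ito_isometry Pc hW lc hI; split => //.
by apply: ler_wpM2l; [exact/ltW/wvar_gt0|exact: int_lincoef].
Qed.

(** Intervals of length at most 1 / (4 C), with C this constant, are short enough
    for the energy integral over the interval to be controlled by the energy at its
    left end. *)
Definition expansion_const : R := 4 * n * beta * (1 + v) + 1.
Local Notation C := expansion_const.

Let C1 : 1 <= C.
Proof. by rewrite /expansion_const lerDr !mulr_ge0// ?addr_ge0 ?ltW ?wvar_gt0// /n ler0n. Qed.

Hypothesis small : t - s <= (4 * C)^-1.

Let h1 : t - s <= 1.
Proof. apply: le_trans small _; rewrite invf_le1//; have := C1; lra. Qed.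

Lemma increment_bound k r : s <= r <= t ->
  ip P (fun w => eta k r w - eta k s w) (fun w => eta k r w - eta k s w) <=
    2 * (beta * (1 + v)) * phi t.
Proof.
move=> srt; have [sr rt] := andP srt.
have [I [hI E]] := lsde_eq he k srt.
have la : l2proc P s r (lincoef a eta k) by apply: lincoef_l2proc => // l; exact: proc_sub.
have sD := tint_sqint sr la.
have [sI nI] := noise_ip srt hI.
have sk := se k srt; have ss : sqint P (eta k s) by apply: se; rewrite lexx.
have sDI := sqintD sD sI.
have mm : measurable_fun setT (fun w => eta k r w - eta k s w).
  by apply: measurable_funB; [case: sk|case: ss].
rewrite (ip_ae mm (proj1 sDI) mm (proj1 sDI)); try by apply: filterS E => w ->; ring.
have := ip_ge0 P (fun w => tint s r (lincoef a eta k) w - I w).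
rewrite ipBB// ipDD//.
have d1 := drift_ip k srt.
have bp : 0 <= beta * phi t.
  by rewrite mulr_ge0//; apply: Rintegral_ge0 => u _; exact: energy_ge0.
have : (t - s) * (beta * phi t) <= beta * phi t by rewrite ler_piMl.
move: d1 nI; set x := ip P (tint _ _ _) (tint _ _ _); set y := ip P I I.
set z := ip P (tint _ _ _) I; set bb := beta * phi t => d1 nI d2 d3.
have -> : 2 * (beta * (1 + v)) * phi t = 2 * bb + 2 * (v * bb) by rewrite /bb; ring.
lra.
Qed.

(** The energy at time u is at most twice the initial one plus C times its own
    integral phi t; integrating over a short interval absorbs the last term. *)
Lemma phi_bound : phi t <= 4 * (t - s) * energy eta s.
Proof.
have key u : s <= u <= t -> energy eta u <= 2 * energy eta s + C * phi t.
  move=> su; have ss k : sqint P (eta k s) by apply: se; rewrite lexx.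
  have one k : gram eta u k k <= 2 * gram eta s k k + 4 * (beta * (1 + v)) * phi t.
    have sk := se k su.
    have := ip_ge0 P (fun w => eta k u w - 2 * eta k s w).
    rewrite ipBB//; last exact: sqintZ.
    rewrite ipZl//; last exact: sqintZ.
    rewrite !ipZr//.
    have := increment_bound k su; rewrite ipBB// /gram.
    set x := ip P _ _; set y := ip P _ _; set z := ip P _ _; lra.
  apply: (@le_trans _ _ (\sum_k (2 * gram eta s k k + 4 * (beta * (1 + v)) * phi t))).
    by apply: ler_sum => k _; exact: one.
  rewrite big_split/= -mulr_sumr sumr_const -[in X in _ + X]mulr_natr -/n lerD2l.
  have p0 : 0 <= phi t by apply: Rintegral_ge0 => x _; exact: energy_ge0.
  by rewrite /expansion_const; nra.
have := Rintegral_itv_le st energy_int key; rewrite -/(phi t).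
have e0 := energy_ge0 eta s.
have p0 : 0 <= phi t by apply: Rintegral_ge0 => x _; exact: energy_ge0.
have : C * (t - s) <= 4^-1.
  have Cp : 0 < C by have := C1; lra.
  by rewrite -ler_pdivlMl//; move: small; rewrite invfM mulrC.
move=> hc; have : C * (t - s) * phi t <= 4^-1 * phi t by rewrite ler_wpM2r.
have hs : 0 <= t - s by rewrite subr_ge0.
nra.
Qed.

Let q := Num.sqrt (t - s).
Let rho := Num.sqrt (energy eta s).
Definition step_const : R := Num.sqrt (8 * (beta * (1 + v))).
Local Notation k1 := step_const.

Let k10 : 0 <= k1. Proof. exact: sqrtr_ge0. Qed.
Let q0 : 0 <= q. Proof. exact: sqrtr_ge0. Qed.
Let rho0 : 0 <= rho. Proof. exact: sqrtr_ge0. Qed.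
Let qq : q ^+ 2 = t - s. Proof. by rewrite sqr_sqrtr// subr_ge0. Qed.
Let rr : rho ^+ 2 = energy eta s. Proof. by rewrite sqr_sqrtr// energy_ge0. Qed.
Let bv0 : 0 <= beta * (1 + v).
Proof. by rewrite mulr_ge0// addr_ge0// ltW// wvar_gt0. Qed.
Let kk : k1 ^+ 2 = 8 * (beta * (1 + v)). Proof. by rewrite sqr_sqrtr// mulr_ge0. Qed.
Let q1 : q <= 1. Proof. by rewrite -sqrtr1 ler_sqrt// h1. Qed.

Let nrm_le f x : 0 <= x -> ip P f f <= x ^+ 2 -> nrm P f <= x.
Proof. by move=> x0 h; rewrite -ler_sqr ?nnegrE ?nrm_ge0// sqr_nrm. Qed.

Lemma increment_nrm k r : s <= r <= t ->
  nrm P (fun w => eta k r w - eta k s w) <= k1 * q * rho.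
Proof.
move=> srt; apply: nrm_le; first by rewrite !mulr_ge0.
apply: le_trans (increment_bound k srt) _.
rewrite !exprMn kk qq rr.
have -> : 8 * (beta * (1 + v)) * (t - s) * energy eta s =
  2 * (beta * (1 + v)) * (4 * (t - s) * energy eta s) by ring.
by apply: ler_wpM2l; [rewrite mulr_ge0|exact: phi_bound].
Qed.

(** Expand the product of two components of the solution at time t around time s.
    The pairing of the past with a stochastic integral vanishes; its pairing with the
    drift and the pairing of two stochastic integrals are integrals over time, whose
    integrand F is within O(sqrt (t - s)) of the flow evaluated at time s.  The
    remaining products are of order (t - s)^(3/2). *)
Lemma local_expansion k l : exists (F : R -> R) (rem : R),
  [/\ lam.-integrable `[s, t] (EFin \o F),
      gram eta t k l = gram eta s k l + \int[lam]_(u in `[s, t]) F u + rem,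
      (forall u, s <= u <= t -> `|F u - gram_flow u (gram eta s) k l| <=
         (2 * n * M * k1 + v * (n * M) ^+ 2 * (k1 * (2 + k1))) * q * rho ^+ 2) &
      `|rem| <= 3 * k1 ^+ 2 * (t - s) * q * rho ^+ 2].
Proof.
have tt : s <= t <= t by rewrite st lexx.
have ts : s <= s <= t by rewrite st lexx.
have ss j : sqint P (eta j s) by exact: se.
have [Ik [hIk Ek]] := lsde_eq he k tt.
have [Il [hIl El]] := lsde_eq he l tt.
have la j : l2proc P s t (lincoef a eta j) by apply: lincoef_l2proc => // i; exact: lsde_proc.
have lc j : l2proc P s t (lincoef c eta j) by apply: lincoef_l2proc => // i; exact: lsde_proc.
have lstart j : l2proc P s t (fun _ => eta j s) by exact: l2proc_const.
have sD j := tint_sqint st (la j).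
have [sIk nIk] := noise_ip tt hIk.
have [sIl nIl] := noise_ip tt hIl.
set Dk := tint s t (lincoef a eta k) in Ek; set Dl := tint s t (lincoef a eta l) in El.
have sDk : sqint P Dk by exact: sD.
have sDl : sqint P Dl by exact: sD.
have pb := phi_bound.
have hs : 0 <= t - s by rewrite subr_ge0.
have e0 := energy_ge0 eta s.
have p0 : 0 <= phi t by apply: Rintegral_ge0 => x _; exact: energy_ge0.
have v0 : 0 <= v by apply/ltW/wvar_gt0.
have bpb : beta * phi t <= beta * (4 * (t - s) * energy eta s) by rewrite ler_wpM2l.
have bvx : 4 * beta <= 8 * (beta * (1 + v)) by have := mulr_ge0 beta0 v0; have := beta0; lra.
have bvx2 : 4 * (v * beta) <= 8 * (beta * (1 + v)).
  by have := mulr_ge0 beta0 v0; have := beta0; lra.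
have nD j : nrm P (tint s t (lincoef a eta j)) <= k1 * (t - s) * rho.
  apply: nrm_le; first by rewrite !mulr_ge0.
  apply: le_trans (drift_ip j tt) _; rewrite !exprMn kk rr.
  apply: (@le_trans _ _ ((t - s) * (beta * (4 * (t - s) * energy eta s)))).
    by rewrite ler_wpM2l.
  have -> : (t - s) * (beta * (4 * (t - s) * energy eta s)) = 4 * beta * ((t - s) ^+ 2 * energy eta s) by ring.
  by rewrite -[leRHS]mulrA ler_wpM2r// mulr_ge0// sqr_ge0.
have nI I : ip P I I <= v * (beta * phi t) -> nrm P I <= k1 * q * rho.
  move=> h; apply: nrm_le; first by rewrite !mulr_ge0.
  apply: le_trans h _; rewrite !exprMn kk rr qq.
  apply: (@le_trans _ _ (v * (beta * (4 * (t - s) * energy eta s)))).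
    by rewrite ler_wpM2l.
  have -> : v * (beta * (4 * (t - s) * energy eta s)) = 4 * (v * beta) * ((t - s) * energy eta s) by ring.
  by rewrite -[leRHS]mulrA ler_wpM2r// mulr_ge0.
have hq : t - s <= q by rewrite -qq expr2 ler_piMl.
pose F u := ip P (eta k s) (lincoef a eta l u) + ip P (eta l s) (lincoef a eta k u)
   + v * ip P (lincoef c eta k u) (lincoef c eta l u).
have i1 := ip_time_integrable (lstart k) (la l).
have i2 := ip_time_integrable (lstart l) (la k).
have i3 := ip_time_integrable (lc k) (lc l).
have i3' : lam.-integrable `[s, t] (EFin \o (fun u => v * ip P (lincoef c eta k u) (lincoef c eta l u))).
  by apply: eq_integrable (integrableZl _ v i3).
have i12 : lam.-integrable `[s, t] (EFin \o (fun u => ip P (eta k s) (lincoef a eta l u) + ip P (eta l s) (lincoef a eta k u))).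
  by apply: eq_integrable (integrableD _ i1 i2).
have iF : lam.-integrable `[s, t] (EFin \o F).
  by apply: eq_integrable (integrableD _ i12 i3').
exists F, (ip P Dk Dl + ip P Dk Il + ip P Dl Ik); split => //.
- have mt j : measurable_fun setT (eta j t) by case: (se j tt).
  have sDIk := sqintD sDk sIk; have sDIl := sqintD sDl sIl.
  have sX j D I : sqint P D -> sqint P I -> sqint P (fun w => eta j s w + (D w + I w)).
    by move=> ? ?; apply: sqintD => //; exact: sqintD.
  have -> : gram eta t k l = ip P (fun w => eta k s w + (Dk w + Ik w)) (fun w => eta l s w + (Dl w + Il w)).
    rewrite /gram; apply: ip_ae; [exact: mt|by case: (sX k _ _ sDk sIk)|exact: mt|by case: (sX l _ _ sDl sIl)| |].
      by apply: filterS Ek => w ->; ring.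
    by apply: filterS El => w ->; ring.
  rewrite ipDl//; last exact: sX.
  rewrite !ipDr// ?(ipDl sDk sIk)// ?(ipDl sDk sIk (ss l)).
  rewrite (ito_orth Pc hW hIl (lsde_start he k)).
  rewrite [ip P Ik (eta l s)]ipC (ito_orth Pc hW hIk (lsde_start he l)).
  rewrite (ito_ip Pc hW st (lc k) (lc l) hIk hIl).
  rewrite (tint_ip (la l) (ss k)) [ip P Dk (eta l s)]ipC (tint_ip (la k) (ss l)).
  rewrite /F RintegralD// RintegralD// RintegralZl// /gram [ip P Ik Dl]ipC.
  clearbody Dk Dl.
  move: (ip P Dk Dl) (ip P Dk Il) (ip P Dl Ik) (ip P (eta k s) (eta l s)) => x1 x2 x3 x4.
  move: (\int[lam]_(u in `[s, t]) ip P (lincoef c eta k u) (lincoef c eta l u)) => x5.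
  move: (\int[lam]_(u in `[s, t]) ip P (eta k s) (lincoef a eta l u)) => x6.
  move: (\int[lam]_(u in `[s, t]) ip P (eta l s) (lincoef a eta k u)) => x7.
  by ring.
- move=> u su.
  have su' j : sqint P (eta j u) by exact: se.
  have sE j : sqint P (fun w => eta j u w - eta j s w).
    by have := sqintD (su' j) (sqintZ (-1) (ss j)); under eq_fun do rewrite mulN1r.
  have dE j := increment_nrm j su.
  have nS j : nrm P (eta j s) <= rho by exact: nrm_energy.
  have etaE j : eta j u = (fun w => eta j s w + (eta j u w - eta j s w)).
    by apply/funext => w; ring.
  have nU j : nrm P (eta j u) <= rho + k1 * q * rho.
    rewrite etaE; apply: le_trans (nrmD (ss j) (sE j)) _.
    by apply: lerD; [exact: nS|exact: dE].
  have d1 i j : `|ip P (eta i s) (eta j u) - ip P (eta i s) (eta j s)| <= k1 * q * rho ^+ 2.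
    rewrite etaE ipDr// addrC addKr.
    apply: le_trans (ip_CS (ss i) (sE j)) _.
    have -> : k1 * q * rho ^+ 2 = rho * (k1 * q * rho) by ring.
    by apply: ler_pM => //; exact: nrm_ge0.
  have d2 i j : `|ip P (eta i u) (eta j u) - ip P (eta i s) (eta j s)| <= k1 * (2 + k1) * q * rho ^+ 2.
    have -> : ip P (eta i u) (eta j u) - ip P (eta i s) (eta j s) =
      ip P (fun w => eta i u w - eta i s w) (eta j u) +
      (ip P (eta i s) (eta j u) - ip P (eta i s) (eta j s)).
      by rewrite {1}etaE ipDl//; ring.
    apply: le_trans (ler_normD _ _) _.
    apply: (@le_trans _ _ (k1 * q * rho * (rho + k1 * q * rho) + k1 * q * rho ^+ 2)).
      apply: lerD => //.
      apply: le_trans (ip_CS (sE i) (su' j)) _.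
      by apply: ler_pM => //; exact: nrm_ge0.
    have -> : k1 * q * rho * (rho + k1 * q * rho) + k1 * q * rho ^+ 2 =
       k1 * (2 + k1 * q) * q * rho ^+ 2 by ring.
    have r2 : 0 <= rho ^+ 2 by exact: sqr_ge0.
    apply: ler_wpM2r => //; apply: ler_wpM2r => //; apply: ler_wpM2l => //.
    by rewrite lerD2l ler_piMr.
  have sum1 i j : `|ip P (eta i s) (lincoef a eta j u) - \sum_l0 a u j l0 * gram eta s i l0| <=
      n * M * k1 * q * rho ^+ 2.
    rewrite /lincoef ip_sumr//; last by move=> l0; exact: sqintZ.
    rewrite -sumrB; apply: le_trans (ler_norm_sum _ _ _) _.
    have -> : n * M * k1 * q * rho ^+ 2 = \sum_(l0 : K) M * (k1 * q * rho ^+ 2).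
      by rewrite sumr_const -[RHS]mulr_natr /n; ring.
    apply: ler_sum => l0 _; rewrite ipZr// -mulrBr normrM.
    by apply: ler_pM.
  have sum2 : `|ip P (lincoef c eta k u) (lincoef c eta l u) -
      \sum_i \sum_j c u k i * c u l j * gram eta s i j| <=
      (n * M) ^+ 2 * (k1 * (2 + k1)) * q * rho ^+ 2.
    rewrite /lincoef ip_suml//; [|by move=> i; exact: sqintZ|by apply: sqint_sum => i; exact: sqintZ].
    have -> : (n * M) ^+ 2 * (k1 * (2 + k1)) * q * rho ^+ 2 =
      \sum_(i : K) \sum_(j : K) M * M * (k1 * (2 + k1) * q * rho ^+ 2).
      rewrite !sumr_const -[RHS]mulr_natr -[X in _ = X * _]mulr_natr /n; ring.
    rewrite -sumrB; apply: le_trans (ler_norm_sum _ _ _) _.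
    apply: ler_sum => i _; rewrite ip_sumr//; [|by move=> j; exact: sqintZ|exact: sqintZ].
    rewrite -sumrB; apply: le_trans (ler_norm_sum _ _ _) _.
    apply: ler_sum => j _; rewrite ipZl//; last exact: sqintZ.
    rewrite ipZr// mulrA -mulrBr normrM normrM.
    apply: ler_pM; [by rewrite mulr_ge0|exact: normr_ge0|by apply: ler_pM|exact: d2].
  rewrite /F /gram_flow.
  have E2 : \sum_j a u k j * gram eta s j l = \sum_j a u k j * gram eta s l j.
    by apply: eq_bigr => j _; rewrite /gram ipC.
  rewrite E2.
  set A1 := ip P (eta k s) _; set A2 := ip P (eta l s) _; set A3 := ip P (lincoef c eta k u) _.
  set B1 := \sum_j a u l j * _; set B2 := \sum_j a u k j * _; set B3 := \sum_i _.
  have -> : A1 + A2 + v * A3 - (B1 + B2 + v * B3) = (A1 - B1) + (A2 - B2) + v * (A3 - B3) by ring.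
  apply: le_trans (ler_normD _ _) _.
  have h12 := le_trans (ler_normD (A1 - B1) (A2 - B2)) (lerD (sum1 k l) (sum1 l k)).
  have h3 : `|v * (A3 - B3)| <= v * ((n * M) ^+ 2 * (k1 * (2 + k1)) * q * rho ^+ 2).
    by rewrite normrM ger0_norm// ler_wpM2l.
  apply: le_trans (lerD h12 h3) _.
  rewrite le_eqVlt; apply/orP; left; apply/eqP; ring.
- have nDk : nrm P Dk <= k1 * (t - s) * rho := nD k.
  have nDl : nrm P Dl <= k1 * (t - s) * rho := nD l.
  clearbody Dk Dl.
  have nIk' := nI _ nIk; have nIl' := nI _ nIl.
  have b1 : `|ip P Dk Dl| <= (k1 * (t - s) * rho) * (k1 * q * rho).
    apply: le_trans (ip_CS sDk sDl) _; apply: ler_pM => //; try exact: nrm_ge0.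
    apply: le_trans nDl _; apply: ler_wpM2r => //; exact: ler_wpM2l.
  have b2 : `|ip P Dk Il| <= (k1 * (t - s) * rho) * (k1 * q * rho).
    by apply: le_trans (ip_CS sDk sIl) _; apply: ler_pM => //; exact: nrm_ge0.
  have b3 : `|ip P Dl Ik| <= (k1 * (t - s) * rho) * (k1 * q * rho).
    by apply: le_trans (ip_CS sDl sIk) _; apply: ler_pM => //; exact: nrm_ge0.
  apply: le_trans (ler_normD _ _) _.
  apply: le_trans (lerD (le_trans (ler_normD _ _) (lerD b1 b2)) b3) _.
  rewrite le_eqVlt; apply/orP; left; apply/eqP; ring.
Qed.

End OneSolution.

End LocalExpansion.

(** * Linear combinations of Gram matrices *)

Section GramStep.
Context {disp : measure_display} {T : measurableType disp} {R : realType}.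
Variable P : probability T R.
Variable W : R -> T -> R.
Hypothesis Pc : measure_is_complete P.
Hypothesis hW : two_sided_wiener P W.
Local Notation lam := (@lebesgue_measure R).
Local Notation v := (@wvar R).

Variables (K : finType) (a c : R -> K -> K -> R) (M : R).
Hypothesis M0 : 0 <= M.
Hypothesis ma : forall k l, measurable_fun setT (fun u => a u k l).
Hypothesis mc : forall k l, measurable_fun setT (fun u => c u k l).
Hypothesis aM : forall u k l, `|a u k l| <= M.
Hypothesis cM : forall u k l, `|c u k l| <= M.
Local Notation n := (#|K|%:R : R).
Local Notation k1 := (@step_const R K M).

Definition znorm (Z : K -> K -> R) : R := \sum_k \sum_l `|Z k l|.

Lemma znorm_ge Z k l : `|Z k l| <= znorm Z.
Proof.
rewrite /znorm (bigD1 k)//= (bigD1 l)//= -addrA lerDl addr_ge0//; first exact: sumr_ge0.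
by apply: sumr_ge0 => i _; apply: sumr_ge0.
Qed.

Lemma gram_flow_sum (I : finType) (x : I -> R) (G : I -> K -> K -> R) u k l :
  \sum_i x i * gram_flow a c u (G i) k l =
  gram_flow a c u (fun k l => \sum_i x i * G i k l) k l.
Proof.
rewrite /gram_flow; under eq_bigr do rewrite !mulrDr !mulr_sumr.
rewrite !big_split/=; congr (_ + _ + _).
- rewrite exchange_big/=; apply: eq_bigr => j _; rewrite mulr_sumr.
  by apply: eq_bigr => i _; ring.
- rewrite exchange_big/=; apply: eq_bigr => j _; rewrite mulr_sumr.
  by apply: eq_bigr => i _; ring.
- rewrite exchange_big/= mulr_sumr; apply: eq_bigr => j _.
  under eq_bigr do rewrite mulr_sumr mulr_sumr.
  rewrite exchange_big/= mulr_sumr; apply: eq_bigr => i _.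
  by rewrite mulr_sumr mulr_sumr; apply: eq_bigr => r _; ring.
Qed.

Definition flow_const : R := 2 * M + v * M ^+ 2.

Lemma flow_const_ge0 : 0 <= flow_const.
Proof. by rewrite addr_ge0 ?mulr_ge0 ?sqr_ge0// ltW// wvar_gt0. Qed.

Lemma gram_flow_le u Z k l : `|gram_flow a c u Z k l| <= flow_const * znorm Z.
Proof.
have sumle (x : K -> R) (y : K -> R) : (forall j, `|x j| <= M) -> \sum_j `|y j| <= znorm Z ->
    `|\sum_j x j * y j| <= M * znorm Z.
  move=> hx hy; apply: le_trans (ler_norm_sum _ _ _) _.
  apply: (@le_trans _ _ (\sum_j M * `|y j|)).
    by apply: ler_sum => j _; rewrite normrM ler_wpM2r.
  by rewrite -mulr_sumr ler_wpM2l.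
rewrite /gram_flow /flow_const mulrDl mulr_natl mulr2n mulrDl.
apply: le_trans (ler_normD _ _) _; apply: lerD.
  apply: le_trans (ler_normD _ _) _; apply: lerD; apply: sumle => //.
    rewrite /znorm [leRHS](bigD1 k)//= lerDl.
    by apply: sumr_ge0 => i _; apply: sumr_ge0.
  apply: ler_sum => j _; rewrite (bigD1 l)//= lerDl; exact: sumr_ge0.
rewrite normrM ger0_norm; last exact/ltW/wvar_gt0.
rewrite -mulrA; apply: ler_wpM2l; first exact/ltW/wvar_gt0.
apply: le_trans (ler_norm_sum _ _ _) _; rewrite /znorm mulr_sumr.
apply: ler_sum => i _; apply: le_trans (ler_norm_sum _ _ _) _; rewrite mulr_sumr.
apply: ler_sum => j _; rewrite !normrM ler_wpM2r// expr2; exact: ler_pM.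
Qed.

Definition rem_const : R :=
  n * n * (2 * n * M * k1 + v * (n * M) ^+ 2 * (k1 * (2 + k1)) + 3 * k1 ^+ 2).

(** One step of the Gronwall argument: the flow of Gram matrices is linear, so a
    linear combination of them grows by a factor 1 + O(t - s), up to the errors of
    the local expansions. *)
Lemma gram_step (I : finType) (x : I -> R) (eta : I -> K -> R -> T -> R) s t : s <= t ->
  t - s <= (4 * @expansion_const R K M)^-1 ->
  (forall i, linear_sde P W a c s t (eta i)) ->
  znorm (fun k l => \sum_i x i * gram P (eta i) t k l) <=
  (1 + n * n * flow_const * (t - s)) * znorm (fun k l => \sum_i x i * gram P (eta i) s k l) +
  rem_const * (t - s) * Num.sqrt (t - s) * \sum_i `|x i| * energy P (eta i) s.
Proof.
move=> st small he.
set Z := fun k l => \sum_i x i * gram P (eta i) s k l.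
set q := Num.sqrt (t - s).
set E := \sum_i `|x i| * energy P (eta i) s.
set C2 := 2 * n * M * k1 + v * (n * M) ^+ 2 * (k1 * (2 + k1)).
have hs : 0 <= t - s by rewrite subr_ge0.
have one k l : `|\sum_i x i * gram P (eta i) t k l| <=
   `|Z k l| + (flow_const * znorm Z * (t - s) + (C2 + 3 * k1 ^+ 2) * (t - s) * q * E).
  have h i := local_expansion Pc hW M0 ma mc aM cM st (he i) small k l.
  have /choice[F /choice[rem hF]] := h.
  have iF i : lam.-integrable `[s, t] (EFin \o F i) by have [] := hF i.
  have ixF i : lam.-integrable `[s, t] (EFin \o (fun u => x i * F i u)).
    by apply: eq_integrable (integrableZl _ (x i) (iF i)).
  have -> : \sum_i x i * gram P (eta i) t k l = Z k l +
    \int[lam]_(u in `[s, t]) (\sum_i x i * F i u) + \sum_i x i * rem i.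
    rewrite Rintegral_sum_itv// /Z -!big_split/=; apply: eq_bigr => i _.
    have [_ -> _ _] := hF i; rewrite RintegralZl//; ring.
  rewrite -addrA; apply: le_trans (ler_normD _ _) _; rewrite lerD2l.
  apply: le_trans (ler_normD _ _) _.
  have r1 : `|\sum_i x i * rem i| <= 3 * k1 ^+ 2 * (t - s) * q * E.
    apply: le_trans (ler_norm_sum _ _ _) _; rewrite /E mulr_sumr.
    apply: ler_sum => i _; rewrite normrM mulrCA ler_wpM2l//.
    have [_ _ _] := hF i; rewrite sqr_sqrtr//; exact: energy_ge0.
  have r2 : `|\int[lam]_(u in `[s, t]) (\sum_i x i * F i u)| <=
     (flow_const * znorm Z + C2 * q * E) * (t - s).
    apply: Rintegral_itv_norm_le => //; first exact: integrable_sum_itv.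
    move=> u su.
    have -> : \sum_i x i * F i u = gram_flow a c u Z k l +
       \sum_i x i * (F i u - gram_flow a c u (gram P (eta i) s) k l).
      rewrite -gram_flow_sum -big_split/=; apply: eq_bigr => i _; ring.
    apply: le_trans (ler_normD _ _) _; apply: lerD; first exact: gram_flow_le.
    apply: le_trans (ler_norm_sum _ _ _) _; rewrite /E mulr_sumr.
    apply: ler_sum => i _; rewrite normrM mulrCA ler_wpM2l//.
    have [_ _ + _] := hF i => /(_ u su); rewrite sqr_sqrtr//; exact: energy_ge0.
  apply: le_trans (lerD r2 r1) _.
  rewrite le_eqVlt; apply/orP; left; apply/eqP; ring.
rewrite {1}/znorm.
apply: (@le_trans _ _ (\sum_k \sum_l (`|Z k l| +
   (flow_const * znorm Z * (t - s) + (C2 + 3 * k1 ^+ 2) * (t - s) * q * E)))).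
  by apply: ler_sum => k _; apply: ler_sum => l _; exact: one.
under eq_bigr do rewrite big_split/=.
rewrite big_split/= -/(znorm Z) !sumr_const.
set D := flow_const * _ * _ + _.
rewrite -[D *+ _ *+ _]mulr_natr -[D *+ _]mulr_natr /D /rem_const -/C2.
rewrite le_eqVlt; apply/orP; left; apply/eqP; ring.
Qed.

End GramStep.

(** * The mean-square state space *)

Section StateSpaceFacts.
Context {disp : measure_display} {T : measurableType disp} {R : realType}.
Variable P : probability T R.
Variable W : R -> T -> R.
Hypothesis Pc : measure_is_complete P.
Hypothesis hW : two_sided_wiener P W.
Variable d : nat.
Implicit Types X Y : T -> 'cV[R]_d.

Lemma euclid_norm_sq (x : 'cV[R]_d) : euclid_norm x ^+ 2 = \sum_(i < d) x i 0 ^+ 2.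
Proof. by rewrite sqr_sqrtr//; apply: sumr_ge0 => i _; exact: sqr_ge0. Qed.

Lemma second_moment_euclid X : (forall i, measurable_fun setT (fun w => X w i 0)) ->
  second_moment P (fun w => euclid_norm (X w)) =
  (\sum_(i < d) second_moment P (fun w => X w i 0)%R)%E.
Proof.
move=> mX; rewrite second_momentE.
under eq_integral do rewrite euclid_norm_sq -sumEFin.
rewrite ge0_integral_sum//.
- by apply: eq_bigr => i _; rewrite second_momentE.
- by move=> i; apply/measurable_EFinP; exact: measurable_funX.
- by move=> i w _; rewrite lee_fin sqr_ge0.
Qed.

Lemma ms_spaceP t X : ms_space P W t X <-> forall i, L2at P W t (fun w => X w i 0).
Proof.
split=> [[aX fX] i|h]; last first.
  have aX i : adapted_at P W t (fun w => X w i 0) by case: (h i).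
  split => //; rewrite second_moment_euclid; last by move=> i; exact: (adapted_measurable Pc hW (aX i)).
  by apply: lte_sum_pinfty => i _; case: (h i).
split => //; apply: le_lt_trans fX.
rewrite second_moment_euclid; last by move=> j; exact: (adapted_measurable Pc hW (aX j)).
rewrite (bigD1 i)//= leeDl//; apply: sume_ge0 => j _; exact: second_moment_ge0.
Qed.

Lemma ms_space_sqint t X i : ms_space P W t X -> sqint P (fun w => X w i 0).
Proof. by move=> /ms_spaceP h; exact: L2at_sqint (h i). Qed.

Lemma ms_norm_ge0 X : 0 <= ms_norm P X. Proof. exact: sqrtr_ge0. Qed.

Lemma ms_norm_sq X : (forall i, sqint P (fun w => X w i 0)) ->
  ms_norm P X ^+ 2 = \sum_(i < d) ip P (fun w => X w i 0) (fun w => X w i 0).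
Proof.
move=> sX; rewrite sqr_sqrtr; last by apply: fine_ge0; exact: second_moment_ge0.
rewrite second_moment_euclid; last by move=> i; case: (sX i).
under eq_bigr do rewrite second_moment_ip//.
by rewrite sumEFin.
Qed.

Lemma ms_space_mono s t X : s <= t -> ms_space P W s X -> ms_space P W t X.
Proof. by move=> st /ms_spaceP h; apply/ms_spaceP => i; exact: L2at_mono st (h i). Qed.

Lemma ms_space_comb t c X Y : ms_space P W t X -> ms_space P W t Y ->
  ms_space P W t (fun w => c *: X w + Y w).
Proof.
move=> /ms_spaceP hX /ms_spaceP hY; apply/ms_spaceP => i.
have -> : (fun w => (c *: X w + Y w) i 0) = (fun w => c * X w i 0 + Y w i 0).
  by apply/funext => w; rewrite !mxE.
by apply: (L2atD Pc hW) => //; exact: L2atZ.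
Qed.

(** Minkowski's inequality; the cross term is bounded by a discriminant, as in
    [ip_CS]. *)
Lemma ms_norm_comb t c X Y : ms_space P W t X -> ms_space P W t Y ->
  ms_norm P (fun w => c *: X w + Y w) <= `|c| * ms_norm P X + ms_norm P Y.
Proof.
move=> hX hY.
have sX i := ms_space_sqint i hX; have sY i := ms_space_sqint i hY.
have sZ i := ms_space_sqint i (ms_space_comb c hX hY).
have nX := ms_norm_ge0 X; have nY := ms_norm_ge0 Y.
rewrite -ler_sqr ?nnegrE ?ms_norm_ge0 ?addr_ge0 ?mulr_ge0//.
rewrite ms_norm_sq//.
have -> : \sum_(i < d) ip P (fun w => (c *: X w + Y w) i 0) (fun w => (c *: X w + Y w) i 0) =
  c ^+ 2 * ms_norm P X ^+ 2 + 2 * c * (\sum_(i < d) ip P (fun w => X w i 0) (fun w => Y w i 0)) + ms_norm P Y ^+ 2.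
  rewrite !ms_norm_sq// !mulr_sumr -!big_split/=; apply: eq_bigr => i _.
  have -> : (fun w => (c *: X w + Y w) i 0) = (fun w => c * X w i 0 + Y w i 0).
    by apply/funext => w; rewrite !mxE.
  rewrite ipDD//; last exact: sqintZ.
  rewrite ipZl//; last exact: sqintZ.
  by rewrite ipZr// ipZl//; ring.
set z := \sum_(i < d) ip P _ _.
have zle : `|z| <= ms_norm P X * ms_norm P Y.
  have key u : 0 <= ms_norm P X ^+ 2 + 2 * u * z + u ^+ 2 * ms_norm P Y ^+ 2.
    rewrite !ms_norm_sq// /z !mulr_sumr -!big_split/=; apply: sumr_ge0 => i _.
    have := ip_ge0 P (fun w => X w i 0 + u * Y w i 0).
    rewrite ipDD//; last exact: sqintZ.
    rewrite ipZl//; last exact: sqintZ.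
    by rewrite !ipZr// expr2 -!mulrA.
  move: key; set x := ms_norm P X; set y := ms_norm P Y => key.
  have [y0|y0] := eqVneq y 0.
    have [->|z0] := eqVneq z 0; first by rewrite normr0 mulr_ge0.
    have := key (- (x ^+ 2 + 1) / (2 * z)).
    rewrite y0 expr0n/= mulr0 addr0.
    have -> : 2 * (- (x ^+ 2 + 1) / (2 * z)) * z = - (x ^+ 2 + 1) by field.
    lra.
  have yp : 0 < y by rewrite lt_def y0.
  have := key (- z / y ^+ 2).
  have -> : x ^+ 2 + 2 * (- z / y ^+ 2) * z + (- z / y ^+ 2) ^+ 2 * y ^+ 2 = ((x * y) ^+ 2 - z ^+ 2) / y ^+ 2.
    by field.
  rewrite pmulr_lge0 ?invr_gt0 ?exprn_gt0// subr_ge0 => h.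
  by rewrite -ler_sqr ?nnegrE ?mulr_ge0// real_normK ?num_real.
have : c * z <= `|c| * (ms_norm P X * ms_norm P Y).
  by apply: le_trans (ler_norm _) _; rewrite normrM ler_wpM2l.
have -> : c ^+ 2 = `|c| ^+ 2 by rewrite real_normK ?num_real.
nra.
Qed.

Lemma ms_norm_ae X Y : (forall i, measurable_fun setT (fun w => X w i 0)) ->
  (forall i, measurable_fun setT (fun w => Y w i 0)) ->
  {ae P, forall w, X w = Y w} -> ms_norm P X = ms_norm P Y.
Proof.
move=> mX mY XY; congr (Num.sqrt (fine _)).
rewrite !second_moment_euclid//; apply: eq_bigr => i _; rewrite !second_momentE.
apply: ae_eq_integral => //.
- by apply/measurable_EFinP; apply: measurable_funX.
- by apply/measurable_EFinP; apply: measurable_funX.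
- by apply: filterS XY => w -> _.
Qed.

Lemma ms_space_measurable t X : ms_space P W t X -> forall i, measurable_fun setT (fun w => X w i 0).
Proof. by move=> h i; case: (ms_space_sqint i h). Qed.

Lemma ms_norm_eq0 t X : ms_space P W t X -> ms_norm P X = 0 -> {ae P, forall w, X w = 0}.
Proof.
move=> hX h; have sX i := ms_space_sqint i hX.
have : \sum_(i < d) ip P (fun w => X w i 0) (fun w => X w i 0) = 0.
  by rewrite -ms_norm_sq// h expr0n.
move=> /eqP; rewrite psumr_eq0; last by move=> i _; exact: ip_ge0.
move=> /allP h0.
have ai i : {ae P, forall w, X w i 0 = 0}.
  apply: nrm_eq0_ae => //; rewrite /nrm; apply/eqP; rewrite sqrtr_eq0.
  by have /= := h0 i (mem_index_enum i); rewrite eq_le => /andP[].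
have key (r : seq 'I_d) : {ae P, forall w, forall i, i \in r -> X w i 0 = 0}.
  elim: r => [|i r ih]; first by apply: aeW => w i; rewrite in_nil.
  apply: filterS2 (ai i) ih => w h1 h2 j; rewrite inE => /orP[/eqP->//|]; exact: h2.
apply: filterS (key (index_enum 'I_d)) => w hw; apply/colP => i.
by rewrite hw ?mem_index_enum// mxE.
Qed.

Lemma ms_zeroP t X : ms_zero P W (d := d) t X <-> ms_space P W t X /\ ms_norm P X = 0.
Proof.
split=> -[hX h]; split => //; last exact: (ms_norm_eq0 hX h).
have m0 (i : 'I_d) : measurable_fun [set: T] (fun=> (0 : 'cV[R]_d) i 0) by exact: measurable_cst.
have -> : ms_norm P X = ms_norm P (fun=> 0 : 'cV[R]_d).
  by apply: ms_norm_ae => //; exact: (ms_space_measurable hX).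
rewrite /ms_norm second_moment_euclid//.
rewrite big1 ?sqrtr0// => i _; rewrite second_momentE.
by under eq_integral do rewrite mxE expr0n/=; rewrite integral0.
Qed.

Lemma meanE X i : mean P X i 0 = \int[P]_w X w i 0.
Proof. by rewrite /mean mxE unlock. Qed.

Lemma mean_ip X i : mean P X i 0 = ip P (cst 1) (fun w => X w i 0).
Proof. by rewrite meanE; apply: eq_Rintegral => w _; rewrite mul1r. Qed.

End StateSpaceFacts.

(** * Elementary inequalities and positive semidefinite matrices *)

Section RealLemmas.
Context {R : realType}.

(** The initial value is at most zero, hence only the accumulated errors e
    remain. *)
Lemma discrete_gronwall (z : nat -> R) (a e : R) n : 0 <= a -> 0 <= e ->
  z 0%N <= 0 -> (forall k, (k < n)%N -> z k.+1 <= (1 + a) * z k + e) ->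
  z n <= n%:R * e * (1 + a) ^+ n.
Proof.
move=> a0 e0 z0 h.
have a1 : 1 <= 1 + a by lra.
have key k : (k <= n)%N -> z k <= k%:R * e * (1 + a) ^+ k.
  elim: k => [_|k ih kn]; first by rewrite !mul0r.
  apply: le_trans (h k kn) _.
  have : (1 + a) * z k <= (1 + a) * (k%:R * e * (1 + a) ^+ k).
    by apply: ler_wpM2l; [lra|exact: ih (ltnW kn)].
  have : e <= e * (1 + a) ^+ k.+1 by rewrite ler_peMr// exprn_ege1.
  have -> : k.+1%:R * e * (1 + a) ^+ k.+1 = (1 + a) * (k%:R * e * (1 + a) ^+ k) + e * (1 + a) ^+ k.+1.
    by rewrite -natr1 exprS; ring.
  lra.
exact: key.
Qed.

Lemma onem_expn_le (a : R) n : 0 <= a -> (1 + a) ^+ n <= expR (n%:R * a).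
Proof.
move=> a0; rewrite mulrC expRM_natr; apply: lerXn2r; rewrite ?nnegrE ?expR_ge0 ?addr_ge0//.
exact: expR_ge1Dx.
Qed.

Lemma nat_steps (x h : R) : 0 <= x -> 0 < h -> exists n, x <= n%:R * h /\ n%:R * h <= x + h.
Proof.
move=> x0 h0.
have y0 : 0 <= x / h by rewrite divr_ge0// ltW.
have /andP[h1 h2] := truncn_itv y0.
exists (Num.truncn (x / h)).+1; split.
  by rewrite -ler_pdivrMr// ltW.
by rewrite -addn1 natrD mulrDl mul1r lerD2r -ler_pdivlMr.
Qed.

End RealLemmas.

(** Cholesky factorization by induction on the size.  When the first diagonal entry
    is zero, semidefiniteness forces the first column to vanish, which makes the
    choice 1 / 0 = 0 harmless. *)
Lemma psd_factor (R : rcfType) (n : nat) (Q : 'M[R]_n) : Q^T = Q ->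
  (forall u : 'cV[R]_n, 0 <= (u^T *m Q *m u) 0 0) -> exists L : 'M[R]_n, Q = L *m L^T.
Proof.
elim: n Q => [|n ih] Q; first by move=> _ _; exists 0; apply/matrixP => -[].
rewrite -[n.+1]/(1 + n)%N in Q *.
move=> symQ psd.
pose a := ulsubmx Q 0 0; pose b : 'cV[R]_n := dlsubmx Q; pose Q1 := drsubmx Q.
have QE : Q = block_mx a%:M b^T b Q1.
  rewrite -{1}(submxK Q); congr (block_mx _ _ _ _); first exact: mx11_scalar.
  by rewrite /b -[in RHS]symQ trmx_dlsub trmxK || by rewrite /b trmx_dlsub symQ.
have symQ1 : Q1^T = Q1 by rewrite /Q1 trmx_drsub symQ.
pose be (u : 'cV[R]_n) := (b^T *m u) 0 0; pose ga (u : 'cV[R]_n) := (u^T *m Q1 *m u) 0 0.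
have form x (u : 'cV[R]_n) : 0 <= a * x ^+ 2 + 2 * x * be u + ga u.
  have := psd (col_mx x%:M u).
  rewrite QE tr_col_mx mul_row_block mul_row_col.
  have -> : (((x%:M : 'M[R]_1)^T *m a%:M + u^T *m b) *m x%:M +
    ((x%:M)^T *m b^T + u^T *m Q1) *m u) 0 0 = a * x ^+ 2 + 2 * x * be u + ga u.
    have ub : u^T *m b = (be u)%:M.
      rewrite [LHS]mx11_scalar; congr _%:M.
      by rewrite -[in LHS](trmxK b) -trmx_mul mxE.
    have bu : b^T *m u = (be u)%:M := mx11_scalar _.
    have gu : u^T *m Q1 *m u = (ga u)%:M := mx11_scalar _.
    rewrite tr_scalar_mx ub -scalar_mxM [X in _ + X]mulmxDl -mulmxA bu gu.
    rewrite mulmxDl -!scalar_mxM !mxE /= !mulr1n; ring.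
  by [].
have a0 : 0 <= a.
  have := form 1 0; rewrite /be /ga !mulmx0 !mxE; lra.
pose s := Num.sqrt a; pose c := s^-1 *: b.
have ss : s * s = a by rewrite -expr2 sqr_sqrtr.
have sb : s *: c = b.
  rewrite /c scalerA; have [s0|s0] := eqVneq s 0; last by rewrite mulfV// scale1r.
  have az : a = 0 by rewrite -ss s0 mul0r.
  rewrite s0 mul0r scale0r; apply/esym/colP => j; rewrite [RHS]mxE.
  have key x : 0 <= 2 * x * be (delta_mx j 0) + ga (delta_mx j 0).
    by have := form x (delta_mx j 0); rewrite az mul0r add0r.
  have bj : be (delta_mx j 0) = b j 0 by rewrite /be -colE !mxE.
  apply/eqP; apply: contraT => bn.
  have := key (- (ga (delta_mx j 0) + 1) / (2 * b j 0)).
  rewrite bj.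
  have -> : 2 * (- (ga (delta_mx j 0) + 1) / (2 * b j 0)) * b j 0 = - (ga (delta_mx j 0) + 1).
    by move: bn; move: (b j 0) (ga _) => z g zn; field; rewrite zn.
  by lra.
pose Q2 := Q1 - c *m c^T.
have symQ2 : Q2^T = Q2 by rewrite /Q2 linearB/= symQ1 trmx_mul trmxK.
have psdQ2 (u : 'cV[R]_n) : 0 <= (u^T *m Q2 *m u) 0 0.
  have e : (u^T *m Q2 *m u) 0 0 = ga u - ((c^T *m u) 0 0) ^+ 2.
    have cu : c^T *m u = ((c^T *m u) 0 0)%:M := mx11_scalar _.
    have uc : u^T *m c = ((c^T *m u) 0 0)%:M.
      rewrite [LHS]mx11_scalar; congr _%:M.
      by rewrite -[in LHS](trmxK c) -trmx_mul mxE.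
    move: cu uc; set w := (c^T *m u) 0 0 => cu uc.
    rewrite /Q2 mulmxBr mulmxBl mulmxA -(mulmxA (u^T *m c)) cu uc -scalar_mxM.
    by rewrite [LHS]mxE [X in _ + X]mxE [X in _ - X]mxE eqxx mulr1n expr2.
  rewrite e; set w := (c^T *m u) 0 0.
  have bw : be u = s * w by rewrite /be -sb linearZ/= -scalemxAl mxE.
  have [s0|s0] := eqVneq s 0.
    have -> : w = 0 by rewrite /w /c s0 invr0 scale0r trmx0 mul0mx mxE.
    rewrite expr0n subr0; have := form 0 u; lra.
  have := form (- w / s) u; rewrite bw -ss.
  have -> : s * s * (- w / s) ^+ 2 + 2 * (- w / s) * (s * w) = - w ^+ 2 by field.
  by lra.
have [L1 hL1] := ih Q2 symQ2 psdQ2.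
exists (block_mx s%:M 0 c L1).
rewrite QE tr_block_mx mulmx_block !trmx0 !mulmx0 !mul0mx !addr0 tr_scalar_mx.
rewrite -scalar_mxM ss mul_scalar_mx mul_mx_scalar -[s *: c^T]linearZ/= sb -hL1.
by rewrite /Q2 addrC subrK.
Qed.

Lemma exp_bounded_le0 (R : realType) (a b al : R) : 0 < al ->
  (forall tau, 0 <= tau -> a * expR (al * tau) <= b) -> a <= 0.
Proof.
move=> al0 h; rewrite leNgt; apply/negP => a0.
have b0 : 0 <= b by have := h 0 (lexx _); rewrite mulr0 expR0 mulr1; lra.
have t0 : 0 <= (b / a) / al by rewrite !divr_ge0// ltW.
have := h _ t0.
have -> : al * (b / a / al) = b / a by field; rewrite !gt_eqF.
apply/negP; rewrite -ltNge -ltr_pdivrMl// mulrC.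
by apply: lt_le_trans (expR_ge1Dx _); rewrite ltrDr ltr01.
Qed.

(** * The mean-field equation as a linear equation *)

Section MeanFieldFlow.
Context {disp : measure_display} {T : measurableType disp} {R : realType}.
Variable P : probability T R.
Variable W : R -> T -> R.
Hypothesis Pc : measure_is_complete P.
Hypothesis hW : two_sided_wiener P W.
Local Notation lam := (@lebesgue_measure R).

Lemma joint_time_itv (s t : R) (g : R -> R) : measurable_fun `[s, t] g -> joint s t (fun u (_ : T) => g u).
Proof.
move=> /(measurable_restrictT _ (measurable_itv _)) mg.
apply: (@joint_congr _ _ _ s t (fun u _ => (g \_ `[s, t]) u)).
  by move=> u w su; rewrite patchE mem_setE in_itv/= su.
by apply: joint_time; exact: mg.
Qed.

(** The mean of a square integrable process is one too, by Cauchy-Schwarz against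
    the constant 1. *)
Lemma l2proc_mean s t (f : R -> T -> R) : l2proc P s t f ->
  l2proc P s t (fun u _ => ip P (cst 1) (f u)).
Proof.
move=> hf; have [jf sf ff] := hf.
have jm : joint s t (fun u (_ : T) => ip P (cst 1) (f u)).
  apply: joint_time_itv.
  have := ip_time_integrable (l2proc_const s t (sqint_cst P 1)) hf.
  by case/integrableP => /measurable_EFinP.
split => //; first by move=> u _; exact: sqint_cst.
apply: le_lt_trans ff; apply: ge0_le_integral => //.
- by move=> u _; exact: second_moment_ge0.
- exact: measurable_second_moment.
- exact: measurable_second_moment.
- move=> u /=; rewrite in_itv/= => su; have su' := sf u su.
  rewrite (second_moment_ip (sqint_cst P _)) (second_moment_ip su') ip_cst lee_fin.
  rewrite -expr2 -real_normK ?num_real// -[leRHS]sqr_nrm.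
  rewrite ler_sqr ?nnegrE ?nrm_ge0//; apply: le_trans (ip_CS (sqint_cst P 1) su') _.
  by rewrite /nrm ip_cst mulr1 sqrtr1 mul1r.
Qed.

Lemma step_process_exists s t : s <= t -> exists e, step_process_on P W s t e /\
  (forall u w, step_value e u w = 0) /\ (forall w, step_integral W e w = 0).
Proof.
move=> st; exists (StepProcess 1%N (fun k => if k == 0%N then s else t) (fun _ => cst 0)); split.
  split => //= k; rewrite ltnS leqn0 => /eqP->//=.
  exact: (L2at_cst P W s 0).
split => [u|] w; rewrite /step_value /step_integral big1// => k _; by rewrite mul0r.
Qed.

Lemma ito_zero s t : s <= t -> is_ito_integral P W s t (fun _ _ => 0) (cst 0).
Proof.
move=> st; have [e [he [ev ei]]] := step_process_exists st.
have z : second_moment P (fun=> 0) = 0%E by rewrite (second_moment_ip (sqint_cst P 0)) ip_cst mulr0.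
split.
- exact: joint_const.
- by move=> u _; exact: adapted_cst.
- by under eq_integral do rewrite z; rewrite integral0 ltry.
- exact: measurable_cst.
exists (fun=> e); split => //.
- apply: cvg_near_cst; near=> n.
  have E u : second_moment P (fun w => 0 - step_value e u w) = 0%E.
    by rewrite -[RHS]z; congr second_moment; apply/funext => w; rewrite ev subr0.
  by under eq_integral do rewrite E; rewrite integral0.
- apply: cvg_near_cst; near=> n.
  by rewrite -[RHS]z; congr second_moment; apply/funext => w; rewrite ei subr0.
Unshelve. all: end_near. Qed.

Variable d : nat.
Variables A B C D : R -> 'M[R]_d.
Variable m : R.
Hypothesis cA : continuous A.
Hypothesis cB : continuous B.
Hypothesis cC : continuous C.
Hypothesis cD : continuous D.
Hypothesis m0 : 0 <= m.
Hypothesis bnd : forall (i j : 'I_d) (t : R),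
     [/\ `|A t i j| <= m, `|B t i j| <= m, `|C t i j| <= m & `|D t i j| <= m].

Lemma entry_measurable (F : R -> 'M[R]_d) i j : continuous F ->
  measurable_fun setT (fun u => F u i j).
Proof.
move=> cF; apply: continuous_measurable_fun => u.
apply: (continuous_comp (f := F) (g := fun M : 'M[R]_d => M i j)); first exact: cF.
exact: coord_continuous.
Qed.

Local Notation idx := ('I_d + 'I_d)%type.

(** Coefficients of the equation for the pair (X, E X): the index [inl i] stands for
    the i-th component of X, [inr i] for that of E X. Taking expectations in the
    equation gives d (E X) = (A + B) (E X) dt, without noise. *)
Definition drift_coef (u : R) (k l : idx) : R :=
  match k, l with
  | inl i, inl j => A u i j
  | inl i, inr j => B u i j
  | inr _, inl _ => 0
  | inr i, inr j => A u i j + B u i j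
  end.

Definition diff_coef (u : R) (k l : idx) : R :=
  match k, l with
  | inl i, inl j => C u i j
  | inl i, inr j => D u i j
  | inr _, _ => 0
  end.

Definition stack (X : R -> T -> 'cV[R]_d) (k : idx) (u : R) (w : T) : R :=
  match k with
  | inl i => X u w i 0
  | inr i => mean P (X u) i 0
  end.

Lemma drift_coef_measurable k l : measurable_fun setT (fun u => drift_coef u k l).
Proof.
case: k => i; case: l => j /=; try exact: entry_measurable; first exact: measurable_cst.
by apply: measurable_funD; exact: entry_measurable.
Qed.

Lemma diff_coef_measurable k l : measurable_fun setT (fun u => diff_coef u k l).
Proof. by case: k => i; case: l => j /=; try exact: entry_measurable; exact: measurable_cst. Qed.

Lemma drift_coef_le u k l : `|drift_coef u k l| <= 2 * m.
Proof.
have m2 : m <= 2 * m by have := m0; lra.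
case: k => i; case: l => j /=; have [hA hB _ _] := bnd i j u.
- exact: le_trans m2.
- exact: le_trans m2.
- by rewrite normr0 mulr_ge0.
- by apply: le_trans (ler_normD _ _) _; rewrite mulr_natl mulr2n lerD.
Qed.

Lemma diff_coef_le u k l : `|diff_coef u k l| <= 2 * m.
Proof.
have m2 : m <= 2 * m by have := m0; lra.
case: k => i; case: l => j /=; have [_ _ hC hD] := bnd i j u.
- exact: le_trans m2.
- exact: le_trans m2.
- by rewrite normr0 mulr_ge0.
- by rewrite normr0 mulr_ge0.
Qed.

Lemma drift_stack X i u w : drift P A B X u w i 0 = lincoef drift_coef (stack X) (inl i) u w.
Proof. by rewrite /drift /lincoef big_sumType/= !mxE. Qed.

Lemma diffusion_stack X i u w : diffusion P C D X u w i 0 = lincoef diff_coef (stack X) (inl i) u w.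
Proof. by rewrite /diffusion /lincoef big_sumType/= !mxE. Qed.

Section OneSolution.
Variables (s : R) (x : T -> 'cV[R]_d) (X : R -> T -> 'cV[R]_d).
Hypothesis hX : mf_sde_solution P W A B C D s x X.

Lemma sol_space t : s <= t -> ms_space P W t (X t).
Proof. by case: hX => h _ _ _ _; exact: h. Qed.

Lemma sol_start : {ae P, forall w, X s w = x w}. Proof. by case: hX. Qed.

Lemma sol_l2proc t i : s <= t -> l2proc P s t (fun u w => X u w i 0).
Proof.
move=> st; have [hs hj hi _ _] := hX.
have jX j : joint s t (fun u w => X u w j 0).
  apply: measurable_funS (hj j); first exact: measurableX.
  by move=> [u w] /= []; rewrite !in_itv/= andbT => /andP[].
split => //.
  by move=> u /andP[su _]; exact: (ms_space_sqint Pc hW i (hs u su)).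
apply: le_lt_trans (hi t st).
rewrite [leRHS](_ : _ = (\int[lam]_(u in `[s, t]) \sum_(j < d) second_moment P (fun w => X u w j 0%R))%E); last first.
  apply: eq_integral => u; rewrite mem_setE in_itv/= => /andP[su _].
  by rewrite second_moment_euclid// => j; case: (ms_space_sqint Pc hW j (hs u su)).
apply: ge0_le_integral => //.
- by move=> u _; exact: second_moment_ge0.
- exact: measurable_second_moment.
- by apply: emeasurable_sum => j; exact: measurable_second_moment.
- move=> u _; rewrite (bigD1 i)//= leeDl//; apply: sume_ge0 => j _; exact: second_moment_ge0.
Qed.

Lemma stack_l2proc t k : s <= t -> l2proc P s t (stack X k).
Proof.
move=> st; case: k => i; first exact: sol_l2proc.
have -> : stack X (inr i) = (fun u _ => ip P (cst 1) (fun w => X u w i 0)).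
  by apply/funext => u; apply/funext => w; rewrite /stack mean_ip.
exact: (l2proc_mean (sol_l2proc i st)).
Qed.

Lemma sol_eq t i : s <= t -> exists I,
  is_ito_integral P W s t (lincoef diff_coef (stack X) (inl i)) I /\
  {ae P, forall w, X t w i 0 = x w i 0 + tint s t (lincoef drift_coef (stack X) (inl i)) w + I w}.
Proof.
move=> st; have [_ _ _ _ heq] := hX; have [I [hI E]] := heq t i st.
exists I; split.
  by apply: ito_congr hI => u w _; exact: diffusion_stack.
apply: filterS E => w ->; congr (_ + _ + _).
by apply: eq_Rintegral => u _; exact: drift_stack.
Qed.

(** The equation of the components of E X is obtained by pairing that of X with the
    constant 1, which is orthogonal to stochastic integrals. *)
Lemma sol_linear_sde t : s <= t -> linear_sde P W drift_coef diff_coef s t (stack X).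
Proof.
move=> st.
have lX k r : s <= r -> l2proc P s r (stack X k) by move=> sr; exact: stack_l2proc.
have L2s k : L2at P W s (stack X k s).
  case: k => i; last exact: L2at_cst.
  by have /(ms_spaceP Pc hW) := sol_space (lexx s); apply.
have la k r : s <= r -> l2proc P s r (lincoef drift_coef (stack X) k).
  move=> sr; apply: (lincoef_l2proc (M := 2 * m)).
  - exact: drift_coef_measurable.
  - exact: drift_coef_le.
  - by move=> l; exact: lX.
split => //; first by move=> k; exact: lX.
case=> i r /andP[sr _].
  have [I [hI E]] := sol_eq i sr; exists I; split => //.
  by apply: filterS2 sol_start E => w; rewrite /stack => ->.
exists (cst 0); split.
  apply: ito_congr (ito_zero sr) => u w _.
  by rewrite /lincoef big1// => l _; case: l => j /=; rewrite mul0r.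
apply: aeW => w; rewrite addr0.
have [I [hI E]] := sol_eq i sr.
have [sI _] := ito_isometry_ereal Pc hW hI.
have sD := tint_sqint sr (la (inl i) r sr).
have hs := ms_space_sqint Pc hW i (sol_space (lexx s)).
have hr := ms_space_sqint Pc hW i (sol_space sr).
have hsD := sqintD hs sD; have hsDI := sqintD hsD sI.
rewrite /= !mean_ip.
have -> : ip P (cst 1) (fun w => X r w i 0) = ip P (cst 1)
   (fun w => X s w i 0 + tint s r (lincoef drift_coef (stack X) (inl i)) w + I w).
  apply: ip_ae.
  - exact: measurable_cst.
  - exact: measurable_cst.
  - by case: hr.
  - by case: hsDI.
  - exact: aeW.
  - by apply: filterS2 sol_start E => w' ->.
rewrite ipDr//; last exact: sqint_cst.
rewrite ipDr//; last exact: sqint_cst.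
rewrite (ito_orth Pc hW hI (L2at_cst P W s 1)) addr0; congr (_ + _).
rewrite (tint_ip (la (inl i) r sr) (sqint_cst P 1)).
apply: eq_Rintegral => u; rewrite mem_setE in_itv/= => su.
have [su1 su2] := andP su.
have sq j : sqint P (stack X j u) by have [_ + _] := lX j r sr; apply.
rewrite /lincoef ip_sumr; last exact: sqint_cst; last by move=> j; exact: sqintZ.
rewrite !big_sumType/= [X in _ = X + _]big1 ?add0r; last by move=> j _; rewrite mul0r.
rewrite -big_split/=; apply: eq_bigr => j _.
rewrite !ipZr ?ip_cst; [|exact: sqint_cst|exact: sqint_cst|exact: (sq (inl j))|exact: sqint_cst].
by rewrite mul1r -mean_ip mulrDl.
Qed.

End OneSolution.

(** * Linearity and cocycle property of the flow *)

Lemma l2proc_concat s r t (f g : R -> T -> R) : s <= r -> r <= t ->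
  l2proc P s r f -> l2proc P r t g -> l2proc P s t (concat r f g).
Proof.
move=> sr rt [jf sf ff] [jg sg fg]; split.
- exact: concat_joint.
- move=> u /andP[su ut].
  have -> : concat r f g u = (if u <= r then f u else g u).
    by apply/funext => w; rewrite /concat; case: ifP.
  by case: (leP u r) => ur; [apply: sf; rewrite su|apply: sg; rewrite (ltW ur)].
- by apply: le_lt_trans (integral_concat_le P sr rt jf jg) _; rewrite lte_add_pinfty.
Qed.

Lemma tint_concat s r t (f g : R -> T -> R) : s <= r -> r <= t ->
  l2proc P s r f -> l2proc P r t g ->
  {ae P, forall w, tint s t (concat r f g) w = tint s r f w + tint r t g w}.
Proof.
move=> sr rt hf hg.
have := tint_ae_integrable (l2proc_concat sr rt hf hg).
have := tint_ae_integrable hg.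
apply: filterS2 => w ig ih.
rewrite /tint (itv_split sr rt) Rintegral_setU//; last 2 first.
- by rewrite -(itv_split sr rt).
- exact: itv_split_disj.
congr (_ + _).
  apply: eq_Rintegral => u; rewrite mem_setE in_itv/= => /andP[_ ur].
  by rewrite /concat ur.
rewrite -(@Rintegral_itv_obnd_cbnd _ r (BRight t) (g^~ w)).
  apply: eq_Rintegral => u; rewrite mem_setE in_itv/= => /andP[ur _].
  by rewrite /concat leNgt ur.
by apply: integrableS ig => // u /=; rewrite !in_itv/= => /andP[/ltW -> ->].
Qed.

Lemma tint_comb s t c (f g : R -> T -> R) : l2proc P s t f -> l2proc P s t g ->
  {ae P, forall w, tint s t (fun u w => c * f u w + g u w) w = c * tint s t f w + tint s t g w}.
Proof.
move=> hf hg; have := tint_ae_integrable hg; have := tint_ae_integrable hf.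
apply: filterS2 => w i_f ig; rewrite /tint RintegralD//.
  by rewrite RintegralZl.
by apply: eq_integrable (integrableZl _ c i_f).
Qed.

Lemma energy_finite s t (X : R -> T -> 'cV[R]_d) :
  (forall i, l2proc P s t (fun u w => X u w i 0)) ->
  (\int[lam]_(u in `[s, t]) second_moment P (fun w => euclid_norm (X u w)) < +oo)%E.
Proof.
move=> hX.
rewrite (_ : (\int[lam]_(u in `[s, t]) second_moment P (fun w => euclid_norm (X u w)) =
  \int[lam]_(u in `[s, t]) \sum_(j < d) second_moment P (fun w => X u w j 0%R))%E); last first.
  apply: eq_integral => u; rewrite mem_setE in_itv/= => su.
  by rewrite second_moment_euclid// => j; have [_ + _] := hX j => /(_ u su) [].
rewrite ge0_integral_sum//.
- by apply: lte_sum_pinfty => j _; have [] := hX j.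
- by move=> j; apply: measurable_second_moment; have [] := hX j.
- by move=> j u _; exact: second_moment_ge0.
Qed.

Let drift_l2proc s x X t i : mf_sde_solution P W A B C D s x X -> s <= t ->
  l2proc P s t (fun u w => drift P A B X u w i 0).
Proof.
move=> hX st.
have -> : (fun u w => drift P A B X u w i 0) = lincoef (drift_coef) (stack X) (inl i).
  by apply/funext => u; apply/funext => w; exact: drift_stack.
apply: (lincoef_l2proc (M := 2 * m)).
- by move=> k l; exact: drift_coef_measurable.
- by move=> u k l; exact: drift_coef_le.
- by move=> l; exact: (stack_l2proc hX).
Qed.

Lemma mean_comb t c (X Y : T -> 'cV[R]_d) : ms_space P W t X -> ms_space P W t Y ->
  mean P (fun w => c *: X w + Y w) = c *: mean P X + mean P Y.
Proof.
move=> hX hY; apply/colP => i.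
have sX := ms_space_sqint Pc hW i hX; have sY := ms_space_sqint Pc hW i hY.
rewrite mean_ip [RHS]mxE [X in _ = X + _]mxE !mean_ip.
have -> : (fun w => (c *: X w + Y w) i 0) = (fun w => c * X w i 0 + Y w i 0).
  by apply/funext => w; rewrite !mxE.
rewrite ipDr//; [|exact: sqintZ|exact: sqint_cst].
by rewrite ipZr//; exact: sqint_cst.
Qed.

Lemma sol_comb s c x y X Y :
  mf_sde_solution P W A B C D s x X -> mf_sde_solution P W A B C D s y Y ->
  mf_sde_solution P W A B C D s (fun w => c *: x w + y w) (fun u w => c *: X u w + Y u w).
Proof.
move=> hX hY.
have [hsX hjX _ hxX heX] := hX; have [hsY hjY _ hxY heY] := hY.
have meanE u : s <= u -> mean P (fun w => c *: X u w + Y u w) = c *: mean P (X u) + mean P (Y u).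
  by move=> su; exact: mean_comb (hsX u su) (hsY u su).
have cmpE i : (fun z : R * T => (c *: X z.1 z.2 + Y z.1 z.2) i 0) =
   (fun z => c * X z.1 z.2 i 0 + Y z.1 z.2 i 0) by apply/funext => z; rewrite !mxE.
split.
- by move=> t st; apply: (ms_space_comb Pc hW); [exact: hsX|exact: hsY].
- move=> i; rewrite cmpE; apply: measurable_funD; last exact: hjY.
  by apply: measurable_funM => //; exact: hjX.
- move=> t st; apply: energy_finite => i.
  have -> : (fun u w => (c *: X u w + Y u w) i 0) = (fun u w => c * X u w i 0 + Y u w i 0).
    by apply/funext => u; apply/funext => w; rewrite !mxE.
  apply: l2procD; last exact: (sol_l2proc hY).
  apply: (l2procM (M := `|c|)) => //; exact: (sol_l2proc hX).
- by apply: filterS2 hxX hxY => w -> ->.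
move=> t i st.
have [I [hI EI]] := heX t i st; have [J [hJ EJ]] := heY t i st.
have driftE u w : s <= u -> drift P A B (fun u w => c *: X u w + Y u w) u w i 0 =
   c * drift P A B X u w i 0 + drift P A B Y u w i 0.
  move=> su; rewrite /drift meanE// !mulmxDr -!scalemxAr.
  by rewrite !mxE; ring.
have diffE u w : s <= u -> diffusion P C D (fun u w => c *: X u w + Y u w) u w i 0 =
   c * diffusion P C D X u w i 0 + diffusion P C D Y u w i 0.
  move=> su; rewrite /diffusion meanE// !mulmxDr -!scalemxAr.
  by rewrite !mxE; ring.
exists (fun w => c * I w + J w); split.
  apply: ito_congr (ito_comb Pc hW c hI hJ) => u w /andP[su _].
  by rewrite diffE.
have dX := drift_l2proc i hX st; have dY := drift_l2proc i hY st.
have td := tint_comb c dX dY.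
apply: filterS3 EI EJ td => w E1 E2 E3.
have cE (p q : 'cV[R]_d) : (c *: p + q) i 0 = c * p i 0 + q i 0 by rewrite !mxE.
rewrite /= !cE E1 E2.
have -> : \int[lam]_(u in `[s, t]) drift P A B (fun u w => c *: X u w + Y u w) u w i 0 =
  tint s t (fun u w => c * drift P A B X u w i 0 + drift P A B Y u w i 0) w.
  by apply: eq_Rintegral => u; rewrite mem_setE in_itv/= => /andP[su _]; exact: driftE.
rewrite E3 /tint; ring.
Qed.

Definition vconcat r (X Y : R -> T -> 'cV[R]_d) u w := if u <= r then X u w else Y u w.

(** The cocycle property is obtained by gluing solutions and using that the value of
    the flow is the value of every solution. *)
Lemma sol_concat s r x y X Y : s <= r ->
  mf_sde_solution P W A B C D s x X -> mf_sde_solution P W A B C D r y Y ->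
  {ae P, forall w, y w = X r w} ->
  mf_sde_solution P W A B C D s x (vconcat r X Y).
Proof.
move=> sr hX hY yX.
have [hsX hjX hiX hxX heX] := hX; have [hsY hjY hiY hyY heY] := hY.
have ZX u : u <= r -> vconcat r X Y u = X u by move=> ur; apply/funext => w; rewrite /vconcat ur.
have ZY u : r < u -> vconcat r X Y u = Y u.
  by move=> ur; apply/funext => w; rewrite /vconcat leNgt ur.
have mZ (F : (R -> T -> 'cV[R]_d) -> R -> T -> R) :
   (forall Z1 Z2 u, Z1 u = Z2 u -> F Z1 u = F Z2 u) ->
   forall u w, F (vconcat r X Y) u w = concat r (F X) (F Y) u w.
  move=> hF u w; rewrite /concat; case: (leP u r) => ur.
    by rewrite (hF _ X _ (ZX u ur)).
  by rewrite (hF _ Y _ (ZY u ur)).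
have entryE i u w : vconcat r X Y u w i 0 = concat r (fun u w => X u w i 0) (fun u w => Y u w i 0) u w.
  by apply: (mZ (fun X u w => X u w i 0)) => Z1 Z2 v' ->.
split.
- move=> t st; case: (leP t r) => tr; first by rewrite ZX//; exact: hsX.
  by rewrite ZY//; apply: hsY; exact: ltW.
- move=> i.
  have E : (`[s, +oo[ `*` [set: T] : set (R * T)) = (`[s, r] `*` [set: T]) `|` (`]r, +oo[ `*` [set: T]).
    apply/seteqP; split => -[u w] /=; rewrite !in_itv/= !andbT.
      by move=> [su _]; case: (leP u r) => ur; [left; rewrite su|right].
    by move=> [[/andP[su _] _]|[ur _]]; split => //; exact: le_trans sr (ltW ur).
  rewrite E; apply/measurable_funU; [exact: measurable_box|exact: measurableX|split].
    have h1 : measurable_fun (`[s, r] `*` [set: T]) (fun z : R * T => X z.1 z.2 i 0).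
      apply: measurable_funS (hjX i); first exact: measurableX.
      by move=> [u w] /= []; rewrite !in_itv/= andbT => /andP[].
    apply: eq_measurable_fun h1 => -[u w].
    by rewrite in_setX/= mem_setE in_itv/= => /andP[/andP[_ ur] _]; rewrite ZX.
  have h1 : measurable_fun (`]r, +oo[ `*` [set: T]) (fun z : R * T => Y z.1 z.2 i 0).
    apply: measurable_funS (hjY i); first exact: measurableX.
    by move=> [u w] /= []; rewrite !in_itv/= !andbT => /ltW.
  apply: eq_measurable_fun h1 => -[u w].
  by rewrite in_setX/= mem_setE in_itv/= andbT => /andP[ur _]; rewrite ZY.
- move=> t st; have [tr|tr] := leP t r.
    rewrite (_ : (\int[lam]_(u in `[s, t]) _)%E = (\int[lam]_(u in `[s, t]) second_moment P (fun w => euclid_norm (X u w)))%E); first exact: hiX.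
    by apply: eq_integral => u; rewrite mem_setE in_itv/= => /andP[_ ut]; rewrite ZX// (le_trans ut tr).
  apply: energy_finite => i.
  have -> : (fun u w => vconcat r X Y u w i 0) = concat r (fun u w => X u w i 0) (fun u w => Y u w i 0).
    by apply/funext => u; apply/funext => w; exact: entryE.
  apply: l2proc_concat; [exact: sr|exact: ltW|exact: (sol_l2proc hX)|].
  by apply: (sol_l2proc hY); exact: ltW.
- by rewrite ZX.
move=> t i st.
have driftE u w : drift P A B (vconcat r X Y) u w i 0 =
   concat r (fun u w => drift P A B X u w i 0) (fun u w => drift P A B Y u w i 0) u w.
  by apply: (mZ (fun X u w => drift P A B X u w i 0)) => Z1 Z2 v' e; rewrite /drift e.
have diffE u w : diffusion P C D (vconcat r X Y) u w i 0 =
   concat r (fun u w => diffusion P C D X u w i 0) (fun u w => diffusion P C D Y u w i 0) u w.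
  by apply: (mZ (fun X u w => diffusion P C D X u w i 0)) => Z1 Z2 v' e; rewrite /diffusion e.
have [tr|tr] := leP t r.
  have [I [hI EI]] := heX t i st; exists I; split.
    by apply: ito_congr hI => u w /andP[_ ut]; rewrite diffE /concat (le_trans ut tr).
  apply: filterS EI => w; rewrite ZX// => ->; congr (_ + _ + _).
  apply: eq_Rintegral => u; rewrite mem_setE in_itv/= => /andP[_ ut].
  by rewrite driftE /concat (le_trans ut tr).
have rt := ltW tr.
have [I [hI EI]] := heX r i sr; have [J [hJ EJ]] := heY t i rt.
exists (fun w => I w + J w); split.
  by apply: ito_congr (ito_concat Pc hW sr rt hI hJ) => u w _; rewrite diffE.
have dX := drift_l2proc i hX sr; have dY := drift_l2proc i hY rt.
have td := tint_concat sr rt dX dY.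
have EIJ : {ae P, forall w, X r w i 0 = x w i 0 + \int[lam]_(u in `[s, r]) drift P A B X u w i 0 + I w /\
    y w = X r w} by apply: filterS2 EI yX.
apply: filterS3 EIJ td EJ => w [E1 E4] E3 E2.
rewrite ZY// E2 E4 E1.
have -> : \int[lam]_(u in `[s, t]) drift P A B (vconcat r X Y) u w i 0 =
  tint s t (concat r (fun u w => drift P A B X u w i 0) (fun u w => drift P A B Y u w i 0)) w.
  by apply: eq_Rintegral => u _; exact: driftE.
rewrite E3 /tint; ring.
Qed.

Variable Phi : R -> R -> (T -> 'cV[R]_d) -> (T -> 'cV[R]_d).
Hypothesis hPhi : ms_rds_generated P W A B C D Phi.

Lemma phi_space s t x : s <= t -> ms_space P W s x -> ms_space P W t (Phi t s x).
Proof. by move=> st hx; have [[X hX] h] := hPhi hx; have [] := h X hX t st. Qed.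

Lemma phi_sol s t x X : s <= t -> ms_space P W s x -> mf_sde_solution P W A B C D s x X ->
  {ae P, forall w, Phi t s x w = X t w}.
Proof. by move=> st hx hX; have [_ h] := hPhi hx; have [] := h X hX t st. Qed.

Lemma phi_comb s t c x y : s <= t -> ms_space P W s x -> ms_space P W s y ->
  {ae P, forall w, Phi t s (fun w => c *: x w + y w) w = c *: Phi t s x w + Phi t s y w}.
Proof.
move=> st hx hy; have [[X hX] _] := hPhi hx; have [[Y hY] _] := hPhi hy.
have h1 := phi_sol st hx hX; have h2 := phi_sol st hy hY.
have h3 := phi_sol st (ms_space_comb Pc hW c hx hy) (sol_comb c hX hY).
by apply: filterS3 h1 h2 h3 => w -> -> ->.
Qed.

Lemma phi_cocycle s r t x : s <= r -> r <= t -> ms_space P W s x ->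
  {ae P, forall w, Phi t r (Phi r s x) w = Phi t s x w}.
Proof.
move=> sr rt hx; have [[X hX] _] := hPhi hx.
have hr := phi_space sr hx.
have [[Y hY] _] := hPhi hr.
have e1 := phi_sol sr hx hX.
have hZ := sol_concat sr hX hY e1.
have e2 := phi_sol (le_trans sr rt) hx hZ.
have e3 := phi_sol rt hr hY.
have [e|tr] := eqVneq r t.
  subst t.
  have [_ _ _ e4 _] := hY.
  by apply: filterS3 e3 e4 e1 => w -> ->.
have lt : r < t by rewrite lt_neqAle tr.
apply: filterS2 e2 e3 => w -> ->.
by rewrite /vconcat leNgt lt.
Qed.

Lemma phi_id s x : ms_space P W s x -> {ae P, forall w, Phi s s x w = x w}.
Proof.
move=> hx; have [[X hX] _] := hPhi hx.
have e1 := phi_sol (lexx s) hx hX; have [_ _ _ e2 _] := hX.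
by apply: filterS2 e1 e2 => w -> ->.
Qed.

(** * Growth of the flow *)

Local Notation N := (@ms_norm _ T R P d).

Let bound0 : 0 <= 2 * m. Proof. by rewrite mulr_ge0. Qed.

(** The Gram matrix of the 2 d variables (x, E x). *)
Definition sgram (x : T -> 'cV[R]_d) (k l : idx) : R :=
  gram P (stack (fun _ => x)) 0 k l.

Lemma gram_stack X u k l : gram P (stack X) u k l = sgram (X u) k l.
Proof. by case: k => i; case: l. Qed.

Lemma sgram_ll x i j : sgram x (inl i) (inl j) = ip P (fun w => x w i 0) (fun w => x w j 0).
Proof. by []. Qed.

Lemma sgram_rr x i j : sgram x (inr i) (inr j) = mean P x i 0 * mean P x j 0.
Proof. exact: ip_cst. Qed.

Lemma sgram_lr t x i j : ms_space P W t x ->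
  sgram x (inl i) (inr j) = mean P x i 0 * mean P x j 0.
Proof.
move=> hx; have sx := ms_space_sqint Pc hW i hx.
transitivity (ip P (fun w : T => mean P x j 0 * (cst 1) w) (fun w => x w i 0)).
  rewrite /sgram /gram ipC; congr (ip P _ _).
  by apply/funext => w /=; rewrite mulr1.
rewrite ipZl//; last exact: sqint_cst.
by rewrite -mean_ip mulrC.
Qed.

Lemma sgram_sym x k l : sgram x k l = sgram x l k.
Proof. exact: ipC. Qed.

Lemma mean_ae t (x y : T -> 'cV[R]_d) : ms_space P W t x -> ms_space P W t y ->
  {ae P, forall w, x w = y w} -> mean P x = mean P y.
Proof.
move=> hx hy xy; apply/colP => i; rewrite !mean_ip; apply: ip_ae.
- exact: measurable_cst.
- exact: measurable_cst.
- exact: (ms_space_measurable Pc hW hx).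
- exact: (ms_space_measurable Pc hW hy).
- exact: aeW.
- by apply: filterS xy => w ->.
Qed.

Lemma sgram_ae t (x y : T -> 'cV[R]_d) : ms_space P W t x -> ms_space P W t y ->
  {ae P, forall w, x w = y w} -> sgram x = sgram y.
Proof.
move=> hx hy xy; apply/funext => k; apply/funext => l.
have mm := mean_ae hx hy xy.
have ms (z : T -> 'cV[R]_d) j : ms_space P W t z -> measurable_fun setT (stack (fun _ => z) j 0).
  move=> hz; case: j => j; last exact: measurable_cst.
  exact: (ms_space_measurable Pc hW hz).
have ae j : {ae P, forall w, stack (fun _ => x) j 0 w = stack (fun _ => y) j 0 w}.
  case: j => j /=; first by apply: filterS xy => w ->.
  by rewrite mm; exact: aeW.
by apply: ip_ae; [exact: ms|exact: ms|exact: ms|exact: ms|exact: ae|exact: ae].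
Qed.

Lemma mean_sq_le t (x : T -> 'cV[R]_d) i : ms_space P W t x ->
  mean P x i 0 * mean P x i 0 <= ip P (fun w => x w i 0) (fun w => x w i 0).
Proof.
move=> hx; have sx := ms_space_sqint Pc hW i hx.
rewrite -expr2 -real_normK ?num_real// -[leRHS]sqr_nrm.
rewrite ler_sqr ?nnegrE ?nrm_ge0// mean_ip.
apply: le_trans (ip_CS (sqint_cst P 1) sx) _.
by rewrite {1}/nrm ip_cst mulr1 sqrtr1 mul1r.
Qed.

(** Up to a factor 2 the energy of (X, E X) is the squared norm of X, because
    |E X| is at most the norm of X. *)
Lemma energy_stack (X : R -> T -> 'cV[R]_d) u : ms_space P W u (X u) ->
  N (X u) ^+ 2 <= energy P (stack X) u <= 2 * N (X u) ^+ 2.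
Proof.
move=> hx; rewrite (ms_norm_sq (fun i => ms_space_sqint Pc hW i hx)).
rewrite /energy big_sumType/=; apply/andP; split.
  by rewrite lerDl; apply: sumr_ge0 => i _; exact: ip_ge0.
rewrite mulr_natl mulr2n lerD2l; apply: ler_sum => i _.
by rewrite gram_stack sgram_rr; exact: mean_sq_le hx.
Qed.

Let phi_linear s t x X : s <= t -> mf_sde_solution P W A B C D s x X ->
  linear_sde P W (drift_coef) (diff_coef) s t (stack X).
Proof. by move=> st hX; exact: (sol_linear_sde hX st). Qed.

Definition small_time : R := (4 * @expansion_const R idx (2 * m))^-1.

Lemma expansion_const_ge1 : 1 <= @expansion_const R idx (2 * m).
Proof. by rewrite /expansion_const lerDr !mulr_ge0 ?sqr_ge0 ?addr_ge0 ?(ltW (wvar_gt0))// ler0n. Qed.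

Lemma small_time_gt0 : 0 < small_time.
Proof. by rewrite invr_gt0; have := expansion_const_ge1; lra. Qed.

Definition small_const : R := Num.sqrt (2 * d%:R) * @step_const R idx (2 * m).

Lemma small_const_ge0 : 0 <= small_const.
Proof. by rewrite mulr_ge0// sqrtr_ge0. Qed.

(** Over a short time the flow displaces a vector by O(sqrt (t - s)), the order of
    an increment of W. *)
Lemma phi_small s t x : s <= t -> t - s <= small_time -> ms_space P W s x ->
  N (fun w => (-1) *: x w + Phi t s x w) <= small_const * Num.sqrt (t - s) * N x.
Proof.
move=> st sm hx; have [[X hX] _] := hPhi hx.
have hl := phi_linear st hX.
have hXs := sol_space hX (lexx s); have hXt := sol_space hX st.
have hxt := ms_space_mono Pc hW st hx.
have hPt := phi_space st hx.
have hst := ms_space_mono Pc hW st hXs.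
have -> : N (fun w => (-1) *: x w + Phi t s x w) = N (fun w => (-1) *: X s w + X t w).
  apply: ms_norm_ae.
  - exact: (ms_space_measurable Pc hW (ms_space_comb Pc hW (-1) hxt hPt)).
  - exact: (ms_space_measurable Pc hW (ms_space_comb Pc hW (-1) hst hXt)).
  - by apply: filterS2 (phi_sol st hx hX) (sol_start hX) => w -> ->.
have -> : N x = N (X s).
  apply: ms_norm_ae.
  - exact: (ms_space_measurable Pc hW hx).
  - exact: (ms_space_measurable Pc hW hXs).
  - by apply: filterS (sol_start hX) => w ->.
have q0 : 0 <= Num.sqrt (t - s) := sqrtr_ge0 _.
have k0 : 0 <= @step_const R idx (2 * m) := sqrtr_ge0 _.
have N0 := ms_norm_ge0 P (X s).
rewrite -ler_sqr ?nnegrE ?ms_norm_ge0 ?mulr_ge0// ?small_const_ge0//.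
have sdiff i := ms_space_sqint Pc hW i (ms_space_comb Pc hW (-1) hst hXt).
rewrite (ms_norm_sq sdiff).
have one i : ip P (fun w => ((-1) *: X s w + X t w) i 0) (fun w => ((-1) *: X s w + X t w) i 0) <=
   2 * (@step_const R idx (2 * m) * Num.sqrt (t - s) * N (X s)) ^+ 2.
  have tt : s <= t <= t by rewrite st lexx.
  have h := increment_nrm Pc hW bound0 (drift_coef_measurable)
    (diff_coef_measurable) (drift_coef_le) (diff_coef_le) st hl sm (inl i) tt.
  have -> : (fun w => ((-1) *: X s w + X t w) i 0) =
      (fun w => stack X (inl i) t w - stack X (inl i) s w).
    by apply/funext => w; rewrite !mxE/=; ring.
  rewrite -sqr_nrm.
  apply: (@le_trans _ _ ((@step_const R idx (2 * m) * Num.sqrt (t - s) * Num.sqrt (energy P (stack X) s)) ^+ 2)).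
    by rewrite ler_sqr ?nnegrE ?nrm_ge0// !mulr_ge0// sqrtr_ge0.
  rewrite !exprMn [Num.sqrt (energy _ _ _) ^+ 2]sqr_sqrtr ?energy_ge0//.
  have /andP[_ h2] := energy_stack (u := s) hXs.
  rewrite [leRHS]mulrCA; apply: ler_wpM2l => //.
  by rewrite mulr_ge0 ?sqr_ge0.
apply: (@le_trans _ _ (\sum_(i < d) 2 * (@step_const R idx (2 * m) * Num.sqrt (t - s) * N (X s)) ^+ 2)).
  by apply: ler_sum => i _; exact: one.
rewrite sumr_const card_ord -[leLHS]mulr_natr /small_const !exprMn (sqr_sqrtr (a := 2 * _)) ?mulr_ge0//.
by rewrite le_eqVlt; apply/orP; left; apply/eqP; ring.
Qed.

Lemma phi_norm_comb s t c x y : s <= t -> ms_space P W s x -> ms_space P W s y ->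
  N (Phi t s (fun w => c *: x w + y w)) <= `|c| * N (Phi t s x) + N (Phi t s y).
Proof.
move=> st hx hy.
have hPx := phi_space st hx; have hPy := phi_space st hy.
have hc := ms_space_comb Pc hW c hx hy.
rewrite (@ms_norm_ae _ _ _ P _ _ (fun w => c *: Phi t s x w + Phi t s y w)).
- exact: (ms_norm_comb Pc hW c hPx hPy).
- exact: (ms_space_measurable Pc hW (phi_space st hc)).
- exact: (ms_space_measurable Pc hW (ms_space_comb Pc hW c hPx hPy)).
- exact: (phi_comb c st hx hy).
Qed.

Lemma phi_cocycle_norm s r t x : s <= r -> r <= t -> ms_space P W s x ->
  N (Phi t r (Phi r s x)) = N (Phi t s x).
Proof.
move=> sr rt hx; apply: ms_norm_ae.
- exact: (ms_space_measurable Pc hW (phi_space rt (phi_space sr hx))).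
- exact: (ms_space_measurable Pc hW (phi_space (le_trans sr rt) hx)).
- exact: (phi_cocycle sr rt hx).
Qed.

Definition half_time : R := Num.min small_time ((2 * (small_const + 1))^-1 ^+ 2).

Lemma half_time_gt0 : 0 < half_time.
Proof.
rewrite lt_min small_time_gt0 exprn_gt0// invr_gt0.
by have := small_const_ge0; lra.
Qed.

(** On a time scale on which the displacement is at most half of the norm, the norm
    changes at most by a factor 2. *)
Lemma phi_half s t x : s <= t -> t - s <= half_time -> ms_space P W s x ->
  N x <= 2 * N (Phi t s x) /\ N (Phi t s x) <= 2 * N x.
Proof.
move=> st; rewrite /half_time le_min => /andP[h1 h2] hx.
have h := phi_small st h1 hx.
have hxt := ms_space_mono Pc hW st hx.
have hPt := phi_space st hx.
have c0 := small_const_ge0.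
have N0 := ms_norm_ge0 P x.
have : Num.sqrt (t - s) <= (2 * (small_const + 1))^-1.
  rewrite -[leRHS]ger0_norm; last by rewrite invr_ge0; lra.
  by rewrite -sqrtr_sqr ler_sqrt// sqr_ge0.
move=> hq.
have hc : small_const * Num.sqrt (t - s) <= 2^-1.
  apply: (@le_trans _ _ ((small_const + 1) * (2 * (small_const + 1))^-1)).
    apply: ler_pM => //; lra.
  by rewrite invfM mulrCA mulfV ?mulr1//; lra.
have hN : N (fun w => (-1) *: x w + Phi t s x w) <= 2^-1 * N x.
  by apply: le_trans h _; apply: ler_wpM2r.
have hd := ms_space_comb Pc hW (-1) hxt hPt.
split.
  have : N x <= N (fun w => (-1) *: x w + Phi t s x w) + N (Phi t s x).
    have := ms_norm_comb Pc hW (-1) hd hPt; rewrite normrN1 mul1r.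
    rewrite (_ : (fun w => _) = x)//; apply/funext => w.
    by rewrite scalerDr scalerA mulrNN mulr1 scale1r scaleN1r addrNK.
  by lra.
have : N (Phi t s x) <= N x + N (fun w => (-1) *: x w + Phi t s x w).
  have := ms_norm_comb Pc hW 1 hxt hd; rewrite normr1 mul1r.
  rewrite (_ : (fun w => _) = Phi t s x)//; apply/funext => w.
  by rewrite scale1r scaleN1r addrA subrr add0r.
by lra.
Qed.

Lemma phi_pow2 n s t x : s <= t -> t - s <= n%:R * half_time -> ms_space P W s x ->
  N x <= 2 ^+ n * N (Phi t s x) /\ N (Phi t s x) <= 2 ^+ n * N x.
Proof.
elim: n s x => [|n ih] s x st h hx.
  have e : s = t by apply/eqP; rewrite eq_le st; move: h; rewrite mul0r; lra.
  have h0 : t - s <= half_time by rewrite e subrr ltW// half_time_gt0.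
  rewrite expr0 !mul1r; subst t.
  have -> : N (Phi s s x) = N x; last by [].
  apply: ms_norm_ae.
  - exact: (ms_space_measurable Pc hW (phi_space st hx)).
  - exact: (ms_space_measurable Pc hW hx).
  - exact: (phi_id hx).
pose r := Num.min t (s + half_time).
have hh := half_time_gt0.
have sr : s <= r by rewrite le_min st; lra.
have rt : r <= t by rewrite ge_min lexx.
have rs : r - s <= half_time.
  have : r <= s + half_time by rewrite ge_min lexx orbT.
  lra.
have tr : t - r <= n%:R * half_time.
  have nh : 0 <= n%:R * half_time by rewrite mulr_ge0// ltW.
  rewrite /r; case: (leP t (s + half_time)) => ht; first by lra.
  by move: h; rewrite -addn1 natrD mulrDl mul1r; lra.
have [a1 a2] := phi_half sr rs hx.
have [b1 b2] := ih r _ rt tr (phi_space sr hx).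
move: b1 b2; rewrite (phi_cocycle_norm sr rt hx) exprS => b1 b2.
split; first by lra.
apply: le_trans b2 _; rewrite mulrAC -[X in X <= _]mulrC.
by apply: ler_wpM2r => //; rewrite exprn_ge0.
Qed.

Definition growth_rate : R := ln 2 / half_time.

Lemma growth_rate_ge0 : 0 <= growth_rate.
Proof. by rewrite divr_ge0 ?(ltW half_time_gt0)// ln_ge0// ler1n. Qed.

(** Iterating the factor 2 along steps of fixed length gives exponential bounds in
    both directions; in particular the flow is injective. *)
Lemma phi_growth s t x : s <= t -> ms_space P W s x ->
  N x <= 2 * expR (growth_rate * (t - s)) * N (Phi t s x) /\
  N (Phi t s x) <= 2 * expR (growth_rate * (t - s)) * N x.
Proof.
move=> st hx.
have ts0 : 0 <= t - s by rewrite subr_ge0.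
have [n [n1 n2]] := nat_steps ts0 half_time_gt0.
have [h1 h2] := phi_pow2 st n1 hx.
have l0 : 0 < ln (2 : R) by rewrite ln_gt0// ltr1n.
have e : 2 ^+ n <= 2 * expR (growth_rate * (t - s)).
  have -> : (2 : R) ^+ n = expR (n%:R * ln 2).
    by rewrite mulrC expRM_natr lnK// posrE.
  rewrite -[X in _ <= X * _](@lnK _ (2 : R)) ?posrE// -expRD ler_expR.
  rewrite /growth_rate.
  have -> : ln 2 + ln 2 / half_time * (t - s) = ln 2 * ((t - s) + half_time) / half_time.
    by field; rewrite gt_eqF// half_time_gt0.
  rewrite ler_pdivlMr ?half_time_gt0//.
  by rewrite [leLHS]mulrAC [leLHS]mulrC ler_pM2l.
split; [apply: le_trans h1 _|apply: le_trans h2 _]; apply: ler_wpM2r => //; exact: ms_norm_ge0.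
Qed.

(** * Second moments determine growth *)

Section MomentDetermination.
Variables (I : finType) (c : I -> R) (x : I -> T -> 'cV[R]_d) (s : R).
Hypothesis hx : forall i, ms_space P W s (x i).
Hypothesis dep : forall k l, \sum_i c i * sgram (x i) k l = 0.

(** A linear relation between the Gram matrices at time s persists, because it
    solves a linear differential equation with initial value zero.  In discrete form:
    over n equal steps the errors sum up to O(n (1 / n)^(3/2)), which tends to 0. *)
Lemma phi_gram_zero t k l : s <= t -> \sum_i c i * sgram (Phi t s (x i)) k l = 0.
Proof.
move=> st.
pose Z u k l := \sum_i c i * sgram (Phi u s (x i)) k l.
pose n : R := #|{: idx}|%:R.
pose a := n * n * flow_const (2 * m).
pose b := rem_const idx (2 * m).
pose E := \sum_i `|c i| * (2 * (2 * expR (growth_rate * (t - s)) * N (x i)) ^+ 2).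
have a0 : 0 <= a by rewrite !mulr_ge0 ?ler0n ?flow_const_ge0.
have sc0 : 0 <= @step_const R idx (2 * m) := sqrtr_ge0 _.
have b0 : 0 <= b.
  have w0 : 0 <= @wvar R by exact/ltW/wvar_gt0.
  by rewrite /b /rem_const !mulr_ge0 ?ler0n// !addr_ge0// !mulr_ge0 ?ler0n ?sqr_ge0 ?addr_ge0.
have E0 : 0 <= E.
  by apply: sumr_ge0 => i _; apply: mulr_ge0 => //; apply: mulr_ge0 => //; exact: sqr_ge0.
have step u r : s <= u -> u <= r -> r <= t -> r - u <= small_time ->
  znorm (Z r) <= (1 + a * (r - u)) * znorm (Z u) + b * (r - u) * Num.sqrt (r - u) * E.
  move=> su ur rt sm.
  have hy i := phi_space su (hx i).
  have /choice[X hX] : forall i, exists X, mf_sde_solution P W A B C D u (Phi u s (x i)) X.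
    by move=> i; have [] := hPhi (hy i).
  have hl i := phi_linear ur (hX i).
  have := gram_step Pc hW bound0 (drift_coef_measurable)
    (diff_coef_measurable) (drift_coef_le) (diff_coef_le) c ur sm hl.
  have -> : (fun k l => \sum_i c i * gram P (stack (X i)) r k l) = Z r.
    apply/funext => k'; apply/funext => l'; apply: eq_bigr => i _; congr (_ * _).
    rewrite gram_stack.
    have e1 := phi_sol ur (hy i) (hX i).
    have e2 := phi_cocycle su ur (hx i).
    rewrite (@sgram_ae r (X i r) (Phi r s (x i)))//.
    - exact: (sol_space (hX i) ur).
    - exact: (phi_space (le_trans su ur) (hx i)).
    - by apply: filterS2 e1 e2 => w -> ->.
  have eu i : sgram (X i u) = sgram (Phi u s (x i)).
    apply: (@sgram_ae u); [exact: (sol_space (hX i) (lexx u))|exact: hy|exact: (sol_start (hX i))].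
  have -> : (fun k l => \sum_i c i * gram P (stack (X i)) u k l) = Z u.
    by apply/funext => k'; apply/funext => l'; apply: eq_bigr => i _; rewrite gram_stack eu.
  move=> h; apply: le_trans h _; rewrite lerD2l; apply: ler_wpM2l.
    by apply: mulr_ge0; [apply: mulr_ge0 => //; rewrite subr_ge0|exact: sqrtr_ge0].
  apply: ler_sum => i _; apply: ler_wpM2l => //.
  have hXu := sol_space (hX i) (lexx u).
  have /andP[_ h2] := energy_stack (u := u) hXu.
  apply: le_trans h2 _; apply: ler_wpM2l => //.
  have -> : N (X i u) = N (Phi u s (x i)).
    apply: ms_norm_ae; [exact: (ms_space_measurable Pc hW hXu)|exact: (ms_space_measurable Pc hW (hy i))|].
    exact: (sol_start (hX i)).
  rewrite ler_sqr ?nnegrE ?ms_norm_ge0 ?mulr_ge0 ?expR_ge0 ?ms_norm_ge0//.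
  have [_ g2] := phi_growth su (hx i).
  apply: le_trans g2 _; apply: ler_wpM2r; first exact: ms_norm_ge0.
  apply: ler_wpM2l => //; rewrite ler_expR; apply: ler_wpM2l; first exact: growth_rate_ge0.
  by have := le_trans ur rt; lra.
clearbody a b E.
have Zs : znorm (Z s) = 0.
  rewrite /znorm big1// => k' _; rewrite big1// => l' _; apply/normr0P/eqP.
  rewrite /Z -[RHS](dep k' l'); apply: eq_bigr => i _; congr (_ * _).
  by rewrite (@sgram_ae s _ (x i))//; [exact: (phi_space (lexx s) (hx i))|exact: (phi_id (hx i))].
suff Zt : znorm (Z t) <= 0.
  have := le_trans (znorm_ge (Z t) k l) Zt.
  by rewrite normr_le0 => /eqP.
pose Cst := b * (t - s) * E * expR (a * (t - s)).
have ts0 : 0 <= t - s by rewrite subr_ge0.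
have Cst0 : 0 <= Cst by rewrite !mulr_ge0 ?expR_ge0.
have bound n' : (t - s) / n'.+1%:R <= small_time ->
   znorm (Z t) <= Cst * Num.sqrt ((t - s) / n'.+1%:R).
  set h := (t - s) / n'.+1%:R => sm.
  have h0 : 0 <= h by rewrite divr_ge0.
  have nh : n'.+1%:R * h = t - s by rewrite /h mulrCA mulfV ?mulr1// pnatr_eq0.
  have tE : t = s + n'.+1%:R * h by rewrite nh addrC subrK.
  have := @discrete_gronwall R (fun k => znorm (Z (s + k%:R * h))) (a * h)
    (b * h * Num.sqrt h * E) n'.+1.
  rewrite -tE mul0r addr0 Zs => g.
  have {}g : znorm (Z t) <= n'.+1%:R * (b * h * Num.sqrt h * E) * (1 + a * h) ^+ n'.+1.
    apply: g => //.
    - exact: mulr_ge0.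
    - by rewrite !mulr_ge0 ?sqrtr_ge0.
    move=> k' kn.
    have e : s + k'.+1%:R * h - (s + k'%:R * h) = h by rewrite -natr1; ring.
    have := @step (s + k'%:R * h) (s + k'.+1%:R * h).
    rewrite e; apply => //.
    - by rewrite lerDl mulr_ge0.
    - by rewrite -subr_ge0 e.
    - by rewrite tE lerD2l ler_wpM2r// ler_nat.
  apply: le_trans g _.
  have -> : n'.+1%:R * (b * h * Num.sqrt h * E) * (1 + a * h) ^+ n'.+1 =
     b * (n'.+1%:R * h) * E * Num.sqrt h * (1 + a * h) ^+ n'.+1 by ring.
  have -> : Cst * Num.sqrt h = b * (t - s) * E * Num.sqrt h * expR (a * (t - s)).
    by rewrite /Cst; ring.
  rewrite nh; apply: ler_wpM2l; first by rewrite !mulr_ge0 ?sqrtr_ge0.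
  apply: le_trans (onem_expn_le _ (mulr_ge0 a0 h0)) _.
  by rewrite mulrCA nh.
apply/ler_addgt0Pl => eps e0; rewrite addr0.
pose y := Num.max ((t - s) / small_time) ((t - s) * ((Cst + 1) / eps) ^+ 2).
have y0 : 0 <= y by rewrite le_max divr_ge0// ltW// small_time_gt0.
have /andP[_ ny] := truncn_itv y0.
set n' := Num.truncn y in ny.
have np : (0 : R) < n'.+1%:R by rewrite ltr0n.
have y1 : (t - s) / small_time <= n'.+1%:R.
  by apply: le_trans (ltW ny); rewrite le_max lexx.
have y2 : (t - s) * ((Cst + 1) / eps) ^+ 2 <= n'.+1%:R.
  by apply: le_trans (ltW ny); rewrite le_max lexx orbT.
apply: le_trans (bound n' _) _.
  by rewrite ler_pdivrMr// mulrC -ler_pdivrMr// small_time_gt0.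
have C1 : 0 < Cst + 1 by lra.
have -> : eps = (Cst + 1) * (eps / (Cst + 1)) by field; rewrite gt_eqF.
apply: ler_pM => //; [lra|].
rewrite -[leRHS]ger0_norm; last by apply: divr_ge0; exact: ltW.
rewrite -sqrtr_sqr ler_sqrt ?sqr_ge0//.
rewrite ler_pdivrMr// mulrC -ler_pdivrMr ?exprn_gt0 ?divr_gt0//.
by rewrite -exprVn invf_div.
Qed.

(** The squared norm is the trace of the upper left block of the Gram matrix. *)
Lemma phi_moment t : s <= t -> \sum_i c i * N (Phi t s (x i)) ^+ 2 = 0.
Proof.
move=> st.
have -> : \sum_i c i * N (Phi t s (x i)) ^+ 2 =
   \sum_i \sum_(j < d) c i * sgram (Phi t s (x i)) (inl j) (inl j).
  apply: eq_bigr => i _; rewrite -mulr_sumr; congr (_ * _).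
  have hp := phi_space st (hx i).
  by rewrite (ms_norm_sq (fun j => ms_space_sqint Pc hW j hp)).
rewrite exchange_big/= big1// => j _; exact: phi_gram_zero.
Qed.

End MomentDetermination.

(** * Realizing given moments at another time *)

(** Normalized increments of W over the disjoint unit intervals before time t. *)
Lemma white_noise (t : R) : exists xi : nat -> T -> R,
  [/\ forall j, L2at P W t (xi j), forall j, ip P (cst 1) (xi j) = 0 &
      forall i j, ip P (xi i) (xi j) = (i == j)%:R].
Proof.
have w0 := @wvar_gt0 R.
pose a j : R := t - j.+1%:R; pose b j : R := t - j%:R.
have ab j : a j <= b j by rewrite /a /b lerD2l lerN2 ler_nat.
have bt j : b j <= t by rewrite /b gerBl.
have ba j : b j - a j = 1 by rewrite /a /b -natr1; ring.
pose dW j := increment W (a j) (b j).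
have LdW j : L2at P W (b j) (dW j).
  split; first exact: adapted_increment.
  by have [] := increment_sqint hW (ab j).
have sD j := L2at_sqint Pc hW (LdW j).
have cE j : (fun w => (cst 1) w * dW j w) = dW j by apply/funext => w; rewrite mul1r.
have orth i j : (i < j)%N -> ip P (dW j) (dW i) = 0.
  move=> ij; rewrite -(cE i); apply: (step_term_orth Pc hW (ab i)); first exact: L2at_cst.
  apply: L2at_mono (LdW j); rewrite /a /b lerD2l lerN2 ler_nat//.
exists (fun j w => (Num.sqrt wvar)^-1 * dW j w); split.
- by move=> j; apply: L2atZ; [exact: Pc|exact: hW|exact: L2at_mono (bt j) (LdW j)].
- move=> j; rewrite ipZr//; last exact: sqint_cst.
  rewrite -(cE j) (step_term_orth Pc hW (ab j)) ?mulr0//; exact: L2at_cst.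
- move=> i j; rewrite ipZl//; last exact: sqintZ.
  rewrite ipZr//; have [<-|ij] := eqVneq i j.
    rewrite /dW increment_ip// ba mulr1 mulrA -invfM -expr2 sqr_sqrtr ?ltW// mulVf// gt_eqF//.
  have [h|h] := ltnP i j; first by rewrite ipC orth// !mulr0.
  by rewrite orth ?mulr0// ltn_neqAle eq_sym ij h.
Qed.

(** If L L^T is the covariance matrix of x, then E x + L xi has the required
    moments for every white noise xi known at time t. *)
Lemma realization s t (x : T -> 'cV[R]_d) : ms_space P W s x ->
  exists y, ms_space P W t y /\ forall k l, sgram y k l = sgram x k l.
Proof.
move=> hx.
have sx i := ms_space_sqint Pc hW i hx.
pose mu (i : 'I_d) : R := mean P x i 0.
pose xc i w := x w i 0 - mu i.
have sxc i : sqint P (xc i).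
  have := sqintD (sx i) (sqint_cst P (- mu i)).
  by congr (sqint P _).
have one_x i : ip P (cst 1) (fun w => x w i 0) = mu i by rewrite /mu mean_ip.
have xcE i j : ip P (xc i) (xc j) = ip P (fun w => x w i 0) (fun w => x w j 0) - mu i * mu j.
  have e k : xc k = (fun w => x w k 0 + (- mu k) * (cst 1) w).
    by apply/funext => w; rewrite /xc mulr1.
  have s1 k := sqintZ (- mu k) (sqint_cst P 1).
  rewrite !e ipDl//; last by apply: sqintD.
  rewrite !ipDr// !ipZl//; try exact: sqint_cst.
  rewrite !ipZr//; try exact: sqint_cst.
  by rewrite ip_cst [ip P _ (cst 1)]ipC !one_x; ring.
pose Q := \matrix_(i < d, j < d) ip P (xc i) (xc j).
have symQ : Q^T = Q by apply/matrixP => i j; rewrite !mxE ipC.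
have psdQ (u : 'cV[R]_d) : 0 <= (u^T *m Q *m u) 0 0.
  have -> : (u^T *m Q *m u) 0 0 = ip P (fun w => \sum_i u i 0 * xc i w) (fun w => \sum_i u i 0 * xc i w).
    rewrite ip_suml; last by apply: sqint_sum => i; exact: sqintZ.
      rewrite mxE; under eq_bigr do rewrite mxE mulr_suml.
      rewrite exchange_big/=; apply: eq_bigr => i _; rewrite ip_sumr; last exact: sqintZ.
        apply: eq_bigr => j _; rewrite !mxE ipZl//; last exact: sqintZ.
        by rewrite ipZr//; ring.
      by move=> j; exact: sqintZ.
    by move=> i; exact: sqintZ.
  exact: ip_ge0.
have [L hL] := psd_factor symQ psdQ.
have [xi [hxi xi1 xixi]] := white_noise t.
have sxi j := L2at_sqint Pc hW (hxi j).
pose y w : 'cV[R]_d := \col_i (mu i + \sum_(k < d) L i k * xi k w).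
have yE i : (fun w => y w i 0) = (fun w => cst (mu i) w + \sum_(k < d) L i k * xi k w).
  by apply/funext => w; rewrite mxE.
have hL2 i : L2at P W t (fun w => \sum_(k < d) L i k * xi k w).
  by apply: (L2at_sum Pc hW) => k; apply: (L2atZ Pc hW).
have sL i := L2at_sqint Pc hW (hL2 i).
have hy : ms_space P W t y.
  by apply/(ms_spaceP Pc hW) => i; rewrite yE; apply: (L2atD Pc hW) => //; exact: L2at_cst.
have one_L i : ip P (cst 1) (fun w => \sum_(k < d) L i k * xi k w) = 0.
  rewrite ip_sumr; [|by move=> k; exact: sqintZ|exact: sqint_cst].
  by rewrite big1// => k _; rewrite ipZr ?xi1 ?mulr0//; exact: sqint_cst.
have cst_L c i : ip P (cst c) (fun w => \sum_(k < d) L i k * xi k w) = 0.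
  have -> : cst c = (fun w : T => c * (cst 1) w) by apply/funext => w; rewrite mulr1.
  by rewrite ipZl ?one_L ?mulr0//; exact: sqint_cst.
have my i : mean P y i 0 = mu i.
  rewrite mean_ip yE ipDr//; try exact: sqint_cst.
  by rewrite ip_cst one_L mul1r addr0.
have yy i j : ip P (fun w => y w i 0) (fun w => y w j 0) = ip P (fun w => x w i 0) (fun w => x w j 0).
  rewrite !yE ipDl//; [|exact: sqint_cst|by apply: sqintD => //; exact: sqint_cst].
  rewrite !ipDr//; try exact: sqint_cst.
  rewrite [X in _ + X + _](cst_L (mu i) j) [X in _ + (X + _)]ipC [X in _ + (X + _)](cst_L (mu j) i) [X in X + _ + _](ip_cst P (mu i) (mu j)).
  have -> : ip P (fun w => \sum_(k < d) L i k * xi k w) (fun w => \sum_(k < d) L j k * xi k w) = Q i j.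
    rewrite hL mxE ip_suml//; last by move=> k; exact: sqintZ.
    apply: eq_bigr => k _; rewrite mxE ip_sumr//; [|by move=> l; exact: sqintZ|exact: sqintZ].
    rewrite (bigD1 k)//= big1 ?addr0.
      by rewrite ipZl//; [rewrite ipZr// xixi eqxx mulr1|exact: sqintZ].
    move=> l lk; rewrite ipZl//; last exact: sqintZ.
    rewrite ipZr// xixi.
    by rewrite (_ : (nat_of_ord k == nat_of_ord l) = false) ?mulr0// eq_sym; apply/negbTE.
  by rewrite mxE xcE; ring.
exists y; split => // -[i|i] [j|j].
- by rewrite !sgram_ll yy.
- by rewrite (sgram_lr i j hy) (sgram_lr i j hx) !my.
- by rewrite sgram_sym (sgram_sym x) (sgram_lr j i hy) (sgram_lr j i hx) !my.
- by rewrite !sgram_rr !my.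
Qed.

(** * Slow vectors and exponential dichotomies *)

Local Notation E := (ms_space P W (d := d)).
Local Notation Z := (ms_zero P W (d := d)).
Local Notation L := growth_rate.

Let N0 X : 0 <= N X := ms_norm_ge0 P X.
Let combE t c X Y : E t X -> E t Y -> E t (fun w => c *: X w + Y w) :=
  fun hX hY => ms_space_comb Pc hW c hX hY.
Let monoE s t X : s <= t -> E s X -> E t X := fun st hX => ms_space_mono Pc hW st hX.
Let L0 : 0 <= L := growth_rate_ge0.

Let phi_add_le s t X Y : s <= t -> E s X -> E s Y ->
  N (Phi t s (fun w => X w + Y w)) <= N (Phi t s X) + N (Phi t s Y).
Proof.
move=> st hX hY; have := phi_norm_comb 1 st hX hY; rewrite normr1 mul1r.
by congr (N (Phi t s _) <= _); apply/funext => w; rewrite scale1r.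
Qed.

Let subE t X Y : E t X -> E t Y -> E t (fun w => X w - Y w).
Proof.
move=> hX hY; have := combE (-1) hY hX.
by congr (E t _); apply/funext => w; rewrite scaleN1r addrC.
Qed.

Let phi_sub_le s t X Y : s <= t -> E s X -> E s Y ->
  N (Phi t s (fun w => X w - Y w)) <= N (Phi t s X) + N (Phi t s Y).
Proof.
move=> st hX hY; have := phi_norm_comb (-1) st hY hX; rewrite normrN1 mul1r addrC.
by congr (N (Phi t s _) <= _); apply/funext => w; rewrite scaleN1r addrC.
Qed.

Let phi_le_add s t X Y : s <= t -> E s X -> E s Y ->
  N (Phi t s X) <= N (Phi t s Y) + N (Phi t s (fun w => X w - Y w)).
Proof.
move=> st hX hY; have := phi_add_le st hY (subE hX hY).
by congr (N (Phi t s _) <= _); apply/funext => w; rewrite addrC subrK.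
Qed.

Let norm_sub_le t X Y : E t X -> E t Y -> N (fun w => X w - Y w) <= N X + N Y.
Proof.
move=> hX hY; have := ms_norm_comb Pc hW (-1) hY hX; rewrite normrN1 mul1r addrC.
by congr (N _ <= _); apply/funext => w; rewrite scaleN1r addrC.
Qed.

Let norm_le_add t X Y : E t X -> E t Y -> N X <= N Y + N (fun w => X w - Y w).
Proof.
move=> hX hY; have := ms_norm_comb Pc hW 1 hY (subE hX hY); rewrite normr1 mul1r.
by congr (N _ <= _); apply/funext => w; rewrite scale1r addrC subrK.
Qed.

Let zeroP t X : Z t X <-> E t X /\ N X = 0 := ms_zeroP Pc hW t X.

Let zero_fun t : Z t (fun=> 0).
Proof.
split; last exact: aeW.
apply/(ms_spaceP Pc hW) => i.
have -> : (fun w : T => (0 : 'cV[R]_d) i 0) = cst 0 by apply/funext => w; rewrite mxE.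
exact: L2at_cst.
Qed.

(** In the presence of a dichotomy this is the stable space. *)
Definition slow (gamma s : R) : set (T -> 'cV[R]_d) :=
  [set X | E s X /\ exists K : R, forall t, s <= t -> N (Phi t s X) <= K * expR (gamma * (t - s))].

Lemma slow_mono g g' s : g <= g' -> slow g s `<=` slow g' s.
Proof.
move=> gg X [hX [K hK]]; split => //; exists K => t st.
apply: le_trans (hK t st) _; apply: ler_wpM2l.
  by have := hK s (lexx s); rewrite subrr mulr0 expR0 mulr1; exact: le_trans.
by rewrite ler_expR ler_wpM2r// subr_ge0.
Qed.

Lemma slow_forward g s t X : s <= t -> slow g s X -> slow g t (Phi t s X).
Proof.
move=> st [hX [K hK]]; split; first exact: phi_space.
exists (K * expR (g * (t - s))) => r tr.
rewrite (phi_cocycle_norm st tr hX) -mulrA -expRD -mulrDr.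
have -> : t - s + (r - t) = r - s by ring.
exact: hK (le_trans st tr).
Qed.

(** On the compact interval [s, t] the orbit is bounded by the growth estimate. *)
Lemma slow_backward g s t X : s <= t -> E s X -> slow g t (Phi t s X) -> slow g s X.
Proof.
move=> st hX [_ [K hK]]; split => //.
have K0 : 0 <= K.
  by have := hK t (lexx t); rewrite subrr mulr0 expR0 mulr1; exact: le_trans.
pose c := expR (`|g| * (t - s)).
exists (K * c + 2 * expR (L * (t - s)) * N X * c) => r sr.
have ts : 0 <= t - s by rewrite subr_ge0.
have rs : 0 <= r - s by rewrite subr_ge0.
have e2 : 0 <= 2 * expR (L * (t - s)) * N X by rewrite !mulr_ge0 ?expR_ge0.
have c0 : 0 <= c := expR_ge0 _.
have ng := ler_norm (- g); rewrite normrN in ng.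
have gn := ler_norm g.
have [tr|rt] := leP t r.
  rewrite -(phi_cocycle_norm st tr hX); apply: le_trans (hK r tr) _.
  apply: (@le_trans _ _ (K * c * expR (g * (r - s)))).
    rewrite -mulrA /c -expRD; apply: ler_wpM2l => //; rewrite ler_expR.
    have -> : g * (r - t) = g * (r - s) - g * (t - s) by ring.
    rewrite addrC lerD2r -mulNr; exact: ler_wpM2r.
  by apply: ler_wpM2r; [exact: expR_ge0|rewrite lerDl mulr_ge0].
have [_ h] := phi_growth sr hX; apply: le_trans h _.
apply: (@le_trans _ _ (2 * expR (L * (t - s)) * N X * c * expR (g * (r - s)))); last first.
  by apply: ler_wpM2r; [exact: expR_ge0|rewrite lerDr mulr_ge0].
rewrite -[leRHS]mulrA -[leLHS]mulr1; apply: ler_pM => //.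
- by rewrite !mulr_ge0 ?expR_ge0.
- apply: ler_wpM2r => //; apply: ler_wpM2l => //; rewrite ler_expR; apply: ler_wpM2l => //.
  by rewrite lerD2r ltW.
- rewrite /c -expRD -expR0 ler_expR.
  have : `|g| * (r - s) <= `|g| * (t - s) by apply: ler_wpM2l => //; rewrite lerD2r ltW.
  have : - g * (r - s) <= `|g| * (r - s) by exact: ler_wpM2r.
  lra.
Qed.

Section OneDichotomy.
Variables (g K al : R) (U S : R -> set (T -> 'cV[R]_d)).
Hypothesis K0 : 0 < K.
Hypothesis al0 : 0 < al.
Hypothesis US : forall t, ms_direct_sum P W t (U t) (S t).
Hypothesis hS : forall s t X, s <= t -> S s X ->
  N (Phi t s X) <= K * expR ((g - al) * (t - s)) * N X.
Hypothesis hU : forall s t X, s <= t -> U s X ->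
  K^-1 * expR ((g + al) * (t - s)) * N X <= N (Phi t s X).

Lemma dich_split s X : E s X -> exists u v, [/\ U s u, S s v, E s u, E s v & X = (fun w => u w + v w)].
Proof.
have [[UE _ _] [SE _ _] h _] := US s => /h[u [v [Uu Sv ->]]].
by exists u, v; split => //; [exact: UE|exact: SE].
Qed.

(** If the unstable part u of a slow vector were not zero, it would grow at least
    like e^((g + al) t), whereas it is the difference of two vectors that grow at
    most like e^(g t). *)
Lemma dich_slow s : S s = slow g s.
Proof.
have [[UE _ _] [SE SZ SC] split_ _] := US s.
apply/seteqP; split => X.
  move=> SX; split; first exact: SE.
  exists (K * N X) => t st; apply: le_trans (hS st SX) _.
  rewrite mulrAC; apply: ler_wpM2l; first by rewrite mulr_ge0// ltW.
  by rewrite ler_expR ler_wpM2r ?subr_ge0//; have := al0; lra.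
move=> [hX [K1 hK1]].
have [u [v [Uu Sv Eu Ev XE]]] := dich_split hX.
suff u0 : N u = 0.
  have Su : S s u by apply: SZ; apply/zeroP.
  have := SC 1 u v Su Sv.
  by rewrite (_ : (fun w => _) = X)// XE; apply/funext => w; rewrite scale1r.
apply/eqP; rewrite eq_le N0 andbT.
have Kp : 0 < K^-1 by rewrite invr_gt0.
rewrite -(pmulr_rle0 _ Kp).
apply: (@exp_bounded_le0 _ _ (K1 + K * N v) al) => // tau tau0.
have st : s <= s + tau by rewrite lerDl.
have e : s + tau - s = tau by rewrite addrC addKr.
have h1 := hU st Uu; have h2 := hS st Sv; have h3 := hK1 _ st.
rewrite e in h1 h2 h3.
have h4 : N (Phi (s + tau) s u) <= N (Phi (s + tau) s X) + N (Phi (s + tau) s v).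
  have := phi_sub_le st hX Ev.
  by congr (N (Phi (s + tau) s _) <= _); apply/funext => w; rewrite XE addrK.
have h5 : K * expR ((g - al) * tau) * N v <= K * N v * expR (g * tau).
  rewrite mulrAC; apply: ler_wpM2l; first by rewrite mulr_ge0// ltW.
  by rewrite ler_expR ler_wpM2r//; have := al0; lra.
rewrite -(ler_pM2r (expR_gt0 (g * tau))).
have -> : K^-1 * N u * expR (al * tau) * expR (g * tau) = K^-1 * expR ((g + al) * tau) * N u.
  by rewrite [in RHS]mulrDl expRD; ring.
have -> : (K1 + K * N v) * expR (g * tau) = K1 * expR (g * tau) + K * N v * expR (g * tau) by ring.
apply: le_trans h1 _; apply: le_trans h4 _; apply: lerD => //.
exact: le_trans h2 h5.
Qed.

(** At time s + tau the expanding vector u is larger than the contracting v by a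
    factor that is large for large tau, while the flow amplifies the difference u - v
    by a bounded factor only; hence u - v cannot be small compared with u.  Only
    estimates along the two orbits enter, so the lemma applies to vectors outside U
    and S. *)
Lemma dich_angle : exists M, [/\ 0 <= M &
  forall s u v, E s u -> E s v ->
   (forall t, s <= t -> K^-1 * expR ((g + al) * (t - s)) * N u <= N (Phi t s u)) ->
   (forall t, s <= t -> N (Phi t s v) <= K * expR ((g - al) * (t - s)) * N v) ->
   N u <= M * N (fun w => u w - v w)].
Proof.
(* Chosen so that e^(al tau) / K = K^-1 + (K + 1): the term K pays for the orbit of
   v, and 1 remains. *)
pose tau := ln (1 + K * (K + 1)) / al.
have KK : 0 <= K * (K + 1) by rewrite mulr_ge0 ?addr_ge0 ?(ltW K0).
have tau0 : 0 <= tau by rewrite divr_ge0 ?(ltW al0)// ln_ge0// lerDl.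
pose M := expR (- (g * tau)) * (K * expR ((g - al) * tau) + 2 * expR (L * tau)).
have M0 : 0 <= M.
  by rewrite mulr_ge0 ?expR_ge0// addr_ge0// mulr_ge0 ?expR_ge0// ltW.
exists M; split => // s u v Eu Ev hu hv.
have st : s <= s + tau by rewrite lerDl.
have e : s + tau - s = tau by rewrite addrC addKr.
have h1 := hu _ st; have h2 := hv _ st; rewrite e in h1 h2.
have Euv := subE Eu Ev.
have [_ h3] := phi_growth st Euv; rewrite e in h3.
have h4 := phi_le_add st Eu Ev.
have h5 : N v <= N u + N (fun w => u w - v w).
  have := norm_le_add Ev Eu; rewrite (_ : N (fun w => v w - u w) = N (fun w => u w - v w))//.
  apply/eqP; rewrite eq_le; apply/andP; split.
    have := ms_norm_comb Pc hW (-1) Euv (proj1 (zero_fun s)).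
    rewrite normrN1 mul1r ((zeroP s _).1 (zero_fun s)).2 addr0.
    by congr (N _ <= _); apply/funext => w; rewrite addr0 scaleN1r opprB.
  have := ms_norm_comb Pc hW (-1) (subE Ev Eu) (proj1 (zero_fun s)).
  rewrite normrN1 mul1r ((zeroP s _).1 (zero_fun s)).2 addr0.
  by congr (N _ <= _); apply/funext => w; rewrite addr0 scaleN1r opprB.
have eal : expR (al * tau) = 1 + K * (K + 1).
  rewrite /tau mulrC divfK ?gt_eqF// lnK// posrE ltr_pwDl//.
set nu := N u in h1 h4 h5 *; set de := N (fun w => u w - v w) in h3 h4 h5 *.
have de0 : 0 <= de := N0 _. have nu0 : 0 <= nu := N0 _.
have gp : 0 < expR (g * tau) := expR_gt0 _.
have k1 : K^-1 * expR ((g + al) * tau) = expR (g * tau) * (K^-1 + (K + 1)).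
  rewrite mulrDl expRD eal; field; exact: lt0r_neq0.
have k2 : K * expR ((g - al) * tau) <= expR (g * tau) * K.
  rewrite mulrC; apply: ler_wpM2r; first exact: ltW.
  by rewrite ler_expR ler_wpM2r//; have := al0; lra.
have k3 : K * expR ((g - al) * tau) * N v <= K * expR ((g - al) * tau) * nu + K * expR ((g - al) * tau) * de.
  rewrite -mulrDr; apply: ler_wpM2l => //; rewrite mulr_ge0 ?expR_ge0// ltW//.
have k4 : K * expR ((g - al) * tau) * nu <= expR (g * tau) * K * nu by exact: ler_wpM2r.
have k5 : 0 <= expR (g * tau) * K^-1 * nu by rewrite !mulr_ge0// ?invr_ge0 ltW.
have main : expR (g * tau) * nu <= (K * expR ((g - al) * tau) + 2 * expR (L * tau)) * de.
  move: h1; rewrite k1.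
  have -> : expR (g * tau) * (K^-1 + (K + 1)) * nu =
    expR (g * tau) * K^-1 * nu + expR (g * tau) * K * nu + expR (g * tau) * nu by ring.
  by rewrite mulrDl; lra.
by rewrite /M expRN -mulrA ler_pdivlMl.
Qed.

End OneDichotomy.

Local Notation ed := (exponential_dichotomy P W Phi).

Lemma ed_open g : ed g -> exists a, [/\ 0 < a &
  forall g', `|g' - g| < a -> ed g' /\ forall s, slow g' s = slow g s].
Proof.
move=> [K [al [U [S [K0 al0 US hS hU]]]]].
exists al; split => // g' hg.
have [h1 h2] : g' - g < al /\ g - g' < al.
  by split; [exact: le_lt_trans (ler_norm _) hg|rewrite distrC in hg; exact: le_lt_trans (ler_norm _) hg].
pose al' := al - `|g' - g|.
have al'0 : 0 < al' by rewrite subr_gt0.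
have hS' s t X : s <= t -> S s X -> N (Phi t s X) <= K * expR ((g' - al') * (t - s)) * N X.
  move=> st SX; apply: le_trans (hS _ _ _ st SX) _.
  apply: ler_wpM2r => //; apply: ler_wpM2l; first exact: ltW.
  rewrite ler_expR; apply: ler_wpM2r; first by rewrite subr_ge0.
  by rewrite /al'; have := ler_norm (- (g' - g)); rewrite normrN; lra.
have hU' s t X : s <= t -> U s X -> K^-1 * expR ((g' + al') * (t - s)) * N X <= N (Phi t s X).
  move=> st UX; apply: le_trans (hU _ _ _ st UX).
  apply: ler_wpM2r => //; apply: ler_wpM2l; first by rewrite invr_ge0 ltW.
  rewrite ler_expR; apply: ler_wpM2r; first by rewrite subr_ge0.
  by rewrite /al'; have := ler_norm (g' - g); lra.
split; first by exists K, al', U, S.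
by move=> s; rewrite -(dich_slow K0 al'0 US hS' hU') -(dich_slow K0 al0 US hS hU).
Qed.

(** The same splitting serves for all rates in between: the stable estimate of the
    smaller rate and the unstable estimate of the larger one hold for it. *)
Lemma ed_between g g' mu : ed g -> ed g' -> (forall s, slow g s = slow g' s) ->
  g <= mu <= g' -> ed mu.
Proof.
move=> [K [al [U [S [K0 al0 US hS hU]]]]] [K' [al' [U' [S' [K'0 al'0 US' hS' hU']]]]] eq_s /andP[g1 g2].
have SS s : S s = S' s by rewrite (dich_slow K0 al0 US hS hU) (dich_slow K'0 al'0 US' hS' hU').
pose K2 := Num.max K K'; pose al2 := Num.min al al'.
have K20 : 0 < K2 by rewrite lt_max K0.
have al20 : 0 < al2 by rewrite lt_min al0.
have KK : K <= K2 by rewrite le_max lexx.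
have KK' : K' <= K2 by rewrite le_max lexx orbT.
have aa : al2 <= al by rewrite ge_min lexx.
have aa' : al2 <= al' by rewrite ge_min lexx orbT.
exists K2, al2, U', S'; split => //.
- move=> s t X st; rewrite -SS => SX; apply: le_trans (hS _ _ _ st SX) _.
  apply: ler_wpM2r => //; apply: ler_pM; [exact: ltW|exact: expR_ge0|by []|].
  rewrite ler_expR; apply: ler_wpM2r; first by rewrite subr_ge0.
  lra.
- move=> s t X st UX; apply: le_trans (hU' _ _ _ st UX).
  apply: ler_wpM2r => //; apply: ler_pM; [by rewrite invr_ge0 ltW|exact: expR_ge0| |].
    by rewrite lef_pV2 ?posrE.
  rewrite ler_expR; apply: ler_wpM2r; first by rewrite subr_ge0.
  lra.
Qed.

Lemma ed_low g : g <= - L - 1 -> ed g /\ forall s, slow g s = Z s.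
Proof.
move=> gl.
have US (t : R) : ms_direct_sum P W t (E t) (Z t).
  split.
  - split => //; first by move=> X [].
    by move=> c X Y; exact: combE.
  - split => //; first by move=> X [].
    move=> c X Y /zeroP[hX nX] /zeroP[hY nY]; apply/zeroP; split; first exact: combE.
    apply/eqP; rewrite eq_le N0 andbT.
    by apply: le_trans (ms_norm_comb Pc hW c hX hY) _; rewrite nX nY mulr0 addr0.
  - move=> X hX; exists X, (fun=> 0); split => //.
    by apply/funext => w; rewrite addr0.
  - by apply/seteqP; split => [X []//|X hX]; split => //; case: hX.
have hS s t X : s <= t -> Z s X -> N (Phi t s X) <= 2 * expR ((g - 1) * (t - s)) * N X.
  move=> st /zeroP[hX nX]; rewrite nX mulr0.
  by have [_] := phi_growth st hX; rewrite nX mulr0.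
have hU s t X : s <= t -> E s X -> 2^-1 * expR ((g + 1) * (t - s)) * N X <= N (Phi t s X).
  move=> st hX; have [h _] := phi_growth st hX.
  have ep : 0 < expR (L * (t - s)) := expR_gt0 _.
  apply: (@le_trans _ _ (2^-1 * expR (- (L * (t - s))) * N X)).
    apply: ler_wpM2r => //; apply: ler_wpM2l => //; rewrite ler_expR -mulNr.
    by apply: ler_wpM2r; [rewrite subr_ge0|lra].
  rewrite expRN -invfM mulrC ler_pdivrMr ?mulr_gt0// mulrC.
  exact: h.
have two0 : (0 : R) < 2 by [].
split; first by exists 2, 1, E, Z.
by move=> s; rewrite -(dich_slow two0 ltr01 US hS hU).
Qed.

Lemma ed_high g : L + 1 <= g -> ed g /\ forall s, slow g s = E s.
Proof.
move=> gl.
have US (t : R) : ms_direct_sum P W t (Z t) (E t).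
  split.
  - split => //; first by move=> X [].
    move=> c X Y /zeroP[hX nX] /zeroP[hY nY]; apply/zeroP; split; first exact: combE.
    apply/eqP; rewrite eq_le N0 andbT.
    by apply: le_trans (ms_norm_comb Pc hW c hX hY) _; rewrite nX nY mulr0 addr0.
  - split => //; first by move=> X [].
    by move=> c X Y; exact: combE.
  - move=> X hX; exists (fun=> 0), X; split => //.
    by apply/funext => w; rewrite add0r.
  - by apply/seteqP; split => [X []//|X hX]; split => //; case: hX.
have hS s t X : s <= t -> E s X -> N (Phi t s X) <= 2 * expR ((g - 1) * (t - s)) * N X.
  move=> st hX; have [_ h] := phi_growth st hX; apply: le_trans h _.
  apply: ler_wpM2r => //; apply: ler_wpM2l => //; rewrite ler_expR.
  by apply: ler_wpM2r; [rewrite subr_ge0|lra].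
have hU s t X : s <= t -> Z s X -> 2^-1 * expR ((g + 1) * (t - s)) * N X <= N (Phi t s X).
  by move=> st /zeroP[hX nX]; rewrite nX mulr0.
have two0 : (0 : R) < 2 by [].
split; first by exists 2, 1, Z, E.
by move=> s; rewrite -(dich_slow two0 ltr01 US hS hU).
Qed.

Lemma slow_subspace g s : ms_subspace P W s (slow g s).
Proof.
split => [X []//|X /zeroP[hX nX]|c X Y [hX [K hK]] [hY [K' hK']]].
  split => //; exists 0 => t st; rewrite mul0r.
  by have [_] := phi_growth st hX; rewrite nX mulr0.
split; first exact: combE.
exists (`|c| * K + K') => t st; apply: le_trans (phi_norm_comb c st hX hY) _.
rewrite mulrDl -mulrA; apply: lerD; last exact: hK'.
by apply: ler_wpM2l => //; exact: hK.
Qed.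

(** * Propagation of the equality of slow spaces in time *)

(** The moment relation for the two vectors with coefficients 1 and -1. *)
Lemma norm_sgram s X Y : E s X -> E s Y ->
  (forall k l, sgram X k l = sgram Y k l) ->
  forall t, s <= t -> N (Phi t s X) = N (Phi t s Y).
Proof.
move=> hX hY h t st.
pose x (b : bool) := if b then X else Y.
pose c (b : bool) : R := if b then 1 else -1.
have hx b : E s (x b) by case: b.
have dep k l : \sum_b c b * sgram (x b) k l = 0.
  by rewrite big_bool /= h mul1r mulN1r subrr.
have := phi_moment hx dep st.
rewrite big_bool /= mul1r mulN1r => /eqP; rewrite subr_eq0 => /eqP e.
by apply/eqP; rewrite -(eqrXn2 (ltn0Sn 1)) ?e.
Qed.

Lemma norm_phi_id s X : E s X -> N (Phi s s X) = N X.
Proof.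
move=> hX; apply: ms_norm_ae.
- exact: (ms_space_measurable Pc hW (phi_space (lexx s) hX)).
- exact: (ms_space_measurable Pc hW hX).
- exact: (phi_id hX).
Qed.

(** The constant does not depend on t and s: the image of X is at most twice as long
    as X, and the factor e^(|b|) accounts for the time s - t <= 1 that is lost. *)
Lemma expanding_image K b t s X : 0 < K -> t <= s -> s - t <= half_time -> s - t <= 1 ->
  E t X ->
  (forall r, t <= r -> K^-1 * expR (b * (r - t)) * N X <= N (Phi r t X)) ->
  forall r, s <= r ->
    (2 * K * expR `|b|)^-1 * expR (b * (r - s)) * N (Phi s t X) <= N (Phi r s (Phi s t X)).
Proof.
move=> K0 ts sh s1 hX h r sr; rewrite (phi_cocycle_norm ts sr hX).
apply: le_trans (h r (le_trans ts sr)).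
have [_ h2] := phi_half ts sh hX.
have Kp : 0 < K^-1 by rewrite invr_gt0.
have -> : (2 * K * expR `|b|)^-1 * expR (b * (r - s)) * N (Phi s t X) =
  K^-1 * (expR (- `|b|) * expR (b * (r - s))) * (2^-1 * N (Phi s t X)).
  by rewrite expRN !invfM; ring.
apply: ler_pM => //.
- by rewrite !mulr_ge0 ?expR_ge0// ltW.
- by rewrite mulr_ge0.
- apply: ler_wpM2l; first exact: ltW.
  rewrite -expRD ler_expR.
  have e : b * (r - t) = b * (r - s) + b * (s - t) by ring.
  have : - b * (s - t) <= `|b| * (s - t).
    by apply: ler_wpM2r; [rewrite subr_ge0|have := ler_norm (- b); rewrite normrN].
  have : `|b| * (s - t) <= `|b| * 1 by exact: ler_wpM2l.
  lra.
- by rewrite mulrC ler_pdivrMr// mulrC.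
Qed.

(** A vector X of the larger slow space at time s splits into a part slow at rate g
    and a part u in the unstable space of g, which is slow at rate g' as well.
    Replacing u by u' known at time t, with the same moments, one splits u' at time
    t for g' into p + q.  By the equality at time t the vector q is slow at rate g,
    so the image q' of q is slow at rate g, that is, in the stable space of g, and
    forms an angle with u'.  On the other hand the image p' of p expands and
    u' - q' is slow at rate g', so p' and u' - q' form an angle, although their
    difference Phi u' - u' is small.  Both together give N u' <= c sqrt (s - t) N u'
    with a fixed c, hence u' = 0 if s - t is small. *)
Lemma equal_forward g g' : g <= g' -> ed g -> ed g' -> exists de, [/\ 0 < de &
  forall t s, slow g t = slow g' t -> t <= s -> s - t <= de -> slow g s = slow g' s].
Proof.
move=> gg [K [al [U [S [K0 al0 US hS hU]]]]] [K' [al' [U' [S' [K'0 al'0 US' hS' hU']]]]].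
have Sg := dich_slow K0 al0 US hS hU; have Sg' := dich_slow K'0 al'0 US' hS' hU'.
have [M [M0 hM]] := dich_angle g K0 al0.
pose K2 := 2 * K' * expR `|g' + al'|.
have K'2 : K' <= K2.
  have := expR_ge1Dx `|g' + al'|; have := normr_ge0 (g' + al') => h1 h2.
  rewrite /K2 -[leLHS]mulr1 [2 * K']mulrC -mulrA; apply: ler_wpM2l; first exact: ltW.
  lra.
have K20 : 0 < K2 := lt_le_trans K'0 K'2.
have [M' [M'0 hM']] := dich_angle g' K20 al'0.
set c0 := small_const; have c00 : 0 <= c0 := small_const_ge0.
pose Q := M * (M' + 1) * c0.
have Q0 : 0 <= Q by apply: mulr_ge0 => //; apply: mulr_ge0 => //; exact: addr_ge0.
have Q1 : 0 < Q + 1 by rewrite ltr_pwDr.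
have H0 := half_time_gt0.
(* The last bound makes the final factor Q sqrt (s - t) at most Q / (Q + 1) < 1. *)
exists (Num.min (Num.min half_time 1) ((Q + 1)^-1 ^+ 2)).
split.
  rewrite lt_min; apply/andP; split; last by rewrite exprn_gt0 ?invr_gt0.
  by rewrite lt_min; apply/andP; split.
move=> t s est ts.
rewrite le_min => /andP[]; rewrite le_min => /andP[sh s1] sQ.
apply/seteqP; split; first exact: slow_mono.
move=> X sX.
have hX : E s X by case: sX.
have [u [v [Uu Sv Eu Ev XE]]] := dich_split US hX.
have sv : slow g' s v by apply: (slow_mono gg); rewrite -Sg.
have su : slow g' s u.
  have [_ _ h] := slow_subspace g' s.
  have := h (-1) v X sv sX; congr (slow g' s _); apply/funext => w.
  by rewrite XE scaleN1r addrCA addNr addr0.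
have [u' [Etu' gu]] := realization t Eu.
have Eu' : E s u' := monoE ts Etu'.
have nu r : s <= r -> N (Phi r s u') = N (Phi r s u) by exact: norm_sgram.
have nu0 : N u' = N u by rewrite -(norm_phi_id Eu) -(norm_phi_id Eu') nu.
have su' : slow g' s u'.
  by case: su => _ [k hk]; split => //; exists k => r sr; rewrite nu//; exact: hk.
have [p [q [Up Sq Ep Eq u'E]]] := dich_split US' Etu'.
have sq : slow g s (Phi s t q) by apply: slow_forward => //; rewrite est -Sg'.
have Ep' := phi_space ts Ep; have Eq' := phi_space ts Eq.
pose y w := u' w - Phi s t q w.
have sy : slow g' s y.
  have [_ _ h] := slow_subspace g' s.
  have := h (-1) _ _ (slow_mono gg sq) su'; congr (slow g' s _); apply/funext => w.
  by rewrite scaleN1r addrC.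
have Ey : E s y by case: sy.
have hy := subE Ep' Ey.
have ehalf : half_time <= small_time by rewrite ge_min lexx.
have small := phi_small ts (le_trans sh ehalf) Etu'.
have ne : N (fun w => Phi s t p w - y w) = N (fun w => (-1) *: u' w + Phi s t u' w).
  apply: ms_norm_ae.
  - exact: (ms_space_measurable Pc hW hy).
  - exact: (ms_space_measurable Pc hW (combE (-1) Eu' (phi_space ts Etu'))).
  - have e := phi_comb 1 ts Ep Eq.
    have e2 : (fun w => 1 *: p w + q w) = u' by rewrite u'E; apply/funext => w; rewrite scale1r.
    rewrite e2 in e.
    apply: filterS e => w ->.
    by rewrite /y scale1r scaleN1r opprB addrA addrC.
set e := (fun w => (-1) *: u' w + Phi s t u' w) in small ne.
have h1 : N (Phi s t p) <= M' * N e.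
  rewrite -ne; apply: (hM' s) => //.
    by move=> r sr; apply: expanding_image => // r0 tr0; exact: hU'.
  move=> r sr; rewrite -Sg' in sy; apply: le_trans (hS' _ _ _ sr sy) _.
  by apply: ler_wpM2r => //; apply: ler_wpM2r; rewrite ?expR_ge0.
have h2 : N y <= (M' + 1) * N e.
  have := norm_sub_le Ep' hy; rewrite ne (_ : (fun w => _) = y).
    by rewrite mulrDl mul1r; lra.
  by apply/funext => w; rewrite opprB addrC subrK.
have h3 : N u' <= M * N y.
  apply: (hM s) => //.
    by move=> r sr; rewrite nu// nu0; exact: hU.
  by move=> r sr; rewrite -Sg in sq; exact: hS.
have h4 : N u' <= Q * Num.sqrt (s - t) * N u'.
  have -> : Q * Num.sqrt (s - t) * N u' = M * ((M' + 1) * (c0 * Num.sqrt (s - t) * N u')) by rewrite /Q; ring.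
  apply: le_trans h3 _; apply: ler_wpM2l => //.
  apply: (le_trans h2); apply: ler_wpM2l; [by rewrite addr_ge0|exact: small].

have h5 : Num.sqrt (s - t) <= (Q + 1)^-1.
  have : Num.sqrt (s - t) <= Num.sqrt ((Q + 1)^-1 ^+ 2) by exact: ler_wsqrtr.
  by rewrite sqrtr_sqr ger0_norm// invr_ge0 ltW.
have u0 : N u = 0.
  rewrite -nu0; apply/eqP; rewrite eq_le N0 andbT.
  have h6 : Q * Num.sqrt (s - t) * N u' <= Q * (Q + 1)^-1 * N u'.
    by apply: ler_wpM2r => //; exact: ler_wpM2l.
  have h7 := le_trans h4 h6.
  have : (1 - Q * (Q + 1)^-1) * N u' <= 0 by rewrite mulrBl mul1r; lra.
  have -> : 1 - Q * (Q + 1)^-1 = (Q + 1)^-1 by field; rewrite gt_eqF.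
  by rewrite pmulr_rle0// invr_gt0.
have [_ zs h] := slow_subspace g s.
have zu : slow g s u by apply: zs; apply/zeroP.
have sv' : slow g s v by rewrite -Sg.
have := h 1 u v zu sv'; congr (slow g s _); apply/funext => w.
by rewrite XE scale1r.
Qed.

(** Forward in time by steps of the fixed length given by [equal_forward], backward
    by invariance. *)
Lemma equal_all_times g g' t : g <= g' -> ed g -> ed g' -> slow g t = slow g' t ->
  forall s, slow g s = slow g' s.
Proof.
move=> gg eg eg' et s.
have [de [de0 hde]] := equal_forward gg eg eg'.
have [ts|st] := leP t s.
  have ts0 : 0 <= s - t by rewrite subr_ge0.
  have [n [hn _]] := nat_steps ts0 de0.
  elim: n s ts {ts0} hn => [|n IH] s ts.
    by rewrite mul0r subr_le0 => st; have -> : s = t by apply/eqP; rewrite eq_le ts st.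
  rewrite -natr1 mulrDl mul1r => hs.
  have [small|big] := leP (s - t) (n%:R * de); first exact: IH.
  apply: (hde (t + n%:R * de)); last 2 first.
  - by rewrite -lerBrDl ltW.
  - by rewrite opprD addrA lerBlDl.
  apply: IH; first by rewrite lerDl mulr_ge0// ltW.
  by rewrite addrC addKr.
apply/seteqP; split => X sX; first exact: (slow_mono gg).
have EX : E s X by case: sX.
apply: (slow_backward (ltW st) EX).
by rewrite et; exact: (slow_forward (ltW st)).
Qed.

(** * The length of chains of slow spaces *)

(** Two symmetric matrices of size d fit into one matrix with d rows and d + 1
    columns: the lower triangle, diagonal included, holds (E X)(E X)^T, and the part
    strictly above the diagonal holds the upper triangle of E X X^T, shifted by one
    column. *)
Definition moments (X : T -> 'cV[R]_d) : 'M[R]_(d, d.+1) :=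
  \matrix_(i, j) (if (j <= i)%N then sgram X (inr i) (inr (insubd i (j : nat)))
                  else sgram X (inl i) (inl (insubd i (j : nat).-1))).

Lemma moments_sgram (I : finType) (c : I -> R) (x : I -> T -> 'cV[R]_d) s :
  (forall i, E s (x i)) -> \sum_i c i *: moments (x i) = 0 ->
  forall k l, \sum_i c i * sgram (x i) k l = 0.
Proof.
move=> hx h.
have entry i (j : 'I_d.+1) : \sum_r c r * moments (x r) i j = 0.
  have := congr1 (fun Q : 'M[R]_(d, d.+1) => Q i j) h; rewrite summxE [in RHS]mxE => e; rewrite -[RHS]e.
  by apply: eq_bigr => r _; rewrite [in RHS]mxE.
have sub (i : 'I_d) (k : 'I_d) : insubd i (k : nat) = k.
  by apply: val_inj; rewrite val_insubd ltn_ord.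
have means_le (i j : 'I_d) : (j <= i)%N -> \sum_r c r * sgram (x r) (inr i) (inr j) = 0.
  move=> ji; have jd : (j < d.+1)%N by rewrite ltnS ltnW.
  rewrite -[RHS](entry i (Ordinal jd)); apply: eq_bigr => r _.
  by rewrite mxE /= ji sub.
have means (i j : 'I_d) : \sum_r c r * sgram (x r) (inr i) (inr j) = 0.
  have [ji|/ltnW ij] := leqP j i; first exact: means_le.
  by rewrite -[RHS](means_le _ _ ij); apply: eq_bigr => r _; rewrite sgram_sym.
have comps_le (i j : 'I_d) : (i <= j)%N -> \sum_r c r * sgram (x r) (inl i) (inl j) = 0.
  move=> ij; have jd : (j.+1 < d.+1)%N by rewrite ltnS.
  rewrite -[RHS](entry i (Ordinal jd)); apply: eq_bigr => r _.
  by rewrite mxE /= ltnNge ij /= sub.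
have comps (i j : 'I_d) : \sum_r c r * sgram (x r) (inl i) (inl j) = 0.
  have [ij|/ltnW ji] := leqP i j; first exact: comps_le.
  by rewrite -[RHS](comps_le _ _ ji); apply: eq_bigr => r _; rewrite sgram_sym.
have mixed (i j : 'I_d) : \sum_r c r * sgram (x r) (inl i) (inr j) = 0.
  rewrite -[RHS](means i j); apply: eq_bigr => r _.
  by rewrite (sgram_lr _ _ (hx r)) sgram_rr.
case=> i [] j //.
by rewrite -[RHS](mixed j i); apply: eq_bigr => r _; rewrite sgram_sym.
Qed.

(** The relation for the squared norms expresses that of the last vector with a
    nonzero coefficient by those of the preceding ones. *)
Lemma slow_dependent n (c : 'I_n -> R) (x : 'I_n -> T -> 'cV[R]_d) g s (k : 'I_n) :
  (forall i, E s (x i)) -> (forall i : 'I_n, (i < k)%N -> slow g s (x i)) ->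
  c k != 0 -> (forall i : 'I_n, (k < i)%N -> c i = 0) ->
  \sum_i c i *: moments (x i) = 0 -> slow g s (x k).
Proof.
move=> hx hs ck hc dep; split; first exact: hx.
have /choice[K hK] : forall i : 'I_n, exists K, 0 <= K /\
    ((i < k)%N -> forall t, s <= t -> N (Phi t s (x i)) <= K * expR (g * (t - s))).
  move=> i; have [ik|ik] := boolP (i < k)%N; last by exists 0.
  have [_ [K hK]] := hs i ik; exists K; split => //.
  by have := hK s (lexx s); rewrite subrr mulr0 expR0 mulr1; exact: le_trans.
pose Q := \sum_(i < n) `|c i| / `|c k| * K i ^+ 2.
have Q0 : 0 <= Q by apply: sumr_ge0 => i _; rewrite mulr_ge0 ?sqr_ge0 ?divr_ge0.
exists (Num.sqrt Q) => t st.
have e0 := expR_ge0 (g * (t - s)).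
rewrite -(ler_pXn2r (ltn0Sn 1)) ?nnegrE ?mulr_ge0 ?sqrtr_ge0// exprMn (sqr_sqrtr Q0).
have := phi_moment hx (moments_sgram hx dep) st.
rewrite (bigD1 k) //= => /eqP; rewrite addr_eq0 => /eqP e.
rewrite -(ler_pM2l (_ : 0 < `|c k|)) ?normr_gt0//.
have -> : `|c k| * N (Phi t s (x k)) ^+ 2 = `|c k * N (Phi t s (x k)) ^+ 2|.
  by rewrite normrM [`|_ ^+ 2|]ger0_norm ?sqr_ge0.
rewrite e normrN; apply: le_trans (ler_norm_sum _ _ _) _.
apply: (@le_trans _ _ (\sum_(i < n) `|c i| * (K i * expR (g * (t - s))) ^+ 2)).
  rewrite [leRHS](bigD1 k) //= ler_wpDl//; first by rewrite mulr_ge0// sqr_ge0.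
  apply: ler_sum => i ik; rewrite normrM [`|_ ^+ 2|]ger0_norm ?sqr_ge0//.
  have [ki|ik'|eik] := ltngtP k i.
  - by rewrite hc// normr0 !mul0r.
  - apply: ler_wpM2l => //; have [Ki hKi] := hK i.
    by rewrite ler_pXn2r ?nnegrE ?mulr_ge0//; exact: hKi.
  - by rewrite (val_inj eik) eqxx in ik.
rewrite /Q mulr_suml mulr_sumr; apply: ler_sum => i _; rewrite exprMn.
by rewrite le_eqVlt; apply/orP; left; apply/eqP; field; rewrite normr_eq0.
Qed.

Lemma chain_bound s n (g : nat -> R) : (forall i, (i < n)%N -> g i <= g i.+1) ->
  (forall i, (i < n)%N -> slow (g i) s <> slow (g i.+1) s) -> (n <= d * (d + 1))%N.
Proof.
move=> gm hne; rewrite leqNgt; apply/negP => big.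
have g_le i j : (i <= j <= n)%N -> g i <= g j.
  elim: j => [|j IH]; first by rewrite leqn0 => /andP[/eqP->].
  move=> /andP[]; rewrite leq_eqVlt ltnS => /orP[/eqP->//|ij] jn.
  by apply: le_trans (gm j jn); apply: IH; rewrite ij ltnW.
have /choice[X hX] : forall i : 'I_n, exists X, slow (g i.+1) s X /\ ~ slow (g i) s X.
  move=> i; apply: contrapT => no; apply: (hne i) => //.
  apply/seteqP; split; first by apply: slow_mono; exact: gm.
  by move=> X sX; apply: contrapT => nX; apply: no; exists X.
have EX i : E s (X i) by case: (hX i) => [[]].
pose Q : 'M[R]_(n, d * d.+1) := \matrix_i mxvec (moments (X i)).
have : kermx Q != 0.
  rewrite kermx_eq0 /row_free neq_ltn; apply/orP; left.
  by apply: leq_ltn_trans (rank_leq_col Q) _; move: big; rewrite addn1.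
move=> /rowV0Pn[c /sub_kermxP cQ c0].
have dep : \sum_i c 0 i *: moments (X i) = 0.
  apply: (can_inj mxvecK); rewrite linear0 -[RHS]cQ linear_sum mulmx_sum_row.
  by apply: eq_bigr => i _; rewrite linearZ rowK.
have [i0 ci0] : exists i, c 0 i != 0.
  apply/existsP; apply: contraR c0; rewrite negb_exists => /forallP h.
  by apply/eqP/rowP => i; rewrite mxE; apply/eqP; rewrite -[_ == _]negbK.
have [k ck hk] := @arg_maxnP _ i0 (fun i => c 0 i != 0) (fun i : 'I_n => i : nat) ci0.
have [_ ns] := hX k; apply: ns.
apply: (@slow_dependent n (fun i => c 0 i)) => // i.
  by move=> ik; have [h _] := hX i; apply: slow_mono h; apply: g_le; rewrite ik ltnW.
by move=> ki; apply/eqP; apply: contraTT ki => /hk; rewrite -leqNgt.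
Qed.

Lemma space_neq_zero s : (0 < d)%N -> E s <> Z s.
Proof.
move=> d0 eEZ.
pose x : T -> 'cV[R]_d := fun=> const_mx 1.
have Ex : E s x.
  apply/(ms_spaceP Pc hW) => i.
  have -> : (fun w => x w i 0) = cst 1 by apply/funext => w; rewrite mxE.
  exact: L2at_cst.
have /zeroP[_ nx] : Z s x by rewrite -eEZ.
have := ms_norm_sq (fun i => ms_space_sqint Pc hW i Ex); rewrite nx expr0n /=.
have one (i : 'I_d) : ip P (fun w => x w i 0) (fun w => x w i 0) = 1.
  have -> : (fun w => x w i 0) = cst 1 by apply/funext => w; rewrite mxE.
  by rewrite ip_cst mulr1.
under eq_bigr do rewrite one.
rewrite sumr_const card_ord => /esym/eqP; rewrite pnatr_eq0.
by rewrite eqn0Ngt d0.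
Qed.

End MeanFieldFlow.

(** * From locally constant filtrations to spectral intervals *)

Section ResolventIntervals.
Variables (R : realType) (X : Type) (rho : set R) (F : R -> set X).
Variables (bot top : set X) (l h : R) (bound : nat).

(** In the application rho is the resolvent set and F g the space of slow vectors at
    rate g and at a fixed time. *)
Definition strict_chain n (g : nat -> R) :=
  forall i, (i < n)%N -> g i <= g i.+1 /\ F (g i) <> F (g i.+1).

Hypothesis F_mono : forall x y, x <= y -> F x `<=` F y.
Hypothesis rho_open : forall x, rho x -> exists a, [/\ 0 < a &
  forall y, `|y - x| < a -> rho y /\ F y = F x].
Hypothesis rho_convex : forall x y z, rho x -> rho y -> F x = F y -> x <= z <= y -> rho z.
Hypothesis rho_low : forall x, x <= l -> rho x /\ F x = bot.
Hypothesis rho_high : forall x, h <= x -> rho x /\ F x = top.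
Hypothesis bot_top : bot <> top.
Hypothesis bounded : forall n g, strict_chain n g -> (n <= bound)%N.

Let F_squeeze x y z : x <= z <= y -> F x = F y -> F z = F x.
Proof.
move=> /andP[xz zy] e; apply/seteqP; split; last exact: F_mono.
by rewrite e; exact: F_mono.
Qed.

Definition resolvent_chain n (g : nat -> R) :=
  [/\ forall i, (i <= n)%N -> rho (g i), strict_chain n g, F (g 0%N) = bot & F (g n) = top].

Let chain_le n g : strict_chain n g -> forall i j, (i <= j <= n)%N -> g i <= g j.
Proof.
move=> c i; elim=> [|j IH]; first by rewrite leqn0 => /andP[/eqP->].
move=> /andP[]; rewrite leq_eqVlt ltnS => /orP[/eqP->//|ij] jn.
by apply: le_trans (c j jn).1; apply: IH; rewrite ij ltnW.
Qed.

Let insert (g : nat -> R) k x j := if (j <= k)%N then g j else if j == k.+1 then x else g j.-1.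

Let chain_insert n g k x : strict_chain n g -> (k < n)%N -> g k <= x <= g k.+1 ->
  F x <> F (g k) -> F x <> F (g k.+1) -> strict_chain n.+1 (insert g k x).
Proof.
move=> c kn /andP[gx xg] n1 n2 j; rewrite ltnS /insert => jn.
case: (ltngtP j k) => [jk|kj|->].
- by apply: c; apply: ltn_trans kn.
- case: (eqVneq j k.+1) => [->|jk].
    by rewrite gtn_eqF//=; split => //; exact: nesym.
  have [i ji] : exists i, j = i.+1 by exists j.-1; lia.
  rewrite ji /= in jn kj jk *.
  have -> : (i.+2 == k.+1)%N = false by lia.
  by apply: c; lia.
- by rewrite eqxx; split => //; exact: nesym.
Qed.

(** In a chain of maximal length every value of F on rho occurs: a resolvent rate with
    a new value could be inserted. *)
Lemma maximal_chain : exists n g, [/\ (1 <= n <= bound)%N, resolvent_chain n g &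
  forall x, rho x -> exists i, (i <= n)%N /\ F x = F (g i)].
Proof.
have lh : l <= h.
  rewrite leNgt; apply/negP => hl; apply: bot_top.
  by rewrite -(rho_low (lexx l)).2 -(rho_high (ltW hl)).2.
have ex1 : exists n, `[< exists g, resolvent_chain n g >].
  exists 1%N; apply/asboolP; exists (fun i => if i is 0%N then l else h).
  have [rl Fl] := rho_low (lexx l); have [rh Fh] := rho_high (lexx h).
  split => //; first by case.
  by case=> // _; split => //; rewrite Fl Fh.
have ub n : `[< exists g, resolvent_chain n g >] -> (n <= bound)%N.
  by move=> /asboolP[g [_ c _ _]]; exact: bounded c.
case: (ex_maxnP ex1 ub) => n /asboolP[g rc] nmax.
have [rg c g0 gn] := rc.
exists n, g; split => //.
  rewrite (ub n) ?andbT; last by apply/asboolP; exists g.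
  by case: n gn {rc nmax rg c} => // gn; case: bot_top; rewrite -g0.
move=> x rx; apply: contrapT => no.
have nF i : (i <= n)%N -> F x <> F (g i) by move=> ni e; apply: no; exists i.
have x0 : g 0%N < x.
  rewrite ltNge; apply/negP => xg; apply: (nF 0%N) => //.
  apply/seteqP; split; first exact: F_mono.
  rewrite g0 -(rho_low (_ : Num.min x l <= l)).2; first by apply: F_mono; rewrite ge_min lexx.
  by rewrite ge_min lexx orbT.
have xn : x < g n.
  rewrite ltNge; apply/negP => xg; apply: (nF n) => //.
  apply/seteqP; split; last exact: F_mono.
  rewrite gn -(rho_high (_ : h <= Num.max x h)).2; first by apply: F_mono; rewrite le_max lexx.
  by rewrite le_max lexx orbT.
have [k [kn gx xg]] : exists k, [/\ (k < n)%N, g k <= x & x <= g k.+1].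
  have : exists k, (k <= n)%N && (x < g k) by exists n; rewrite leqnn.
  move=> exk; case: (ex_minnP exk) => -[|k] /andP[kn xk] kmin.
    by move: xk; rewrite ltNge ltW.
  exists k; split => //; last exact: ltW.
  rewrite leNgt; apply/negP => xk'.
  by have := kmin k; rewrite (ltnW kn) xk' ltnn => /(_ isT).
suff : (n.+1 <= n)%N by rewrite ltnn.
apply: nmax; apply/asboolP; exists (insert g k x); split.
- move=> j jn; rewrite /insert; case: ifP => jk; first by apply: rg; lia.
  by case: ifP => // jk'; apply: rg; lia.
- by apply: chain_insert; rewrite ?gx//; apply: nF => //; exact: ltnW.
- by rewrite /insert leq0n.
- by rewrite /insert leqNgt ltnS ltnW// eqSS gtn_eqF.
Qed.

(** For a maximal chain g the classes C i = { x in rho | F x = F (g i) } are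
    consecutive open intervals that cover rho.  The spectral intervals run from the
    supremum of one class to the infimum of the next. *)
Lemma resolvent_intervals : exists n (g a b : nat -> R), 
  [/\ (1 <= n <= bound)%N, resolvent_chain n g,
      forall i, (1 <= i <= n)%N -> a i <= b i,
      forall i, (1 <= i < n)%N -> b i < a i.+1 &
      ~` rho = \bigcup_(i in [set k | (1 <= k <= n)%N]) `[a i, b i]%classic /\
      forall i x, (1 <= i <= n)%N -> b i < x -> ((i < n)%N -> x < a i.+1) -> rho x /\ F x = F (g i)].
Proof.
have [n [g [hn rc cover]]] := maximal_chain.
have [rg c g0 gn] := rc.
pose C i := [set x | rho x /\ F x = F (g i)].
have Cg i : (i <= n)%N -> C i (g i) by move=> ni; split => //; exact: rg.
have C_open i x : C i x -> exists e, [/\ 0 < e, C i (x - e) & C i (x + e)].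
  move=> [rx Fx]; have [e [e0 he]] := rho_open rx; have e2 : 0 < e / 2 by rewrite divr_gt0.
  have [r1 F1] : rho (x - e / 2) /\ F (x - e / 2) = F x.
    by apply: he; rewrite addrAC subrr add0r normrN gtr0_norm//; lra.
  have [r2 F2] : rho (x + e / 2) /\ F (x + e / 2) = F x.
    by apply: he; rewrite addrAC subrr add0r gtr0_norm//; lra.
  by exists (e / 2); split => //; split; rewrite ?F1 ?F2.
have C_convex i x y z : C i x -> C i y -> x <= z <= y -> C i z.
  move=> [rx Fx] [ry Fy] xzy; have e : F x = F y by rewrite Fx Fy.
  split; first exact: rho_convex xzy.
  by rewrite (F_squeeze xzy e).
have C_lt i j x y : (i < j <= n)%N -> C i x -> C j y -> x < y.
  move=> /andP[ij jn] [_ Fx] [_ Fy]; rewrite ltNge; apply/negP => yx.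
  have [gi nFi] := c i (leq_trans ij jn); apply: nFi.
  apply/seteqP; split; first exact: F_mono.
  apply: (@subset_trans _ (F (g j))); first by apply/F_mono/(chain_le c); rewrite ij.
  by rewrite -Fy -Fx; exact: F_mono.
pose a i := sup (C i.-1); pose b i := inf (C i).
have sup_C i x : (1 <= i <= n)%N -> C i.-1 x -> x <= a i.
  move=> hi Cx; apply: ub_le_sup => //; exists (g i) => y Cy.
  by apply/ltW/(C_lt i.-1 i) => //; [lia|apply: Cg; lia].
have inf_C i x : (1 <= i <= n)%N -> C i x -> b i <= x.
  move=> hi Cx; apply: ge_inf => //; exists (g i.-1) => y Cy.
  by apply/ltW/(C_lt i.-1 i) => //; [lia|apply: Cg; lia].
have gap i x : (1 <= i <= n)%N -> b i < x -> ((i < n)%N -> x < a i.+1) -> C i x.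
  move=> hi bx xa.
  have ne : C i !=set0 by exists (g i); apply: Cg; lia.
  have [y Cy yx] := inf_lt ne bx.
  have [ni|] := ltnP i n.
    by have [z Cz xz] := sup_gt ne (xa ni); apply: (C_convex _ _ _ _ Cy Cz); rewrite !ltW.
  move=> ni; have ein : i = n by lia.
  have hx : h <= Num.max x h by rewrite le_max lexx orbT.
  have [rz Fz] := rho_high hx.
  apply: (C_convex i y (Num.max x h)) => //; first by split; rewrite // ein gn.
  by rewrite (ltW yx) le_max lexx.
have low x : x < a 1%N -> C 0%N x.
  move=> xa; have ne : C 0%N !=set0 by exists (g 0%N); exact: Cg.
  have [z Cz xz] := sup_gt ne xa.
  have xl : Num.min x l <= l by rewrite ge_min lexx orbT.
  have [ry Fy] := rho_low xl.
  apply: (C_convex 0%N (Num.min x l) z) => //; first by split; rewrite // g0.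
  by rewrite (ltW xz) ge_min lexx.
exists n, g, a, b; split => //.
- move=> i hi; apply: ge_sup; first by exists (g i.-1); apply: Cg; lia.
  move=> x Cx; apply: lb_le_inf; first by exists (g i); apply: Cg; lia.
  by move=> y Cy; apply/ltW/(C_lt i.-1 i) => //; lia.
- move=> i hi.
  have [|e [e0 Cm Cp]] := C_open i (g i); first by apply: Cg; lia.
  have h1 : b i <= g i - e by apply: inf_C => //; lia.
  have h2 : g i + e <= a i.+1 by apply: sup_C => //; lia.
  lra.
split; last exact: gap.
apply/seteqP; split => x.
  move=> nrx; have a1 : a 1%N <= x.
    by rewrite leNgt; apply/negP => /low[].
  suff H k i : (i + k = n)%N -> (1 <= i)%N -> a i <= x ->
      exists2 j, (1 <= j <= n)%N & a j <= x <= b j.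
    have n1 : (1 + n.-1 = n)%N by lia.
    have [j hj xj] := H n.-1 1%N n1 isT a1.
    by exists j => //; rewrite /= in_itv.
  elim: k i => [|k IH] i ik i1 ai.
    exists i; first lia.
    rewrite ai leNgt; apply/negP => bx; apply: nrx.
    have hi : (1 <= i <= n)%N by lia.
    have ni : (i < n)%N -> x < a i.+1 by lia.
    by case: (gap i x hi bx ni).
  have [xb|bx] := leP x (b i); first by exists i; [lia|rewrite ai].
  have [xa|ax] := ltP x (a i.+1); last by apply: (IH i.+1) => //; lia.
  have hi : (1 <= i <= n)%N by lia.
  by case: nrx; case: (gap i x hi bx (fun=> xa)).
move=> [i /= hi]; rewrite in_itv /= => /andP[ax xb] rx.
have [j [jn Fx]] := cover x rx.
have [e [e0 Cm Cp]] := C_open j x (conj rx Fx).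
have [ij|ji] := leqP i j.
  suff : b i <= x - e by lra.
  have [eij|nij] := eqVneq i j; first by apply: inf_C; rewrite // eij.
  apply: (@le_trans _ _ (g i)); first by apply: inf_C => //; apply: Cg; lia.
  by apply/ltW/(C_lt i j) => //; [lia|apply: Cg; lia].
suff : x + e <= a i by lra.
have [eij|nij] := eqVneq j i.-1; first by apply: sup_C; rewrite // -eij.
apply: (@le_trans _ _ (g i.-1)); last by apply: sup_C => //; apply: Cg; lia.
by apply/ltW/(C_lt j i.-1) => //; [lia|apply: Cg; lia].
Qed.

End ResolventIntervals.

(** * The dichotomy spectrum *)

Theorem theorem9 (disp : measure_display) (T : measurableType disp)
  (R : realType) (P : probability T R) (W : R -> T -> R)
  (d : nat) (A B C D : R -> 'M[R]_d) (m : R)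
  (Phi : R -> R -> (T -> 'cV[R]_d) -> (T -> 'cV[R]_d))
  (P_complete : measure_is_complete P)
  (W_wiener : two_sided_wiener P W)
  (d_gt0 : (0 < d)%N)
  (A_cont : continuous A) (B_cont : continuous B)
  (C_cont : continuous C) (D_cont : continuous D)
  (m_gt0 : 0 < m)
  (ABCD_bounded : forall (i j : 'I_d) (t : R),
     [/\ `|A t i j| <= m, `|B t i j| <= m, `|C t i j| <= m & `|D t i j| <= m])
  (Phi_generated : ms_rds_generated P W A B C D Phi) :
  exists (n : nat) (a b : nat -> R),
  [/\ (1 <= n <= d * (d + 1))%N,
      (forall i, (1 <= i <= n)%N -> a i <= b i),
      (forall i, (1 <= i < n)%N -> b i < a i.+1),
      dichotomy_spectrum P W Phi =
        \bigcup_(i in [set k | (1 <= k <= n)%N]) `[a i, b i]%classic &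
      forall s : R, exists V : nat -> set (T -> 'cV[R]_d),
      [/\ (forall i, (1 <= i <= n)%N -> ms_subspace P W s (V i)),
          V 0%N = ms_zero P W (d := d) s,
          (forall i, (i < n)%N -> V i `<` V i.+1),
          V n = ms_space P W (d := d) s &
          forall i, (1 <= i <= n)%N -> forall X, ms_space P W s X ->
            (V i X <->
             forall eps : R, 0 < eps -> exists K : R, 0 < K /\
               forall t, s <= t ->
                 ms_norm P (Phi t s X) <= K * expR ((b i + eps) * (t - s)))]].
Proof.
have m0 := ltW m_gt0.
set ed := exponential_dichotomy P W Phi; pose L := @growth_rate R d m.
pose sl (g t : R) := slow P W Phi g t.
have eq_all g g' t : ed g -> ed g' -> sl g t = sl g' t -> forall s, sl g s = sl g' s.
  move=> eg eg' e; have [gg|/ltW gg] := leP g g'.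
    exact: (equal_all_times P_complete W_wiener A_cont B_cont C_cont D_cont m0 ABCD_bounded Phi_generated gg eg eg' e).
  move=> s; apply/esym.
  exact: (equal_all_times P_complete W_wiener A_cont B_cont C_cont D_cont m0 ABCD_bounded Phi_generated gg eg' eg (esym e)).
have low x : x <= - L - 1 -> ed x /\ forall t, sl x t = ms_zero P W t.
  exact: (ed_low P_complete W_wiener A_cont B_cont C_cont D_cont m0 ABCD_bounded Phi_generated).
have high x : L + 1 <= x -> ed x /\ forall t, sl x t = ms_space P W t.
  exact: (ed_high P_complete W_wiener A_cont B_cont C_cont D_cont m0 ABCD_bounded Phi_generated).
have eopen x : ed x -> exists e, [/\ 0 < e &
    forall y, `|y - x| < e -> ed y /\ sl y 0 = sl x 0].
  move=> ex; have [e [e0 he]] := ed_open P_complete W_wiener A_cont B_cont m0 ABCD_bounded Phi_generated ex.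
  by exists e; split => // y /he[ey h]; split => //; exact: h.
have econvex x y z : ed x -> ed y -> sl x 0 = sl y 0 -> x <= z <= y -> ed z.
  move=> ex ey /(eq_all _ _ _ ex ey) e.
  exact: (ed_between P_complete W_wiener A_cont B_cont m0 ABCD_bounded Phi_generated ex ey e).
have elow x (h : x <= - L - 1) : ed x /\ sl x 0 = ms_zero P W 0.
  by have [ex ->] := low x h.
have ehigh x (h : L + 1 <= x) : ed x /\ sl x 0 = ms_space P W 0.
  by have [ex ->] := high x h.
have [n [g [a [b [hn [rg c g0 gn] ab ba [spec gap]]]]]] :=
  resolvent_intervals (fun x y => @slow_mono _ _ _ P W d Phi x y 0) eopen econvex elow ehigh
    (fun e => space_neq_zero P_complete W_wiener d_gt0 (esym e))
    (fun k f h => chain_bound P_complete W_wiener A_cont B_cont C_cont D_cont m0 ABCD_bounded Phi_generated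
        (fun i ik => (h i ik).1) (fun i ik => (h i ik).2)).
have sl0 s : sl (g 0%N) s = ms_zero P W s.
  have [el <-] := low _ (lexx _); apply: (eq_all _ _ 0) => //; first exact: rg.
  exact: etrans g0 (esym ((low _ (lexx _)).2 0)).
have sln s : sl (g n) s = ms_space P W s.
  have [eh <-] := high _ (lexx _); apply: (eq_all _ _ 0) => //; first exact: rg.
  exact: etrans gn (esym ((high _ (lexx _)).2 0)).
exists n, a, b; split => // s; exists (fun i => sl (g i) s); split => //.
- by move=> i _; exact: (slow_subspace P_complete W_wiener A_cont B_cont C_cont D_cont m0 ABCD_bounded Phi_generated).
- move=> i ni; have [gi ne] := c i ni; split; first exact: slow_mono.
  move=> sub; apply: ne; apply: (eq_all _ _ s); [by apply: rg; lia|by apply: rg; lia|].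
  by apply/seteqP; split => //; exact: slow_mono.
move=> i hi X EX.
(* Rates just above b i lie in the resolvent set and have the same slow space as g i. *)
have rate eps : 0 < eps -> exists x, b i < x <= b i + eps /\ sl x s = sl (g i) s.
  move=> e0; pose x := if (i < n)%N then Num.min (b i + eps) ((b i + a i.+1) / 2) else b i + eps.
  have hx : [/\ b i < x, x <= b i + eps & (i < n)%N -> x < a i.+1].
    rewrite /x; have [ni|] := boolP (i < n)%N; last by split => //; rewrite ltrDl.
    have bai : b i < a i.+1 by apply: ba; lia.
    split=> [||_]; rewrite ?lt_min ?ge_min ?gt_min ?lexx// ?ltrDl ?e0 /=; last first.
      by apply/orP; right; lra.
    lra.
  have [bx xe xa] := hx; have [ex Fx] := gap i x hi bx xa.
  exists x; rewrite bx xe; split => //; apply: (eq_all _ _ 0) => //; apply: rg; lia.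
split=> [sX eps e0|h].
  have [x [/andP[_ xe] ex]] := rate eps e0.
  have : sl (b i + eps) s X by apply: (slow_mono xe); rewrite -/(sl x s) ex.
  move=> [_ [K hK]]; exists (`|K| + 1); split; first by rewrite ltr_pwDr.
  move=> t st; apply: le_trans (hK t st) _; apply: ler_wpM2r; first exact: expR_ge0.
  by apply: le_trans (ler_norm K) _; rewrite lerDl.
have [x [/andP[bx _] ex]] := rate 1 ltr01.
rewrite -ex; split => //; have [|K [_ hK]] := h (x - b i); first by rewrite subr_gt0.
by exists K => t st; have := hK t st; rewrite addrC subrK.
Qed.
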